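(* Let $W$ be a compact metric space, and let $G\curvearrowright(B,\nu)$ be any $\mu$-stationary, essentially free extension of the Poisson boundary $\Pi(G,\mu)$. Then $\mathrm{Fact}((B,\nu),W^G)$ is dense in $\mathcal{P}_\mu(W^G)$.
   Context: $G$ is a countably infinite discrete group, $\mu$ a probability measure on $G$ whose support generates $G$ as a semigroup. $G$ acts on $W^G$ (product topology) by $(gx)(k)=x(g^{-1}k)$; $\mathcal{P}_\mu(W^G)$ is the set of Borel probability measures $\eta$ on $W^G$ with $\sum_g\mu(g)g_*\eta=\eta$, weak* topology. A $\mu$-stationary action $G\curvearrowright(B,\nu)$ means $\sum_g\mu(g)g_*\nu=\nu$. The Poisson boundary $\Pi(G,\mu)=(B_0,\beta)$ is the Mackey realization of the shift-invariant $\sigma$-algebra of the random walk $(g_1,g_1g_2,\dots)$ with i.i.d. $\mu$-increments, with induced $G$-action and measure. An extension of the Poisson boundary is an action admitting a $G$-equivariant measurable map to $B_0$ pushing the measure to $\beta$. Essentially free: every $g\neq e$ has a null fixed-point set. $\mathrm{Fact}((B,\nu),W^G)$ is the set of $\eta\in\mathcal{P}_\mu(W^G)$ of the form $\eta=\pi_*\nu$ for some $G$-equivariant Borel map $\pi:B\to W^G$. *)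

(* Defs.v *)
From HB Require Import structures.
From mathcomp Require Import all_boot all_order all_algebra.
From mathcomp Require Import all_classical all_reals all_analysis.

Set Implicit Arguments.
Unset Strict Implicit.
Unset Printing Implicit Defensive.

Import Order.TTheory GRing.Theory Num.Theory.
Import numFieldNormedType.Exports.
Local Open Scope classical_set_scope.
Local Open Scope ring_scope.

Definition prob_on_group (R : realType) (G : groupType) (mu : G -> R) :=
  (forall g, 0 <= mu g) /\ (\esum_(g in [set: G]) (mu g)%:E = 1)%E.

Definition supp_generates_semigroup (R : realType) (G : groupType)
  (mu : G -> R) :=
  forall g : G, exists s : seq G,
    s <> [::] /\ (forall h, h \in s -> 0 < mu h) /\
    g = foldr (fun h acc => (h * acc)%g) 1%g s.

Definition is_action (G : groupType) (X : Type) (a : G -> X -> X) :=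
  (forall x, a 1%g x = x) /\ (forall g h x, a (g * h)%g x = a g (a h x)).

Definition measurable_action (G : groupType) d (X : measurableType d)
  (a : G -> X -> X) :=
  is_action a /\ (forall g, measurable_fun [set: X] (a g)).

Definition stationary (R : realType) (G : groupType) (mu : G -> R)
  d (X : measurableType d) (a : G -> X -> X) (nu : set X -> \bar R) :=
  forall A : set X, measurable A ->
    nu A = (\esum_(g in [set: G]) ((mu g)%:E * nu (a g @^-1` A)))%E.

Definition essentially_free (R : realType) (G : groupType) d
  (X : measurableType d) (a : G -> X -> X) (nu : set X -> \bar R) :=
  forall g : G, g <> 1%g -> nu.-negligible [set x | a g x = x].

Definition standard_borel (R : realType) d (X : measurableType d) :=
  exists (P : completePseudoMetricType R) (phi : X -> P),
    bijective phi /\ hausdorff_space P /\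
    (exists D : set P, countable D /\ dense D) /\
    (forall A : set X, measurable A <-> <<s @open P >> (phi @` A)).

(* path space G^N of the random walk (w 0, w 1, ...) = (g1, g1 g2, ...) *)
Definition paths (G : groupType) := nat -> G.
HB.instance Definition _ (G : groupType) := gen_eqMixin (paths G).
HB.instance Definition _ (G : groupType) := gen_choiceMixin (paths G).
HB.instance Definition _ (G : groupType) :=
  isPointed.Build (paths G) (fun _ => 1%g).

Definition cylinders (G : groupType) : set (set (paths G)) :=
  [set A | exists (n : nat) (g : G), A = [set w | w n = g]].

Definition Omega (G : groupType) := g_sigma_algebraType (@cylinders G).

Definition incr (G : groupType) (h : nat -> G) (i : nat) : G :=
  if i is j.+1 then ((h j)^-1 * h i)%g else h 0%N.

Definition rw_law (R : realType) (G : groupType) (mu : G -> R)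
  (P : probability (Omega G) R) :=
  forall (n : nat) (h : nat -> G),
    P [set w : Omega G | forall i, (i < n)%N -> w i = h i] =
    (\prod_(i < n) mu (incr h i))%:E.

Definition shift_invariant (G : groupType) : set (set (Omega G)) :=
  [set A | measurable A /\
           (fun w : Omega G => (fun n => w n.+1) : Omega G) @^-1` A = A].

Definition path_act (G : groupType) (g : G) (w : Omega G) : Omega G :=
  fun n => (g * w n)%g.

(* (B0, a0, beta) is a (Mackey) realization of the Poisson boundary
   Pi(G, mu): a standard Borel G-space with a map p from path space
   which is shift-invariant-measurable, G-equivariant (a.e.), pushes P
   to beta, and identifies Borel(B0) with the shift-invariant
   sigma-algebra modulo P-null sets. *)
Definition poisson_boundary (R : realType) (G : groupType) (mu : G -> R)
  d0 (B0 : measurableType d0) (a0 : G -> B0 -> B0) (beta : probability B0 R) :=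
  standard_borel R B0 /\ measurable_action a0 /\
  exists (P : probability (Omega G) R) (p : Omega G -> B0),
    rw_law mu P /\
    (forall C : set B0, measurable C -> @shift_invariant G (p @^-1` C)) /\
    (forall A, @shift_invariant G A -> exists C : set B0, measurable C /\
        P ((A `\` p @^-1` C) `|` (p @^-1` C `\` A)) = 0%E) /\
    (forall C : set B0, measurable C -> beta C = P (p @^-1` C)) /\
    (forall g : G, P.-negligible [set w | p (path_act g w) <> a0 g (p w)]).

Definition is_extension (R : realType) (G : groupType)
  d (B : measurableType d) (a : G -> B -> B) (nu : probability B R)
  d0 (B0 : measurableType d0) (a0 : G -> B0 -> B0) (beta : probability B0 R) :=
  exists pi : B -> B0, measurable_fun [set: B] pi /\
    (forall g b, pi (a g b) = a0 g (pi b)) /\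
    (forall C : set B0, measurable C -> beta C = nu (pi @^-1` C)).

Definition WG (G : groupType) (W : ptopologicalType) := {ptws G -> W}.

Definition WGB (G : groupType) (W : ptopologicalType) :=
  g_sigma_algebraType (@open (WG G W)).

Definition shiftW (G : groupType) (W : ptopologicalType) (g : G)
  (x : WGB G W) : WGB G W := fun k => x (g^-1 * k)%g.

Definition P_mu (R : realType) (G : groupType) (mu : G -> R)
  (W : ptopologicalType) : set (probability (WGB G W) R) :=
  [set eta | stationary mu (@shiftW G W) eta].
Arguments P_mu {R G} mu W.

Definition Fact (R : realType) (G : groupType) (mu : G -> R)
  d (B : measurableType d) (a : G -> B -> B) (nu : probability B R)
  (W : ptopologicalType) : set (probability (WGB G W) R) :=
  [set eta | P_mu mu W eta /\
     exists pi : B -> WGB G W, measurable_fun [set: B] pi /\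
       (forall g b, pi (a g b) = shiftW g (pi b)) /\
       (forall A : set (WGB G W), measurable A -> eta A = nu (pi @^-1` A))].
Arguments Fact {R G} mu {d B} a nu W.

(* F is dense in S for the weak* topology (the topology of convergence of
   integrals of continuous functions), via its basic neighbourhoods *)
Definition weakstar_dense (R : realType) (G : groupType) (W : ptopologicalType)
  (F S : set (probability (WGB G W) R)) :=
  F `<=` S /\
  forall eta, S eta ->
  forall (n : nat) (f : 'I_n -> WGB G W -> R),
    (forall i, continuous (f i : WG G W -> R^o)) ->
    forall eps : R, 0 < eps ->
    exists eta', F eta' /\
      forall i, (`| \int[eta']_x (f i x)%:E - \int[eta]_x (f i x)%:E | < eps%:E)%E.

(* Main.v *)
(** Write [theta] for the Cesaro averages, started at the identity, of the
    transition probabilities of the walk.  The functions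
    [theta g * d(g beta)/d beta] on the Poisson boundary are asymptotically
    equivariant in [L1], and their integrals average a bounded harmonic
    function [v] to [v 1].  Rounding and pulling back along the extension map
    gives integer counts [N g b] on [B] with the same two properties.

    For a stationary [eta] and a continuous [f], the function
    [v g = \int f (g y) d eta] is harmonic, so [\int f d eta] is nearly the
    average of [f (h x)] when [x] is drawn from a finite approximation of
    [eta] and [h] with probability [N h b / M], with [b] drawn from [nu].
    This draw is made equivariantly by a competition: the slot [(h, t)], for
    [t < N h b], carries a priority and a sample point, both read off at
    [h^-1 b], and the slot of least priority wins.  The points [b] and
    [k^-1 b] have nearly the same slots up to translation, hence the same
    winner with high probability, so the map sending [b] to the configuration
    whose [k]-th letter is dictated by the winner at [k^-1 b] nearly has the
    law [eta].

    The labels are finite-valued functions on [B].  Since the action is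
    essentially free and [nu] has no atoms, a random colouring of a fine
    enough partition of [B] behaves like independent labels, by a second
    moment computation. *)

Require Import Defs.
From HB Require Import structures.
From mathcomp Require Import all_boot all_order all_algebra.
From mathcomp Require Import all_classical all_reals all_analysis.
From mathcomp Require Import measurable_realfun ring lra zify.
From mathcomp Require finmap.

Set Implicit Arguments.
Unset Strict Implicit.
Unset Printing Implicit Defensive.

Import Order.TTheory GRing.Theory Num.Theory.
Import numFieldNormedType.Exports.
Local Open Scope classical_set_scope.
Local Open Scope ring_scope.

(** The [L1] estimate bounds a sum over [g] of absolute values, so it has to be uniform over all
    choices of signs; no single harmonic function is enough. On a set [C] where the density [rho k]
    is close to a constant [c], the sum is the difference between a Cesaro average at [k] and [c]
    times that average at [1], for one function [u] with [|u g|] at most [beta (g^-1 C)]. Long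
    averages are nearly harmonic, so an ultralimit reduces the estimate to harmonic functions with
    the same bound. Such a function integrates a shift-invariant function of the path that vanishes
    almost surely unless the path ends in [C]; moving the start from [1] to [k] multiplies the
    integrand by [rho k] at the end point, which leaves an error of at most the integral of
    [|rho k - c|] over [C]. Rounding to integers turns densities into numbers of interchangeable
    slots, so that a competition with nearly equal chances samples [h] with the right frequency.
    Finitely many priorities and a fixed colouring replace independent randomness because the factor
    map must be a function of [b] alone, equivariant at every point. *)

Section BoundedMeasurable.
Context (R : realType) d (T : measurableType d) (P : probability T R).
Implicit Types (f g : T -> R) (A : set T).

(** Bounded at every point rather than almost everywhere: the class is then closed under composition
    with any measurable map and does not depend on the measure. *)
Definition bdd_meas f := measurable_fun setT f /\ exists M : R, forall x, `|f x| <= M.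

Lemma bdd_meas_int f : bdd_meas f -> P.-integrable setT (EFin \o f).
Proof.
case=> mf [M fM]; apply: measurable_bounded_integrable => //.
  by apply: (le_lt_trans (probability_le1 P measurableT)); rewrite ltry.
exists M; split; first exact: num_real.
by move=> x Mx y _ /=; rewrite (le_trans (fM y))// ltW.
Qed.

Lemma bdd_meas_cst c : bdd_meas (fun=> c).
Proof. by split; [exact: measurable_cst|exists `|c|]. Qed.

Lemma bdd_measD f g : bdd_meas f -> bdd_meas g -> bdd_meas (fun x => f x + g x).
Proof.
move=> [mf [M fM]] [mg [N gN]]; split; first exact: measurable_funD.
by exists (M + N) => x; rewrite (le_trans (ler_normD _ _))// lerD.
Qed.

Lemma bdd_measM f g : bdd_meas f -> bdd_meas g -> bdd_meas (fun x => f x * g x).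
Proof.
move=> [mf [M fM]] [mg [N gN]]; split; first exact: measurable_funM.
by exists (M * N) => x; rewrite normrM ler_pM.
Qed.

Lemma bdd_measZ c f : bdd_meas f -> bdd_meas (fun x => c * f x).
Proof. by move=> bf; apply: bdd_measM => //; exact: bdd_meas_cst. Qed.

Lemma bdd_measB f g : bdd_meas f -> bdd_meas g -> bdd_meas (fun x => f x - g x).
Proof.
move=> bf [mg [N gN]]; apply: bdd_measD => //; split; first exact: measurableT_comp.
by exists N => x; rewrite normrN.
Qed.

Lemma bdd_meas_norm f : bdd_meas f -> bdd_meas (fun x => `|f x|).
Proof.
move=> [mf [M fM]]; split; first exact: measurableT_comp.
by exists M => x; rewrite normr_id.
Qed.

Lemma bdd_meas_sum I (s : seq I) (F : I -> T -> R) :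
  (forall i, bdd_meas (F i)) -> bdd_meas (fun x => \sum_(i <- s) F i x).
Proof.
move=> bF; elim: s => [|i s IH].
  by under eq_fun do rewrite big_nil; exact: bdd_meas_cst.
by under eq_fun do rewrite big_cons; exact: bdd_measD.
Qed.

Lemma bdd_meas_indic A : measurable A -> bdd_meas \1_A.
Proof.
move=> mA; split; first exact: measurable_indic.
by exists 1 => x; rewrite indicE; case: (x \in A); rewrite ?normr1 ?normr0.
Qed.

Lemma ExpD f g : bdd_meas f -> bdd_meas g ->
  \int[P]_x (f x + g x) = \int[P]_x f x + \int[P]_x g x.
Proof. by move=> bf bg; apply: RintegralD => //; exact: bdd_meas_int. Qed.

Lemma ExpB f g : bdd_meas f -> bdd_meas g ->
  \int[P]_x (f x - g x) = \int[P]_x f x - \int[P]_x g x.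
Proof. by move=> bf bg; apply: RintegralB => //; exact: bdd_meas_int. Qed.

Lemma ExpZ c f : bdd_meas f -> \int[P]_x (c * f x) = c * \int[P]_x f x.
Proof. by move=> bf; apply: RintegralZl => //; exact: bdd_meas_int. Qed.

Lemma Exp_cst c : \int[P]_x c = c.
Proof. by rewrite Rintegral_cst// [X in fine X](probability_setT P) mulr1. Qed.

Lemma Exp_sum I (s : seq I) (F : I -> T -> R) : (forall i, bdd_meas (F i)) ->
  \int[P]_x (\sum_(i <- s) F i x) = \sum_(i <- s) \int[P]_x F i x.
Proof.
move=> bF; elim: s => [|i s IH].
  by under eq_Rintegral do rewrite big_nil; rewrite big_nil Exp_cst.
under eq_Rintegral do rewrite big_cons.
by rewrite big_cons ExpD// ?IH//; exact: bdd_meas_sum.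
Qed.

Lemma le_Exp f g : bdd_meas f -> bdd_meas g -> (forall x, f x <= g x) ->
  \int[P]_x f x <= \int[P]_x g x.
Proof. by move=> bf bg fg; apply: le_Rintegral => //; exact: bdd_meas_int. Qed.

Lemma normr_Exp f : bdd_meas f -> `|\int[P]_x f x| <= \int[P]_x `|f x|.
Proof. by move=> bf; apply: le_normr_Rintegral => //; exact: bdd_meas_int. Qed.

Lemma normr_Exp_le f M : bdd_meas f -> (forall x, `|f x| <= M) ->
  `|\int[P]_x f x| <= M.
Proof.
move=> bf fM; rewrite (le_trans (normr_Exp bf))// -[leRHS](Exp_cst M).
by apply: le_Exp => //; [exact: bdd_meas_norm|exact: bdd_meas_cst].
Qed.

Lemma Exp_ge0 f : (forall x, 0 <= f x) -> 0 <= \int[P]_x f x.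
Proof. by move=> f0; exact: Rintegral_ge0. Qed.

Lemma Exp_indic A : measurable A -> \int[P]_x \1_A x = fine (P A).
Proof. by move=> mA; rewrite /Rintegral integral_indic// setIT. Qed.

Lemma Exp_EFin f : bdd_meas f -> (\int[P]_x f x)%:E = (\int[P]_x (f x)%:E)%E.
Proof. by move=> bf; rewrite fineK//; apply: integrable_fin_num => //; exact: bdd_meas_int. Qed.

Lemma Exp_cvg (F : nat -> T -> R) f M : (forall n, measurable_fun setT (F n)) ->
  measurable_fun setT f -> (forall n x, `|F n x| <= M) ->
  {ae P, forall x, F ^~ x @ \oo --> f x} ->
  (fun n => \int[P]_x F n x) @ \oo --> \int[P]_x f x.
Proof.
move=> mF mf FM cF.
have bc : P.-integrable setT (EFin \o (fun=> M)) by apply: bdd_meas_int; exact: bdd_meas_cst.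
have [intf _ c] := @dominated_convergence _ _ _ P setT measurableT
  (fun n => EFin \o F n) (EFin \o f) (EFin \o (fun=> M))
  (fun n => (measurable_EFinP _ _).2 (mF n)) ((measurable_EFinP _ _).2 mf)
  ltac:(by apply: filterS cF => x c _; apply/fine_cvgP; split => //=; exact: nearW)
  bc ltac:(by apply: aeW => x n _ /=; rewrite lee_fin).
by apply/fine_cvg; rewrite fineK//; exact: integrable_fin_num.
Qed.

End BoundedMeasurable.

Lemma bdd_meas_comp (R : realType) d (T : measurableType d) d' (T' : measurableType d')
  (g : T' -> R) (h : T -> T') :
  bdd_meas g -> measurable_fun setT h -> bdd_meas (fun x => g (h x)).
Proof. by move=> [mg [M gM]] mh; split; [exact: measurableT_comp|exists M]. Qed.

Lemma cvg_sumr (R : realType) T (F : set_system T) (FF : Filter F) I (s : seq I)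
  (f : I -> T -> R) (l : I -> R) : (forall i, f i @ F --> l i) ->
  (fun x => \sum_(i <- s) f i x) @ F --> \sum_(i <- s) l i.
Proof.
move=> fl; elim: s => [|i s IH].
  by under eq_fun do rewrite big_nil; rewrite big_nil; exact: cvg_cst.
under eq_fun do rewrite big_cons.
by rewrite big_cons; apply: cvgD.
Qed.

Section LinearExtension.
Context (R : realType) d (T : measurableType d).
Implicit Types (f g : T -> R).

Lemma uniform_step_approx (M eps : R) : 0 < eps ->
  exists n (c : 'I_n -> R) (B : 'I_n -> set R), (forall i, measurable (B i)) /\
    forall y, `|y| <= M -> `|y - \sum_(i < n) c i * \1_(B i) y| <= eps.
Proof.
move=> e0; set n := (Num.truncn (2 * M / eps)).+1.
pose c (i : 'I_n) : R := i%:R * eps - M.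
exists n, c, (fun i => `[c i, c i + eps[%classic); split => // y yM.
have yM0 : 0 <= (y + M) / eps.
  by rewrite divr_ge0 ?(ltW e0)// -lerBlDr sub0r; move: yM; rewrite ler_norml => /andP[].
set j := Num.truncn ((y + M) / eps).
have /andP[jle jlt] : j%:R <= (y + M) / eps < j.+1%:R by rewrite truncn_itv.
have jn : (j < n)%N.
  rewrite ltnS /j; apply: le_truncn; rewrite ler_pM2r ?invr_gt0//.
  by move: yM; rewrite ler_norml => /andP[_]; lra.
rewrite (bigD1 (Ordinal jn))//= big1 ?addr0; last first.
  move=> i ij; rewrite indicE memNset ?mulr0//= in_itv/= => /andP[].
  rewrite /c => ciy yci; move/eqP: ij; apply; apply/val_inj => /=.
  suff : Num.truncn ((y + M) / eps) = i by [].
  apply/eqP; rewrite truncn_eq// ler_pdivlMr// ltr_pdivrMr//.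
  by rewrite -natr1 mulrDl mul1r; apply/andP; split; lra.
move: jle jlt; rewrite ler_pdivlMr// ltr_pdivrMr// -natr1 mulrDl mul1r => jle jlt.
rewrite indicE mem_set ?mulr1 /c /=; last by rewrite in_itv/=; apply/andP; split; lra.
by rewrite ler_norml; apply/andP; split; lra.
Qed.

(** Only preimages under [f] itself are tested, not all measurable sets: rounding the values of [f]
    needs no others. A property of [f] such as shift invariance is thus inherited by every test
    set. *)
Lemma linear_ext (L : (T -> R) -> R) (C : R) f :
  (forall g h, bdd_meas g -> bdd_meas h -> L (fun x => g x + h x) = L g + L h) ->
  (forall c g, bdd_meas g -> L (fun x => c * g x) = c * L g) ->
  (forall g K, bdd_meas g -> (forall x, `|g x| <= K) -> `|L g| <= C * K) ->
  (forall B, measurable B -> L \1_(f @^-1` B) = 0) ->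
  bdd_meas f -> L f = 0.
Proof.
move=> LD LZ LK L1 bf; have [mf [M fM]] := bf.
have fpre B : measurable B -> measurable (f @^-1` B).
  by move=> mB; rewrite -[_ @^-1` _]setTI; exact: mf.
apply/eqP; rewrite -normr_le0; apply/ler_addgt0Pr => e e0; rewrite add0r.
have [C0|C0] := leP C 0.
  have M0 : 0 <= `|M| by [].
  apply: (le_trans (LK f `|M| bf _)); first by move=> x; rewrite (le_trans (fM x))// ler_norm.
  by rewrite (le_trans _ (ltW e0))// mulr_le0_ge0.
have [n [c [B [mB HB]]]] := uniform_step_approx M (divr_gt0 e0 C0).
pose s x := \sum_(i < n) c i * \1_(f @^-1` B i) x.
have bs (r : seq 'I_n) : bdd_meas (fun x => \sum_(i <- r) c i * \1_(f @^-1` B i) x).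
  by apply: bdd_meas_sum => i; apply: bdd_measZ; apply: bdd_meas_indic; exact: fpre.
have L0 : L (fun=> 0) = 0.
  rewrite -[RHS](mul0r (L f)) -LZ//; congr L; apply/funext => x.
  by rewrite mul0r.
have Ls : L s = 0.
  rewrite /s; elim: (index_enum _) => [|i r IH].
    by under eq_fun do rewrite big_nil.
  under eq_fun do rewrite big_cons.
  rewrite LD// ?LZ// ?IH ?L1 ?mulr0 ?addr0//.
    by apply: bdd_meas_indic; exact: fpre.
  by apply: bdd_measZ; apply: bdd_meas_indic; exact: fpre.
have -> : L f = L (fun x => f x - s x).
  transitivity (L (fun x => (f x - s x) + s x)).
    by congr L; apply/funext => x; rewrite subrK.
  by rewrite LD ?Ls ?addr0//; [apply: bdd_measB => //; exact: bs|exact: bs].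
have -> : e = C * (e / C) by rewrite mulrC divfK ?gt_eqF.
apply: LK => [|x]; first by apply: bdd_measB => //; exact: bs.
by rewrite /s; apply: HB.
Qed.

End LinearExtension.

Lemma countable_infinite_bij (G : Type) : countable [set: G] ->
  infinite_set [set: G] -> exists (en : nat -> G) (rk : G -> nat),
    cancel en rk /\ cancel rk en.
Proof.
move=> cG iG; have /card_set_bijP[rk] := eq_card_nat cG iG.
by rewrite setTT_bijective => -[en rkK enK]; exists en, rk.
Qed.

(** * Random walks *)

Section RandomWalk.
Context (R : realType) (G : groupType) (G_countable : countable [set: G])
  (G_infinite : infinite_set [set: G]) (mu : G -> R)
  (P : probability (Omega G) R) (P_law : rw_law mu P).
Implicit Types (w : Omega G) (x g : G) (u : G -> R) (A D : set (Omega G)).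

Definition walk_tail w : Omega G := fun n => ((w 0%N)^-1 * w n.+1)%g.
Definition walk_shift w : Omega G := fun n => w n.+1.

Lemma measurable_coord n g : measurable [set w : Omega G | w n = g].
Proof. by apply: sub_sigma_algebra; exists n, g. Qed.

Lemma measurable_coord_set n (B : set G) : measurable [set w : Omega G | B (w n)].
Proof.
rewrite (_ : mkset _ = \bigcup_(g in [set: G]) [set w : Omega G | B g /\ w n = g]).
  apply: countable_bigcupT_measurable => // g.
  have [Bg|nBg] := pselect (B g).
    rewrite (_ : mkset _ = [set w : Omega G | w n = g]); first exact: measurable_coord.
    by apply/seteqP; split => w //= [].
  rewrite (_ : mkset _ = set0)//; apply/seteqP; split => w //= [] //.
by apply/seteqP; split => [w Bw|w [g _ [Bg wn]]]; [by exists (w n)|by rewrite /= wn].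
Qed.

Lemma measurable_to_paths d (T : measurableType d) (f : T -> Omega G) :
  (forall n g, measurable [set x | f x n = g]) -> measurable_fun setT f.
Proof.
move=> mf; apply: (@measurability _ _ T (Omega G) setT f (@cylinders G)) => // _ [_ [n [g ->]] <-].
by rewrite setTI; exact: mf.
Qed.

Lemma measurable_coordfun n u : measurable_fun setT (fun w : Omega G => u (w n)).
Proof. by move=> _ Y _; rewrite setTI; exact: (measurable_coord_set n (u @^-1` Y)). Qed.

Lemma measurable_walk_tail : measurable_fun setT walk_tail.
Proof.
apply: measurable_to_paths => n g.
rewrite (_ : mkset _ = \bigcup_(h in [set: G])
    ([set w : Omega G | w 0%N = h] `&` [set w : Omega G | w n.+1 = (h * g)%g])).
  apply: countable_bigcupT_measurable => // h.
  by apply: measurableI; exact: measurable_coord.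
apply/seteqP; split => [w /= <-|w [h _ []]/= w0 w1].
  by exists (w 0%N) => //; split => //=; rewrite /walk_tail mulVKg.
by rewrite /walk_tail w0 w1 mulKg.
Qed.

Lemma measurable_path_act x : measurable_fun setT (@path_act G x).
Proof.
apply: measurable_to_paths => n g.
exact: (measurable_coord_set n [set h | (x * h)%g = g]).
Qed.

Definition cylinder n (h : nat -> G) : set (Omega G) :=
  [set w | forall i, (i < n)%N -> w i = h i].

Lemma cylinderS n h : cylinder n.+1 h =
  [set w : Omega G | w 0%N = h 0%N] `&`
  walk_tail @^-1` cylinder n (fun i => ((h 0%N)^-1 * h i.+1)%g).
Proof.
apply/seteqP; split => [w wh|w [w0 wh] [|i] ilt //].
  split; first exact: wh.
  by move=> i ilt; rewrite /walk_tail !wh.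
by apply: (@mulgI _ (h 0%N)^-1%g); have := wh i ilt; rewrite /walk_tail w0.
Qed.

Lemma measurable_cylinder n h : measurable (cylinder n h).
Proof.
elim: n h => [|n IH] h.
  by rewrite (_ : cylinder _ _ = setT)//; apply/seteqP; split.
rewrite cylinderS; apply: measurableI; first exact: measurable_coord.
by rewrite -[_ @^-1` _]setTI; exact: measurable_walk_tail.
Qed.

(** The one-coordinate sets that generate the sigma-algebra are not closed under intersection;
    initial segments, together with [set0], are, as Dynkin induction requires. *)
Definition full_cylinders : set (set (Omega G)) :=
  [set A | A = set0 \/ exists n h, A = cylinder n h].

Lemma full_cylinders_setI : setI_closed full_cylinders.
Proof.
move=> A B [->|[n [h ->]]]; first by rewrite set0I; left.
move=> [->|[m [k ->]]]; first by rewrite setI0; left.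
wlog nm : n m h k / (n <= m)%N.
  move=> H; have [/H//|/ltnW/H] := leqP n m.
  by rewrite setIC.
have [hk|/existsNP[i /not_implyP[ilt hk]]] := pselect (forall i, (i < n)%N -> h i = k i).
  right; exists m, k; apply/seteqP; split => [w []//|w wk]; split => // i ilt.
  by rewrite wk ?hk//; exact: leq_trans nm.
left; apply/seteqP; split => // w [wh wk]; apply: hk.
by rewrite -wh// -wk//; exact: leq_trans nm.
Qed.

Lemma measurable_full_cylinders : @measurable _ (Omega G) = <<s full_cylinders >>.
Proof.
apply/seteqP; split; last first.
  apply: smallest_sub; first exact: sigma_algebra_measurable.
  move=> _ [->|[n [h ->]]]; [exact: measurable0|exact: measurable_cylinder].
apply: smallest_sub; first exact: smallest_sigma_algebra.
move=> _ [n [g ->]].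
have [en [rk [enK rkK]]] := countable_infinite_bij G_countable G_infinite.
(* The code [c] lists the ranks of the first [n] positions; lists of any other length contribute
   nothing. *)
pose F (c : nat) : set (Omega G) := if unpickle c is Some s
  then if size s == n then cylinder n.+1 (nth g (rcons (map en s) g)) else set0
  else set0.
have -> : [set w : Omega G | w n = g] = \bigcup_c F c.
  apply/seteqP; split => [w /= wn|w [c _]]; rewrite /F.
    exists (pickle (mkseq (rk \o w) n)) => //.
    rewrite pickleK size_mkseq eqxx => i ilt.
    rewrite nth_rcons size_map size_mkseq.
    have [ilt'|ni|->] := ltngtP i n; last by rewrite wn.
      by rewrite (nth_map 0%N) ?size_mkseq// nth_mkseq//= rkK.
    by move: ilt; rewrite ltnS leqNgt ni.
  case: unpickle => // s; case: eqP => // sn /(_ n (ltnSn n)) /= ->.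
  by rewrite nth_rcons size_map sn ltnn eqxx.
have [_ _ sU] := smallest_sigma_algebra setT full_cylinders.
apply: sU => c; rewrite /F; case: unpickle => [s|]; last first.
  by apply: sub_sigma_algebra; left.
apply: sub_sigma_algebra; case: eqP => _; last by left.
by right; exists n.+1, (nth g (rcons (map en s) g)).
Qed.

Lemma cylinder_prob n h : P (cylinder n h) = (\prod_(i < n) mu (incr h i))%:E.
Proof. exact: P_law. Qed.

Lemma cylinder0 h : cylinder 0 h = setT.
Proof. by apply/seteqP; split. Qed.

Lemma walk_start g : P [set w : Omega G | w 0%N = g] = (mu g)%:E.
Proof.
have := cylinder_prob 1 (fun=> g); rewrite big_ord_recl big_ord0 mulr1 => <-.
congr (P _); apply/seteqP; split => [w /= wg [|//] _|w /(_ 0%N isT)//].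
exact: wg.
Qed.

(** Markov property at time one: the walk seen from its first position is independent of that
    position and has law [P]. On cylinders this is the product form of [rw_law]; Dynkin induction
    does the rest. *)
Lemma walk_markov g A : measurable A ->
  P ([set w : Omega G | w 0%N = g] `&` walk_tail @^-1` A) = ((mu g)%:E * P A)%E.
Proof.
have mt B : measurable B -> measurable (walk_tail @^-1` B).
  by move=> mB; rewrite -[_ @^-1` _]setTI; exact: measurable_walk_tail.
have mc := measurable_coord 0 g.
move: A; rewrite measurable_full_cylinders.
apply: (@dynkin_induction _ (Omega G) full_cylinders (fun A => P (_ `&` walk_tail @^-1` A) = (_ * P A)%E)).
- exact: measurable_full_cylinders.
- exact: full_cylinders_setI.
- by rewrite preimage_setT setIT probability_setT mule1 walk_start.
- move=> _ [->|[n [h ->]]]; first by rewrite preimage_set0 setI0 !measure0 mule0.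
  (* [k] is [g] followed by the translate of [h] by [g]; its increments are [g] and then those of
     [h]. *)
  pose k i := if i is j.+1 then (g * h j)%g else g.
  have := cylinder_prob n.+1 k; rewrite cylinderS cylinder_prob.
  rewrite (_ : (fun i => _) = h); last by apply/funext => i; rewrite /k mulKg.
  move=> ->; rewrite big_ord_recl /= EFinM; congr (_ * (_)%:E)%E.
  apply: eq_bigr => -[[|i] ilt] _ //=; first by rewrite /bump /= mulKg.
  by rewrite /bump /= invgM -mulgA mulKg.
- move=> A mA IH; rewrite preimage_setC -setDE measureD//; last 2 first.
    exact: mt.
    by apply: (le_lt_trans (probability_le1 P mc)); rewrite ltry.
  rewrite [X in (_ - X)%E]IH [X in (X - _)%E]walk_start probability_setC// muleBr//.
  by rewrite mule1.
- move=> F mF tF IH; rewrite preimage_bigcup setI_bigcupr.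
  rewrite measure_bigcup//; last 2 first.
    by move=> n _; apply: measurableI => //; exact: mt.
    by move=> i j _ _ [w [[_ wi] [_ wj]]]; apply: tF => //; exists (walk_tail w).
  rewrite measure_bigcup// -nneseriesZl//.
  by apply: eq_eseriesr => n _; exact: IH.
Qed.

End RandomWalk.
Arguments walk_tail {G} w.
Arguments walk_shift {G} w.

Section Markov.
Context (R : realType) (G : groupType) (G_countable : countable [set: G])
  (G_infinite : infinite_set [set: G]) (mu : G -> R)
  (P : probability (Omega G) R) (P_law : rw_law mu P).
Implicit Types (M : R) (w : Omega G) (x g : G) (u h : G -> R) (A D : set (Omega G)).

Let start_indic g : bdd_meas (\1_[set w : Omega G | w 0%N = g] : _ -> R).
Proof. by apply: bdd_meas_indic; exact: measurable_coord. Qed.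

Lemma markov_start g (f : Omega G -> R) : bdd_meas f ->
  \int[P]_w (\1_[set w : Omega G | w 0%N = g] w * f (walk_tail w)) =
  mu g * \int[P]_w f w.
Proof.
move=> bf; apply/eqP; rewrite -subr_eq0; apply/eqP.
have bt f' : bdd_meas f' -> bdd_meas (fun w : Omega G => f' (walk_tail w) : R).
  by move=> bf'; apply: bdd_meas_comp => //; exact: measurable_walk_tail.
apply: (@linear_ext _ _ _ (fun f =>
  \int[P]_w (\1_[set w : Omega G | w 0%N = g] w * f (walk_tail w)) -
  mu g * \int[P]_w f w) (1 + `|mu g|)) => //.
- move=> f1 f2 b1 b2; under eq_Rintegral do rewrite mulrDr.
  rewrite !ExpD//; try by apply: bdd_measM => //; exact: bt.
  by rewrite mulrDr; ring.
- move=> c f1 b1; under eq_Rintegral do rewrite mulrCA.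
  rewrite !ExpZ//; try by apply: bdd_measM => //; exact: bt.
  by ring.
- move=> f1 K b1 fK; rewrite (le_trans (ler_normB _ _))// mulrDl mul1r lerD//.
    apply: normr_Exp_le => [|w]; first by apply: bdd_measM => //; exact: bt.
    rewrite normrM indicE; case: (_ \in _); rewrite ?normr1 ?mul1r//.
    by rewrite normr0 mul0r (le_trans _ (fK w)).
  by rewrite normrM ler_wpM2l//; exact: normr_Exp_le.
- move=> B mB; have mfB : measurable (f @^-1` B).
    by rewrite -[_ @^-1` _]setTI; apply bf.1.
  rewrite (_ : (fun w => _) = \1_([set w : Omega G | w 0%N = g] `&`
      walk_tail @^-1` (f @^-1` B))); last first.
    by apply/funext => w; rewrite indicI /= !indicE.
  rewrite !Exp_indic//; last first.
    apply: measurableI; first exact: measurable_coord.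
    by rewrite -[_ @^-1` _]setTI; exact: measurable_walk_tail.
  by rewrite (walk_markov G_countable G_infinite P_law)// fineM//= ?subrr// fin_num_measure.
Qed.

Lemma measurable_walk_pair (F : G -> Omega G -> R) :
  (forall g, measurable_fun setT (F g)) ->
  measurable_fun setT (fun w : Omega G => F (w 0%N) (walk_tail w)).
Proof.
move=> mF _ Y mY; rewrite setTI.
rewrite (_ : _ @^-1` _ = \bigcup_(g in [set: G])
   ([set w : Omega G | w 0%N = g] `&` walk_tail @^-1` (F g @^-1` Y))).
  apply: countable_bigcupT_measurable => // g.
  apply: measurableI; first exact: measurable_coord.
  rewrite -[_ @^-1` _]setTI; apply: measurable_walk_tail => //.
  by rewrite -[_ @^-1` _]setTI; exact: mF.
apply/seteqP; split => [w /= Yw|w [g _ [/= <-]]//].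
by exists (w 0%N).
Qed.

Lemma walk_start_cvg (en : nat -> G) (rk : G -> nat) (F : G -> R) w :
  cancel en rk -> cancel rk en ->
  (fun n => \sum_(i < n) \1_[set w' : Omega G | w' 0%N = en i] w * F (en i)) @ \oo -->
  F (w 0%N).
Proof.
move=> enK rkK; apply: cvg_near_cst; exists (rk (w 0%N)).+1 => // n /= nlt.
rewrite (bigD1 (Ordinal nlt))//= rkK indicE mem_set// mul1r big1 ?addr0// => i ine.
rewrite indicE memNset ?mul0r//= => wi; move/eqP: ine; apply; apply/val_inj => /=.
by rewrite wi enK.
Qed.

Lemma walk_start_bounded (en : nat -> G) (rk : G -> nat) (F : G -> R) w n M :
  cancel en rk -> (forall g, `|F g| <= M) ->
  `|\sum_(i < n) \1_[set w' : Omega G | w' 0%N = en i] w * F (en i)| <= M.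
Proof.
move=> enK FM; have M0 : 0 <= M by exact: le_trans (FM 1%g).
have [[i wi]|H] := pselect (exists i : 'I_n, w 0%N = en i).
  rewrite (bigD1 i)//= indicE mem_set// mul1r big1 ?addr0// => j ji.
  rewrite indicE memNset ?mul0r//= => wj; move/eqP: ji; apply; apply/val_inj => /=.
  by rewrite -(enK j) -(enK i) -wi -wj.
rewrite big1 ?normr0// => i _; rewrite indicE memNset ?mul0r//= => wi.
by apply: H; exists i.
Qed.

(** Fubini for the first position and the walk seen from it. There are countably many positions, so
    both sides are limits of partial sums along [en], whose terms agree by [markov_start]. *)
Lemma markov_exp (F : G -> Omega G -> R) M :
  (forall g, measurable_fun setT (F g)) -> (forall g w, `|F g w| <= M) ->
  \int[P]_w F (w 0%N) (walk_tail w) = \int[P]_w' \int[P]_w F (w' 0%N) w.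
Proof.
move=> mF FM; have [en [rk [enK rkK]]] := countable_infinite_bij G_countable G_infinite.
have bF g : bdd_meas (F g) by split => //; exists M.
pose S1 n w := \sum_(i < n) \1_[set w' : Omega G | w' 0%N = en i] w * F (en i) (walk_tail w).
pose S2 n (w : Omega G) := \sum_(i < n) \1_[set w' : Omega G | w' 0%N = en i] w * \int[P]_w' F (en i) w'.
have bt g : bdd_meas (fun w : Omega G => F g (walk_tail w)).
  by apply: bdd_meas_comp => //; exact: measurable_walk_tail.
have b1 n : bdd_meas (S1 n) by apply: bdd_meas_sum => i; exact: bdd_measM.
have b2 n : bdd_meas (S2 n).
  by apply: bdd_meas_sum => i; apply: bdd_measM => //; exact: bdd_meas_cst.
have c1 : (fun n => \int[P]_w S1 n w) @ \oo --> \int[P]_w F (w 0%N) (walk_tail w).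
  apply: (@Exp_cvg _ _ _ P S1 _ M) => [n||n w|]; first exact: (b1 n).1.
  - exact: measurable_walk_pair.
  - exact: (@walk_start_bounded en rk (F^~ (walk_tail w))).
  - by apply: aeW => w; exact: (@walk_start_cvg en rk (F^~ (walk_tail w))).
have c2 : (fun n => \int[P]_w S2 n w) @ \oo --> \int[P]_w' \int[P]_w F (w' 0%N) w.
  apply: (@Exp_cvg _ _ _ P S2 _ M) => [n||n w|]; first exact: (b2 n).1.
  - exact: (measurable_coordfun G_countable 0 (fun g => \int[P]_w F g w)).
  - apply: (@walk_start_bounded en rk (fun g => \int[P]_w F g w)) => // g.
    exact: normr_Exp_le.
  - by apply: aeW => w; exact: (@walk_start_cvg en rk (fun g => \int[P]_w F g w)).
rewrite -(cvg_lim (@Rhausdorff R) c1) -(cvg_lim (@Rhausdorff R) c2).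
congr (limn _); apply/funext => n; rewrite !Exp_sum//; last 2 first.
- by move=> i; apply: bdd_measM => //; exact: bdd_meas_cst.
- by move=> i; exact: bdd_measM.
apply: eq_bigr => i _; rewrite markov_start//.
under [RHS]eq_Rintegral do rewrite mulrC.
rewrite ExpZ// Exp_indic; last exact: measurable_coord.
by rewrite (walk_start P_law) mulrC.
Qed.

(** The sum over [g] of [mu g * u (x * g)], written as an integral over the first position so that
    the integration lemmas apply. *)
Definition markov_op u x : R := \int[P]_w u (x * w 0%N)%g.
Definition harmonic h := forall x, markov_op h x = h x.

Lemma walk_tail_coord w n : w n.+1 = (w 0%N * walk_tail w n)%g.
Proof. by rewrite /walk_tail mulVKg. Qed.

Lemma bdd_meas_coord u M x n : (forall g, `|u g| <= M) ->
  bdd_meas (fun w : Omega G => u (x * w n)%g).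
Proof.
by move=> uM; split; [exact: (measurable_coordfun G_countable n (fun g => u (x * g)%g))|exists M].
Qed.

Lemma walk_exp u M n x : (forall g, `|u g| <= M) ->
  \int[P]_w u (x * w n)%g = iter n.+1 markov_op u x.
Proof.
move=> uM; elim: n x => [|n IH] x //.
under eq_Rintegral do rewrite walk_tail_coord mulgA.
rewrite (@markov_exp (fun g w => u (x * g * w n)%g) M)//; last first.
  by move=> g; have [] := bdd_meas_coord (x * g)%g n uM.
by rewrite iterS {1}/markov_op; apply: eq_Rintegral => w _; rewrite IH.
Qed.

Lemma harmonic_walk h M n x : harmonic h -> (forall g, `|h g| <= M) ->
  \int[P]_w h (x * w n)%g = h x.
Proof.
move=> hh hM; rewrite (walk_exp _ _ hM).
by elim: n x => [|n IH] x; [exact: hh|rewrite iterS (_ : iter _ _ _ = h)//; apply/funext].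
Qed.

(* Martingale increments are orthogonal. *)
Lemma harmonic_walk_prod h M m n x : harmonic h -> (forall g, `|h g| <= M) ->
  (m <= n)%N ->
  \int[P]_w (h (x * w m)%g * h (x * w n)%g) = \int[P]_w (h (x * w m)%g ^+ 2).
Proof.
move=> hh hM.
have M0 : 0 <= M by exact: le_trans (hM 1%g).
have hhM g g' : `|h g * h g'| <= M * M by rewrite normrM ler_pM.
elim: m n x => [|m IH] [|n] x //= mn.
- under eq_Rintegral do rewrite walk_tail_coord mulgA.
  rewrite (@markov_exp (fun g w => h (x * g)%g * h (x * g * w n)%g) (M * M))//; last first.
    move=> g; apply: (@bdd_measM _ _ _ (fun=> _) _ _ _).1; first exact: bdd_meas_cst.
    exact: bdd_meas_coord hM.
  apply: eq_Rintegral => w _; rewrite ExpZ; last exact: bdd_meas_coord hM.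
  by rewrite (harmonic_walk _ _ hh hM) expr2.
- under eq_Rintegral => w _ do rewrite (walk_tail_coord w m) (walk_tail_coord w n)
    (mulgA x (w 0%N) (walk_tail w m)) (mulgA x (w 0%N) (walk_tail w n)).
  under [RHS]eq_Rintegral do rewrite walk_tail_coord mulgA.
  rewrite (@markov_exp (fun g w => h (x * g * w m)%g * h (x * g * w n)%g) (M * M))//; last first.
    by move=> g; apply: (bdd_measM _ _).1; exact: bdd_meas_coord hM.
  rewrite (@markov_exp (fun g w => h (x * g * w m)%g ^+ 2) (M * M))//; last first.
    by move=> g w; rewrite expr2.
    by move=> g; under eq_fun do rewrite expr2; apply: (bdd_measM _ _).1; exact: bdd_meas_coord hM.
  by apply: eq_Rintegral => w _; rewrite IH.
Qed.

End Markov.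

(** * Shift-invariant events and their harmonic functions *)

Section InvariantSets.
Context (R : realType) (G : groupType) (G_countable : countable [set: G])
  (G_infinite : infinite_set [set: G]) (mu : G -> R)
  (P : probability (Omega G) R) (P_law : rw_law mu P).
Implicit Types (w : Omega G) (x g : G) (A D : set (Omega G)).

Definition hit_prob D x : R := \int[P]_w \1_D (path_act x w : Omega G).

Lemma shift_path_act x w :
  walk_shift (path_act x w) = path_act (x * w 0%N)%g (walk_tail w).
Proof.
by apply/funext => n; rewrite /walk_shift /path_act -mulgA -walk_tail_coord.
Qed.

Lemma shift_invariantE D w : shift_invariant D -> D (walk_shift w) = D w.
Proof. by move=> [_ DD]; rewrite -[in RHS]DD. Qed.

Lemma indic_path_act D x w : shift_invariant D ->
  \1_D (path_act x w : Omega G) = \1_D (path_act (x * w 0%N)%g (walk_tail w) : Omega G) :> R.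
Proof.
by move=> iD; rewrite !indicE -shift_path_act; congr (nat_of_bool _)%:R;
  apply/idP/idP; rewrite !inE shift_invariantE.
Qed.

Lemma bdd_meas_hit D x : measurable D ->
  bdd_meas (fun w : Omega G => \1_D (path_act x w : Omega G) : R).
Proof.
move=> mD; apply: (@bdd_meas_comp _ _ _ _ _ \1_D); first exact: bdd_meas_indic.
exact: measurable_path_act.
Qed.

Lemma hit_prob_ge0 D x : 0 <= hit_prob D x.
Proof. by apply: Exp_ge0 => w; rewrite indicE. Qed.

Lemma hit_prob_norm D x : measurable D -> `|hit_prob D x| <= 1.
Proof.
move=> mD; apply: normr_Exp_le; first exact: bdd_meas_hit.
by move=> w; rewrite indicE; case: (_ \in _); rewrite ?normr1 ?normr0.
Qed.

(** Dropping the first position does not affect membership in [D], and what remains is a walk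
    restarted at [x * w 0]. *)
Lemma hit_prob_harmonic D : shift_invariant D -> harmonic P (hit_prob D).
Proof.
move=> iD x; have mD := iD.1; rewrite /markov_op /hit_prob.
under [RHS]eq_Rintegral do rewrite (indic_path_act _ _ iD).
rewrite (@markov_exp _ _ G_countable G_infinite _ _ P_law
  (fun g w => \1_D (path_act (x * g)%g w : Omega G)) 1)//.
- by move=> g; exact: (bdd_meas_hit _ mD).1.
- by move=> g w; rewrite indicE; case: (_ \in _); rewrite ?normr1 ?normr0.
Qed.

Lemma markov_op_ge (u : G -> R) M x g : 0 <= mu g -> (forall y, 0 <= u y <= M) ->
  mu g * u (x * g)%g <= markov_op P u x.
Proof.
move=> mug uM; have bu : bdd_meas (fun w : Omega G => u (x * w 0%N)%g).
  by apply: (@bdd_meas_coord _ _ G_countable _ M) => y; have /andP[u0 ?] := uM y; rewrite ger0_norm.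
have -> : mu g = \int[P]_w \1_[set w : Omega G | w 0%N = g] w.
  by rewrite Exp_indic; [rewrite (walk_start P_law)|exact: measurable_coord].
rewrite mulrC -ExpZ; last by apply: bdd_meas_indic; exact: measurable_coord.
apply: le_Exp => // [|w].
  by apply: bdd_measZ; apply: bdd_meas_indic; exact: measurable_coord.
rewrite indicE; have [|_] := boolP (w \in _); first by rewrite inE/= => ->; rewrite mulr1.
by rewrite mulr0; have /andP[] := uM (x * w 0%N)%g.
Qed.

(** Minimum principle: a nonnegative harmonic function that vanishes at a point vanishes after every
    step of positive weight, and such steps lead from [1] to every element of the group. *)
Lemma hit_prob_null D : prob_on_group mu -> supp_generates_semigroup mu ->
  shift_invariant D -> hit_prob D 1%g = 0 -> forall x, hit_prob D x = 0.
Proof.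
move=> [mu0 _] gen iD D1.
have bD y : 0 <= hit_prob D y <= 1.
  by rewrite hit_prob_ge0/= -[leLHS]ger0_norm ?hit_prob_ge0// hit_prob_norm//; exact: iD.1.
have step x g : 0 < mu g -> hit_prob D x = 0 -> hit_prob D (x * g)%g = 0.
  move=> g0 Dx; apply/eqP; rewrite eq_le hit_prob_ge0 andbT.
  have := markov_op_ge x (mu0 g) bD.
  by rewrite (hit_prob_harmonic iD) Dx pmulr_rle0.
have H s : (forall h, h \in s -> 0 < mu h) -> forall y, hit_prob D y = 0 ->
    hit_prob D (y * foldr (fun h acc => (h * acc)%g) 1%g s)%g = 0.
  elim: s => [|g s IH] sP y Dy /=; first by rewrite mulg1.
  rewrite mulgA; apply: IH => [h hs|]; first by apply: sP; rewrite inE hs orbT.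
  by apply: step => //; apply: sP; rewrite mem_head.
move=> x; have [s [_ [sP ->]]] := gen x.
by rewrite -[foldr _ _ _]mul1g; exact: H.
Qed.

(* A weak form of Levy's zero-one law. *)
Lemma hit_prob_levy D A : shift_invariant D -> measurable A -> forall x,
  (fun i => \int[P]_w (\1_A w * hit_prob D (x * w i)%g)) @ \oo -->
  \int[P]_w (\1_A w * \1_D (path_act x w : Omega G)).
Proof.
move=> iD; have mD := iD.1.
have bh x i : bdd_meas (fun w : Omega G => hit_prob D (x * w i)%g).
  by apply: (@bdd_meas_coord _ _ G_countable _ 1) => y; exact: hit_prob_norm.
have bI x := bdd_meas_hit x mD.
have bA A0 : measurable A0 -> bdd_meas (\1_A0 : Omega G -> R) by exact: bdd_meas_indic.
(* For the whole space the integrals do not depend on the time [i], by harmonicity. *)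
have EhD x i : \int[P]_w hit_prob D (x * w i)%g = hit_prob D x.
  apply: (@harmonic_walk _ _ G_countable G_infinite _ _ P_law _ 1).
    exact: hit_prob_harmonic.
  by move=> g; exact: hit_prob_norm.
have QT x : (fun i => \int[P]_w (\1_[set: Omega G] w * hit_prob D (x * w i)%g)) @ \oo -->
  \int[P]_w (\1_[set: Omega G] w * \1_D (path_act x w : Omega G)).
  have E f : \int[P]_w (\1_[set: Omega G] w * f w) = \int[P]_w f w.
    by apply: eq_Rintegral => w _; rewrite indicT mul1r.
  under eq_fun do rewrite E EhD.
  by rewrite E; exact: cvg_cst.
move: A; rewrite (measurable_full_cylinders G_countable G_infinite).
apply: (@dynkin_induction _ (Omega G) (@full_cylinders G)).
- exact: measurable_full_cylinders.
- exact: full_cylinders_setI.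
- exact: QT.
- move=> _ [->|[n [k ->]]] x.
    have E f : \int[P]_w (\1_(@set0 (Omega G)) w * f w) = 0.
      by under eq_Rintegral do rewrite indic0 mul0r; rewrite Exp_cst.
    under eq_fun do rewrite E.
    by rewrite E; exact: cvg_cst.
  (* Fixing the first position moves the start to [x * k 0] and shortens the cylinder, hence the
     induction over all starting points. *)
  elim: n k x => [|n IH] k x; first by rewrite cylinder0; exact: QT.
  set A' := cylinder n (fun i => ((k 0%N)^-1 * k i.+1)%g).
  have mA' : measurable A' by exact: measurable_cylinder.
  have E1 w : \1_(cylinder n.+1 k) w =
      \1_[set w : Omega G | w 0%N = k 0%N] w * \1_A' (walk_tail w) :> R.
    by rewrite cylinderS indicI /= !indicE.
  have E2 : \int[P]_w (\1_(cylinder n.+1 k) w * \1_D (path_act x w : Omega G)) =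
      mu (k 0%N) * \int[P]_w (\1_A' w * \1_D (path_act (x * k 0%N)%g w : Omega G)).
    rewrite -(markov_start G_countable G_infinite P_law); last by apply: bdd_measM; [exact: bA|exact: bI].
    apply: eq_Rintegral => w _; rewrite E1 -mulrA (indic_path_act x w iD).
    by rewrite [\1_(mkset _) w]indicE; have [|_] := boolP (w \in _); rewrite ?mul0r// inE/= => ->.
  rewrite E2 -cvg_shiftS /=.
  rewrite (_ : (fun i => _) = (fun i => mu (k 0%N) *
      \int[P]_w (\1_A' w * hit_prob D (x * k 0%N * w i)%g))).
    by apply: cvgMr; exact: IH.
  apply/funext => i; rewrite -(markov_start G_countable G_infinite P_law); last by apply: bdd_measM; [exact: bA|exact: bh].
  apply: eq_Rintegral => w _; rewrite E1 -mulrA walk_tail_coord mulgA.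
  by rewrite [\1_(mkset _) w]indicE; have [|_] := boolP (w \in _); rewrite ?mul0r// inE/= => ->.
- move=> A mA QA x.
  have E f : bdd_meas f -> \int[P]_w (\1_(~` A) w * f w) =
      \int[P]_w (\1_[set: Omega G] w * f w) - \int[P]_w (\1_A w * f w) :> R.
    move=> bf; rewrite -ExpB; [|by apply: bdd_measM => //; exact: bA..].
    apply: eq_Rintegral => w _; rewrite !indicE in_setC in_setT.
    by case: (w \in A); rewrite ?mul1r ?mul0r ?subrr ?subr0.
  under eq_fun do rewrite E//.
  rewrite E//; apply: cvgB; [exact: QT|exact: QA].
- move=> F mF tF QF x.
  have mU : measurable (\bigcup_k F k) by exact: bigcupT_measurable.
  pose S n w : R := \sum_(j < n) \1_(F j) w.
  have bS n : bdd_meas (S n) by apply: bdd_meas_sum => j; exact: bA.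
  have S01 w : (exists k, \1_(\bigcup_k F k) w = 1 :> R /\ forall n, S n w = (k < n)%N%:R) \/
      (\1_(\bigcup_k F k) w = 0 :> R /\ forall n, S n w = 0).
    have [[k _ Fkw]|nU] := pselect ((\bigcup_k F k) w); [left; exists k|right].
      split=> [|n]; first by rewrite indicE mem_set//; exists k.
      rewrite /S; case: ltnP => [kn|nk]; last first.
        rewrite big1// => j _; rewrite indicE memNset// => Fjw.
        have := tF j k I I (ex_intro _ w (conj Fjw Fkw)).
        by move=> /= jk; have := ltn_ord j; rewrite jk ltnNge nk.
      rewrite (bigD1 (Ordinal kn))//= indicE mem_set// big1 ?addr0// => j jk.
      rewrite indicE memNset// => Fjw; move/eqP: jk; apply; apply/val_inj => /=.
      exact: tF j k I I (ex_intro _ w (conj Fjw Fkw)).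
    split=> [|n]; first by rewrite indicE memNset.
    by rewrite /S big1// => j _; rewrite indicE memNset// => Fjw; apply: nU; exists j.
  have SU n w : `|\1_(\bigcup_k F k) w - S n w| <= 1.
    have [[k [-> ->]]|[-> ->]] := S01 w; last by rewrite subrr normr0.
    by case: (k < n)%N; rewrite ?subrr ?normr0// subr0 normr1.
  have bUS n : bdd_meas (fun w => \1_(\bigcup_k F k) w - S n w).
    by apply: bdd_measB => //; exact: bA.
  have cU : (fun n => \int[P]_w `|\1_(\bigcup_k F k) w - S n w|) @ \oo --> 0.
    rewrite -[X in _ --> X](Exp_cst P); apply: (@Exp_cvg _ _ _ _ _ _ 1).
    - by move=> n; exact: (bdd_meas_norm (bUS n)).1.
    - exact: measurable_cst.
    - by move=> n w; rewrite normr_id.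
    - apply: aeW => w; apply: cvg_near_cst.
      have [[k [-> Sk]]|[-> S0]] := S01 w; last by apply: nearW => n; rewrite S0 subrr normr0.
      by exists k.+1 => // n /= kn; rewrite Sk kn subrr normr0.
  have QS n : (fun i => \int[P]_w (S n w * hit_prob D (x * w i)%g)) @ \oo -->
     \int[P]_w (S n w * \1_D (path_act x w : Omega G)).
    have E f : bdd_meas f -> \int[P]_w (S n w * f w) =
       \sum_(j < n) \int[P]_w (\1_(F j) w * f w).
      move=> bf; rewrite -Exp_sum; last by move=> j; apply: bdd_measM => //; exact: bA.
      by apply: eq_Rintegral => w _; rewrite -mulr_suml.
    under eq_fun do rewrite E//.
    by rewrite E//; apply: cvg_sumr => j; exact: QF.
  (* Replacing the union by its first [n] members costs an amount that does not depend on the time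
     [i], so the two limits may be exchanged. *)
  have dist n f : bdd_meas f -> (forall w, `|f w| <= 1) ->
      `|\int[P]_w (\1_(\bigcup_k F k) w * f w) - \int[P]_w (S n w * f w)| <=
      \int[P]_w `|\1_(\bigcup_k F k) w - S n w|.
    move=> bf f1; rewrite -ExpB; [|by apply: bdd_measM => //; exact: bA|exact: bdd_measM].
    under eq_Rintegral do rewrite -mulrBl.
    rewrite (le_trans (normr_Exp _ _))//; first exact: bdd_measM.
    apply: le_Exp => [||w]; [exact/bdd_meas_norm/bdd_measM|exact: bdd_meas_norm|].
    by rewrite normrM ler_piMr.
  apply/cvgrPdist_le => e e0.
  have e3 : 0 < e / 3 by exact: divr_gt0.
  have /cvgrPdist_le/(_ _ e3)[n _ Hn] := cU.
  have {Hn} := Hn n (leqnn n); rewrite sub0r normrN ger0_norm; last exact: Exp_ge0.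
  move=> Hn; have /cvgrPdist_le/(_ _ e3) := QS n; apply: filterS => i Hi.
  have Hx1 := le_trans (dist n _ (bh x i) (fun w => hit_prob_norm (x * w i)%g mD)) Hn.
  have Hx2 : `|\int[P]_w (\1_(\bigcup_k F k) w * \1_D (path_act x w : Omega G)) -
     \int[P]_w (S n w * \1_D (path_act x w : Omega G))| <= e / 3.
    apply: le_trans (dist n _ (bI x) _) Hn => w.
    by rewrite indicE; case: (_ \in _); rewrite ?normr1 ?normr0.
  move: Hi Hx1 Hx2; rewrite !ler_norml => /andP[? ?] /andP[? ?] /andP[? ?].
  by apply/andP; split; lra.
Qed.

End InvariantSets.

(** * Limits of bounded sequences of functions *)

Section LimitFunction.
Context (R : realType).

Lemma limn_sup_eq (u v : R^nat) M : (forall n, `|u n| <= M) -> (forall n, `|v n| <= M) ->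
  (fun n => u n - v n) @ \oo --> (0 : R) -> limn_sup u = limn_sup v.
Proof.
have bd w K : (forall n, `|w n| <= K) -> bounded_fun (w : R^nat).
  move=> wK; exists K; split; first exact: num_real.
  by move=> y Ky n _ /=; rewrite (le_trans (wK n))// ltW.
move=> uM vM uv.
have half (a b : R^nat) : (forall n, `|a n| <= M) -> (forall n, `|b n| <= M) ->
    (fun n => a n - b n) @ \oo --> (0 : R) -> limn_sup a <= limn_sup b.
  move=> aM bM ab.
  have -> : a = b \+ (fun n => a n - b n) by apply/funext => n /=; rewrite addrC subrK.
  rewrite (le_trans (le_limn_supD (bd _ _ bM) (bd _ (M + M) _)))//.
    by move=> n; rewrite (le_trans (ler_normB _ _))// lerD.
  by have [_ ->] := cvg_limn_inf_sup ab; rewrite addr0.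
apply/eqP; rewrite eq_le !half//.
rewrite (_ : (fun n => _) = (fun n => - (u n - v n))); last by apply/funext => n; rewrite opprB.
by rewrite -oppr0; apply: cvgN.
Qed.

Context d (T : measurableType d) (P : probability T R).

(** The increments have summable [L1] norms, so the series of their absolute values has a finite
    integral and converges almost everywhere. *)
Lemma ae_cvg_of_L1 (f : nat -> T -> R) c : (forall n, bdd_meas (f n)) ->
  (forall n, \int[P]_x `|f n.+1 x - f n x| <= c * 2^-1 ^+ n) ->
  {ae P, forall x, cvgn (f ^~ x)}.
Proof.
move=> bf fc; pose D n x := `|f n.+1 x - f n x|.
have bD n : bdd_meas (D n) by apply: bdd_meas_norm; exact: bdd_measB.
have mD n : measurable_fun setT (fun x => (D n x)%:E) by apply/measurable_EFinP; exact: (bD n).1.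
have D0 n x : (0 <= (D n x)%:E)%E by rewrite lee_fin /D.
have c0 : 0 <= c by have := le_trans (Exp_ge0 P (fun x => normr_ge0 (f 1%N x - f 0%N x))) (fc 0%N); rewrite expr0 mulr1.
have ifin : (\int[P]_x (\sum_(n <oo) (D n x)%:E) <= (c * 2)%:E)%E.
  rewrite integral_nneseries//.
  apply: lime_le; first by apply: is_cvg_nneseries => n _ _; apply: integral_ge0 => x _; exact: D0.
  apply: nearW => n; under eq_bigr do rewrite -Exp_EFin//.
  rewrite sumEFin lee_fin; apply: (@le_trans _ _ (\sum_(0 <= k < n) c * 2^-1 ^+ k)).
    by apply: ler_sum => k _; exact: fc.
  rewrite -mulr_sumr ler_wpM2l//.
  suff -> : \sum_(0 <= k < n) 2^-1 ^+ k = 2 - 2 * 2^-1 ^+ n :> R.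
    by rewrite gerBl mulr_ge0// exprn_ge0.
  elim: n => [|n IH]; first by rewrite big_geq// expr0 mulr1 subrr.
  by rewrite big_nat_recr//= IH exprS mulrA divff// mul1r; ring.
have mS : measurable_fun setT (fun x => \sum_(n <oo) (D n x)%:E)%E.
  by apply: ge0_emeasurable_sum => // n x _ _; exact: D0.
have int : P.-integrable setT (fun x => \sum_(n <oo) (D n x)%:E)%E.
  apply/integrableP; split => //; under eq_integral => x _.
    rewrite gee0_abs; last by apply: nneseries_ge0 => n _ _; exact: D0.
    over.
  by apply: le_lt_trans ifin _; rewrite ltry.
have := integrable_ae measurableT int; apply: filterS => x /(_ I) fin.
have cS : cvgn (series (fun n => D n x)).
  apply: nondecreasing_is_cvgn; first by apply: nondecreasing_series => n _ _; rewrite /D.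
  exists (fine (\sum_(n <oo) (D n x)%:E)%E) => _ [n _ <-].
  rewrite -lee_fin fineK// /series/= -sumEFin.
  by apply: nneseries_lim_ge => k _ _; exact: D0.
have : cvgn (series (telescope (f^~ x))) by apply: normed_cvg.
rewrite telescopeK => cT.
have -> : f^~ x = (fun n => f n x - f 0%N x) + (fun=> f 0%N x).
  by apply/funext => n /=; rewrite fctE subrK.
by apply: is_cvgD => //; exact: is_cvg_cst.
Qed.

End LimitFunction.

(** * Harmonic functions and the boundary *)

Section BoundaryRepresentation.
Context (R : realType) (G : groupType) (G_countable : countable [set: G])
  (G_infinite : infinite_set [set: G]) (mu : G -> R)
  (P : probability (Omega G) R) (P_law : rw_law mu P).
Implicit Types (e : R) (w : Omega G) (x g : G) (h : G -> R) (D : set (Omega G)).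

(** Averaging makes limits along a sparse sequence of times insensitive to the shift at every path,
    which [h (w n)] alone would not be. A sparse sequence then yields almost sure convergence from
    mean square bounds only. *)
Definition walk_avg h n w : R := n.+1%:R^-1 * \sum_(i < n.+1) h (w i).

Lemma normr_avg (n : nat) (u : nat -> R) M : (forall i, `|u i| <= M) ->
  `|n.+1%:R^-1 * \sum_(i < n.+1) u i| <= M.
Proof.
move=> uM; rewrite normrM ger0_norm ?invr_ge0// ler_pdivrMl//.
rewrite (le_trans (ler_norm_sum _ _ _))//.
apply: (@le_trans _ _ (\sum_(i < n.+1) M)); first exact: ler_sum.
by rewrite sumr_const card_ord mulr_natl.
Qed.

Lemma walk_avg_shift h n w : (forall g, `|h g| <= 1) ->
  `|walk_avg h n (walk_shift w) - walk_avg h n w| <= 2 / n.+1%:R.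
Proof.
move=> h1; rewrite /walk_avg -mulrBr.
have -> : \sum_(i < n.+1) h (walk_shift w i) = \sum_(i < n) h (w i.+1) + h (w n.+1).
  by rewrite big_ord_recr.
have -> : \sum_(i < n.+1) h (w i) = h (w 0%N) + \sum_(i < n) h (w i.+1).
  by rewrite big_ord_recl.
set S := \sum_(i < n) _.
rewrite normrM ger0_norm ?invr_ge0// mulrC ler_wpM2r ?invr_ge0//.
rewrite (_ : S + h (w n.+1) - (h (w 0%N) + S) = h (w n.+1) - h (w 0%N)); last by ring.
by rewrite (le_trans (ler_normB _ _))// (_ : 2 = 1 + 1)// lerD.
Qed.

Lemma bdd_meas_walk_avg h n x : (forall g, `|h g| <= 1) ->
  bdd_meas (fun w : Omega G => walk_avg h n (path_act x w)).
Proof.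
move=> h1; apply: bdd_measZ; apply: bdd_meas_sum => i.
exact: bdd_meas_coord h1.
Qed.

Let V h x n : R := \int[P]_w (h (x * w n)%g ^+ 2).

Let bcoord h x n : (forall g, `|h g| <= 1) -> bdd_meas (fun w : Omega G => h (x * w n)%g).
Proof. exact: bdd_meas_coord. Qed.

Let V_dist h x m n : harmonic P h -> (forall g, `|h g| <= 1) -> (m <= n)%N ->
  \int[P]_w ((h (x * w n)%g - h (x * w m)%g) ^+ 2) = V h x n - V h x m.
Proof.
move=> hh h1 mn.
have E := harmonic_walk_prod G_countable G_infinite P_law x hh h1 mn.
transitivity (\int[P]_w ((h (x * w n)%g ^+ 2 - 2 * (h (x * w m)%g * h (x * w n)%g)) + h (x * w m)%g ^+ 2)).
  by apply: eq_Rintegral => w _; ring.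
have b2 k : bdd_meas (fun w : Omega G => h (x * w k)%g ^+ 2).
  by under eq_fun do rewrite expr2; apply: bdd_measM; exact: bcoord.
have bp : bdd_meas (fun w : Omega G => h (x * w m)%g * h (x * w n)%g).
  by apply: bdd_measM; exact: bcoord.
rewrite ExpD//; last by apply: bdd_measB => //; exact: bdd_measZ.
rewrite ExpB//; last exact: bdd_measZ.
by rewrite ExpZ// E /V; ring.
Qed.

Let V_L1 h x m n e : harmonic P h -> (forall g, `|h g| <= 1) -> (m <= n)%N -> 0 < e ->
  V h x n - V h x m <= e ^+ 2 ->
  \int[P]_w `|h (x * w n)%g - h (x * w m)%g| <= e.
Proof.
move=> hh h1 mn e0 Ve; set Y := fun w : Omega G => h (x * w n)%g - h (x * w m)%g.
have bY : bdd_meas Y by apply: bdd_measB; exact: bcoord.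
have bY2 : bdd_meas (fun w => Y w ^+ 2).
  by under eq_fun do rewrite expr2; exact: bdd_measM.
(* The pointwise inequality [|y| <= y^2 / (2 e) + e / 2] does the work of Cauchy-Schwarz. *)
apply: (@le_trans _ _ (\int[P]_w ((2 * e)^-1 * Y w ^+ 2 + e / 2))).
  apply: le_Exp => [||w]; first exact: bdd_meas_norm.
    by apply: bdd_measD; [exact: bdd_measZ|exact: bdd_meas_cst].
  rewrite -/(Y w) -subr_ge0; move: (Y w) => y.
  rewrite (_ : _ - _ = (2 * e)^-1 * (`|y| - e) ^+ 2).
    by rewrite mulr_ge0// ?sqr_ge0// invr_ge0 mulr_ge0// ltW.
  by rewrite sqrrB real_normK ?num_real//; field; rewrite gt_eqF.
rewrite ExpD; [|exact: bdd_measZ|exact: bdd_meas_cst].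
rewrite Exp_cst ExpZ// V_dist//.
apply: (@le_trans _ _ ((2 * e)^-1 * e ^+ 2 + e / 2)).
  by rewrite lerD2r ler_wpM2l// invr_ge0 mulr_ge0// ltW.
by rewrite le_eqVlt; apply/orP; left; apply/eqP; field; rewrite gt_eqF.
Qed.

(** A bounded harmonic function is the integral of a shift-invariant function of the path. Two
    starting points are served at once because the times of the averages are chosen to give fast
    convergence from both. The last clause localises: if [|h|] is at most the chance of [D], then
    [phi] vanishes almost surely off [D]. *)
Lemma boundary_representation h x1 x2 : harmonic P h -> (forall g, `|h g| <= 1) ->
  exists phi : Omega G -> R, [/\ measurable_fun setT phi,
    forall w, `|phi w| <= 1, forall w, phi (walk_shift w) = phi w &
    forall x, x = x1 \/ x = x2 -> h x = \int[P]_w phi (path_act x w) /\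
      forall D, shift_invariant D -> (forall g, `|h g| <= hit_prob P D g) ->
        \int[P]_w (\1_(~` D) (path_act x w : Omega G) * `|phi (path_act x w)|) = 0].
Proof.
move=> hh h1.
have V01 x n : 0 <= V h x n <= 1.
  apply/andP; split; first by apply: Exp_ge0 => w; exact: sqr_ge0.
  rewrite -[leRHS](Exp_cst P) /V; apply: le_Exp; [|exact: bdd_meas_cst|move=> w].
    by under eq_fun do rewrite expr2; apply: bdd_measM; exact: bcoord.
  by have := h1 (x * w n)%g; rewrite ler_norml => /andP[? ?]; nra.
have Vnd x m n : (m <= n)%N -> V h x m <= V h x n.
  by move=> mn; rewrite -subr_ge0 -V_dist//; apply: Exp_ge0 => w; exact: sqr_ge0.
(* Both summands are nondecreasing, so a bound on the growth of the sum bounds both, and one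
   sequence of times fits both starts. *)
pose W n := V h x1 n + V h x2 n.
have cW : cvgn W.
  apply: nondecreasing_is_cvgn; first by move=> m n mn; rewrite lerD ?Vnd.
  by exists 2 => _ [n _ <-]; have /andP[_ ?] := V01 x1 n; have /andP[_ ?] := V01 x2 n; rewrite /W; lra.
have exN j : exists N, forall n, (N <= n)%N -> W n - W N <= (2^-1 ^+ j) ^+ 2.
  have ej : 0 < (2^-1 ^+ j) ^+ 2 :> R by rewrite !exprn_gt0.
  move/cvgrPdist_le : cW => /(_ _ (divr_gt0 ej (ltr0n _ 2)))[N _ HN].
  exists N => n Nn; have := HN N (leqnn N); have := HN n Nn.
  by rewrite !ler_norml => /andP[? ?] /andP[? ?]; lra.
have [N HN] := choice exN.
(* The terms before time [N j], each off by at most 2, weigh at most [2 * 2^-j] in an average of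
   this length. Together with the later terms this gives the constant 3 in [aN]. *)
pose m j := ((N j).+1 * 2 ^ j)%N.-1.
have mE j : (m j).+1 = ((N j).+1 * 2 ^ j)%N by rewrite prednK// muln_gt0 expn_gt0.
have Hx x j n : x = x1 \/ x = x2 -> (N j <= n)%N ->
    \int[P]_w `|h (x * w n)%g - h (x * w (N j))%g| <= 2^-1 ^+ j.
  move=> xx Nn; apply: V_L1 => //.
  apply: le_trans (HN j n Nn); rewrite /W.
  by have := Vnd x1 _ _ Nn; have := Vnd x2 _ _ Nn; case: xx => ->; lra.
have bdiff x a b : bdd_meas (fun w : Omega G => `|h (x * w a)%g - h (x * w b)%g|).
  by apply: bdd_meas_norm; apply: bdd_measB; exact: bcoord.
pose a j w := walk_avg h (m j) w.
have ba x j : bdd_meas (fun w : Omega G => a j (path_act x w)) by exact: bdd_meas_walk_avg.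
have a1 j w : `|a j w| <= 1 by exact: (normr_avg (m j) (fun i => h1 (w i))).
have aN x j : x = x1 \/ x = x2 ->
    \int[P]_w `|a j (path_act x w) - h (x * w (N j))%g| <= 3 * 2^-1 ^+ j.
  move=> xx.
  have pt w : `|a j (path_act x w) - h (x * w (N j))%g| <=
     (m j).+1%:R^-1 * \sum_(i < (m j).+1) `|h (x * w i)%g - h (x * w (N j))%g|.
    rewrite /a /walk_avg -[X in _ - X](@mulKf _ (m j).+1%:R) ?pnatr_eq0//.
    rewrite -mulrBr normrM ger0_norm ?invr_ge0// ler_wpM2l ?invr_ge0//.
    rewrite (_ : (m j).+1%:R * _ = \sum_(i < (m j).+1) h (x * w (N j))%g); last first.
      by rewrite sumr_const card_ord mulr_natl.
    by rewrite -sumrB ler_norm_sum.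
  apply: (@le_trans _ _ (\int[P]_w ((m j).+1%:R^-1 *
      \sum_(i < (m j).+1) `|h (x * w i)%g - h (x * w (N j))%g|))).
    apply: le_Exp => //; last by apply: bdd_measZ; apply: bdd_meas_sum => i.
    by apply: bdd_meas_norm; apply: bdd_measB => //; exact: bcoord.
  rewrite ExpZ; last by apply: bdd_meas_sum => i.
  rewrite Exp_sum// ler_pdivrMl//.
  have Nm : (N j <= (m j).+1)%N by rewrite mE (leq_trans (leqnSn _))// leq_pmulr// expn_gt0.
  rewrite -(big_mkord xpredT (fun i => \int[P]_w `|h (x * w i)%g - h (x * w (N j))%g|)).
  rewrite (big_cat_nat _ Nm)//=.
  apply: (@le_trans _ _ (\sum_(0 <= i < N j) 2 + \sum_(N j <= i < (m j).+1) 2^-1 ^+ j)).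
    apply: lerD; last by apply: ler_sum_nat => i /andP[Ni _]; exact: Hx.
    apply: ler_sum => i _; apply: le_trans (ler_norm _) _.
    apply: normr_Exp_le => // w; rewrite normr_id (le_trans (ler_normB _ _))//.
    by rewrite (_ : 2 = 1 + 1)// lerD.
  rewrite !sumr_const_nat subn0.
  have e0 : 0 < 2^-1 ^+ j :> R by exact: exprn_gt0.
  have E : (m j).+1%:R * 2^-1 ^+ j = (N j).+1%:R :> R.
    by rewrite mE natrM natrX exprVn mulfK// expf_neq0.
  have : 2^-1 ^+ j *+ ((m j).+1 - N j) <= (m j).+1%:R * 2^-1 ^+ j :> R.
    by rewrite -[leLHS]mulr_natl ler_wpM2r// ?(ltW e0)// ler_nat leq_subr.
  rewrite mulrCA E -natr1 -[2 *+ _]mulr_natr => ?; have : 0 <= (N j)%:R :> R by [].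
  by lra.
(* The constant 7 is generous: the three distances used add up to [(3/2 + 1 + 3) * 2^-j]. *)
have aae x : x = x1 \/ x = x2 -> {ae P, forall w, cvgn (fun j => a j (path_act x w))}.
  move=> xx; apply: (@ae_cvg_of_L1 _ _ _ P (fun j w => a j (path_act x w)) 7) => // j.
  have NN : \int[P]_w `|h (x * w (N j.+1))%g - h (x * w (N j))%g| <= 2^-1 ^+ j.
    have [NN|/ltnW NN] := leqP (N j) (N j.+1); first exact: Hx.
    under eq_Rintegral do rewrite distrC.
    rewrite (le_trans (Hx x j.+1 (N j) xx NN))// exprS ger_pMl ?exprn_gt0//.
    by rewrite invf_le1// ler1n.
  have b3 j' : bdd_meas (fun w : Omega G => `|a j' (path_act x w) - h (x * w (N j'))%g|).
    by apply: bdd_meas_norm; apply: bdd_measB => //; exact: bcoord.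
  apply: (@le_trans _ _ (\int[P]_w ((`|a j.+1 (path_act x w) - h (x * w (N j.+1))%g| +
       `|h (x * w (N j.+1))%g - h (x * w (N j))%g|) + `|a j (path_act x w) - h (x * w (N j))%g|))).
    apply: le_Exp => [||w].
    - by apply: bdd_meas_norm; exact: bdd_measB.
    - by apply: bdd_measD => //; exact: bdd_measD.
    - rewrite [X in _ <= _ + X]distrC.
      rewrite (_ : a j.+1 _ - a j _ = ((a j.+1 (path_act x w) - h (x * w (N j.+1))%g) +
        (h (x * w (N j.+1))%g - h (x * w (N j))%g)) + (h (x * w (N j))%g - a j (path_act x w))); last by ring.
      by rewrite (le_trans (ler_normD _ _))// lerD2r ler_normD.
  rewrite ExpD//; last exact: bdd_measD.
  rewrite ExpD//; have := aN x j xx; have := aN x j.+1 xx; rewrite exprS.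
  have : 0 < 2^-1 ^+ j :> R by exact: exprn_gt0.
  by move: NN; lra.
(* Clamping gives the bound at every path without an estimate of the limit superior. *)
pose phi w := Num.max (-1) (Num.min 1 (limn_sup (fun j => a j w))) : R.
have mcoord : measurable_fun setT phi.
  apply: measurable_maxr => //; apply: measurable_minr => //.
  apply: measurable_fun_limn_sup => [w _|w _|j].
  - by exists 1 => _ [j _ <-]; have := a1 j w; rewrite ler_norml => /andP[].
  - by exists (-1) => _ [j _ <-]; have := a1 j w; rewrite ler_norml => /andP[].
  - have := (ba 1%g j).1; congr (measurable_fun _ _); apply/funext => w.
    by congr (a j _); apply/funext => i; rewrite /path_act mul1g.
have phi1 w : `|phi w| <= 1.
  rewrite ler_norml /phi; apply/andP; split; first by rewrite le_max lexx.
  by rewrite ge_max ge_min lexx /= andbT; lra.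
have phiE w : cvgn (fun j => a j w) -> (fun j => a j w) @ \oo --> phi w.
  move=> c; rewrite /phi cvg_limn_supE//.
  have lo : -1 <= limn (fun j => a j w).
    by apply: limr_ge => //; apply: nearW => j; have := a1 j w; rewrite ler_norml => /andP[].
  have hi : limn (fun j => a j w) <= 1.
    by apply: limr_le => //; apply: nearW => j; have := a1 j w; rewrite ler_norml => /andP[].
  by rewrite (min_idPr hi) (max_idPr lo).
have mx x : measurable_fun setT (fun w : Omega G => phi (path_act x w)).
  by apply: measurableT_comp => //; exact: measurable_path_act.
exists phi; split => //.
  move=> w; rewrite /phi (@limn_sup_eq _ _ (fun j => a j w) 1)//.
  apply/cvgrPdist_le => e e0; near=> j.
  rewrite sub0r normrN; apply: le_trans (walk_avg_shift _ _ h1) _.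
  rewrite ler_pdivrMr// mE.
  apply: (@le_trans _ _ (e * (2 ^ j)%:R)); last by rewrite ler_wpM2l ?(ltW e0)// ler_nat leq_pmull.
  rewrite mulrC -ler_pdivrMr//.
  apply: (@le_trans _ _ j%:R); last by rewrite ler_nat; exact/ltnW/ltn_expl.
  by near: j; exact: nbhs_infty_ger.
move=> x xx; have ax := aae x xx.
have cv : {ae P, forall w : Omega G, (fun j => a j (path_act x w)) @ \oo --> phi (path_act x w)}.
  by apply: filterS ax => w; exact: phiE.
split.
  have c := Exp_cvg (fun j => (ba x j).1) (mx x) (fun j w => a1 j (path_act x w)) cv.
  rewrite -(cvg_lim (@Rhausdorff R) c); apply/esym/lim_near_cst => //; apply: nearW => j.
  rewrite /a /walk_avg ExpZ; last by apply: bdd_meas_sum => i; exact: (bcoord x i h1).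
  rewrite Exp_sum; last by move=> i; exact: (bcoord x i h1).
  rewrite (eq_bigr (fun=> h x)); last first.
    by move=> i _; exact: (harmonic_walk G_countable G_infinite P_law i x hh h1).
  by rewrite sumr_const card_ord -[h x *+ _]mulr_natl mulKf// pnatr_eq0.
move=> D iD hD; have mD := iD.1.
have bD : bdd_meas (fun w : Omega G => \1_(~` D) (path_act x w : Omega G) : R).
  by apply: bdd_meas_hit => //; exact: measurableC.
have c1 : (fun j => \int[P]_w (\1_(~` D) (path_act x w : Omega G) * `|a j (path_act x w)|)) @ \oo -->
   \int[P]_w (\1_(~` D) (path_act x w : Omega G) * `|phi (path_act x w)|).
  apply: (@Exp_cvg _ _ _ P (fun j w => \1_(~` D) (path_act x w : Omega G) * `|a j (path_act x w)|) _ 1).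
  - by move=> j; apply: (bdd_measM bD (bdd_meas_norm (ba x j))).1.
  - by apply: measurable_funM; [exact: bD.1|exact: measurableT_comp].
  - move=> j w; rewrite normrM normr_id indicE; case: (_ \in _); rewrite ?normr1 ?mul1r// normr0 mul0r//.
  - by apply: filterS cv => w c; apply: cvgMr; exact: cvg_norm.
(* Off [D] the chance of [D] seen from the path tends to 0 in mean by [hit_prob_levy], hence so do
   its Cesaro means, which dominate the averages of [|h|]. *)
pose b i := \int[P]_w (\1_((@path_act G x : Omega G -> Omega G) @^-1` (~` D)) w * hit_prob P D (x * w i)%g).
have cb : b @ \oo --> 0.
  have mA : measurable ((@path_act G x : Omega G -> Omega G) @^-1` (~` D)).
    by rewrite -[_ @^-1` _]setTI; apply: measurable_path_act => //; exact: measurableC.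
  have := @hit_prob_levy _ _ G_countable G_infinite _ _ P_law _ _ iD mA x.
  rewrite [X in _ --> X -> _](_ : _ = 0)// -[RHS](Exp_cst P).
  apply: eq_Rintegral => w _; rewrite !indicE.
  have [Dw|nDw] := pselect (D (path_act x w)).
    by rewrite memNset ?mul0r//; exact: (@^~ Dw).
  by rewrite (memNset nDw) mulr0.
have mlim : m @ \oo --> \oo.
  move=> A [k _ kA]; exists k => // j /= kj; apply: kA => /=.
  rewrite -ltnS mE (leq_ltn_trans kj)// (leq_trans (ltn_expl j (ltnSn 1)))//.
  exact: leq_pmull.
have cm := cvg_comp _ _ mlim (cesaro cb).
have le_b j : 0 <= \int[P]_w (\1_(~` D) (path_act x w : Omega G) * `|a j (path_act x w)|) <=
    arithmetic_mean b (m j).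
  apply/andP; split; first by apply: Exp_ge0 => w; rewrite mulr_ge0// indicE.
  have bh i : bdd_meas (fun w : Omega G => hit_prob P D (x * w i)%g).
    by apply: (@bdd_meas_coord _ _ G_countable _ 1) => g; exact: hit_prob_norm.
  have bDh i : bdd_meas (fun w : Omega G => \1_(~` D) (path_act x w : Omega G) * hit_prob P D (x * w i)%g).
    exact: bdd_measM.
  have -> : arithmetic_mean b (m j) = \int[P]_w ((m j).+1%:R^-1 * \sum_(i < (m j).+1)
       (\1_(~` D) (path_act x w : Omega G) * hit_prob P D (x * w i)%g)).
    rewrite ExpZ; last by apply: bdd_meas_sum => i.
    by rewrite Exp_sum// /arithmetic_mean /series /= big_mkord.
  apply: le_Exp => [||w].
  - by apply: bdd_measM => //; exact: bdd_meas_norm.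
  - by apply: bdd_measZ; apply: bdd_meas_sum => i.
  rewrite -mulr_sumr mulrCA ler_wpM2l//.
  rewrite /a /walk_avg normrM ger0_norm ?invr_ge0// ler_wpM2l ?invr_ge0//.
  by rewrite (le_trans (ler_norm_sum _ _ _))//; apply: ler_sum => i _; exact: hD.
rewrite -(cvg_lim (@Rhausdorff R) c1).
apply/cvg_lim; first exact: Rhausdorff.
exact: (squeeze_cvgr (nearW _ le_b) (cvg_cst 0) cm).
Unshelve. all: by end_near. Qed.

End BoundaryRepresentation.

(** * Almost everywhere equalities and image measures *)

Section IntegralTools.
Context (R : realType) d (T : measurableType d) (P : probability T R).
Implicit Types (f g : T -> R).

Lemma ae_eq_Rintegral f g : measurable_fun setT f -> measurable_fun setT g ->
  {ae P, forall x, f x = g x} -> \int[P]_x f x = \int[P]_x g x.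
Proof.
move=> mf mg fg; congr fine; apply: ae_eq_integral => //; try exact/measurable_EFinP.
by apply: filterS fg => x ->.
Qed.

Lemma bdd_measM_int f g : bdd_meas f -> P.-integrable setT (EFin \o g) ->
  P.-integrable setT (EFin \o (fun x => f x * g x)).
Proof.
move=> [mf [M fM]] ig; have := @integrableMr _ _ _ P setT measurableT f (EFin \o g) mf _ ig.
apply; exists M; split; first exact: num_real.
by move=> y My x _ /=; rewrite (le_trans (fM x))// ltW.
Qed.

Lemma Rintegral_indic D f : measurable D ->
  \int[P]_(x in D) f x = \int[P]_x (\1_D x * f x).
Proof.
move=> mD; rewrite Rintegral_mkcond; apply: eq_Rintegral => x _.
by rewrite patchE indicE; case: (x \in D); rewrite ?mul1r ?mul0r.
Qed.

Lemma Rintegral_pushforward_eq d' (T' : measurableType d') (Q : probability T' R)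
  (q : T -> T') (f : T' -> R) : measurable_fun setT q ->
  (forall C, measurable C -> Q C = P (q @^-1` C)) ->
  measurable_fun setT f -> (forall y, 0 <= f y) ->
  (\int[Q]_y (f y)%:E = \int[P]_x (f (q x))%:E)%E.
Proof.
move=> mq Qq mf f0.
transitivity (\int[pushforward P q]_y (f y)%:E)%E.
  by apply: eq_measure_integral => C mC _; exact: Qq.
rewrite ge0_integral_pushforward//; last by move=> y _; rewrite lee_fin.
exact/measurable_EFinP.
Qed.

Lemma Exp_eq0_ae f : bdd_meas f -> \int[P]_x f x = 0 -> (forall x, 0 <= f x) ->
  {ae P, forall x, f x = 0}.
Proof.
move=> bf Ef f0.
have mf : measurable_fun setT (EFin \o f) by apply/measurable_EFinP; exact: bf.1.
have [+ _] := ae_eq_integral_abs P measurableT mf.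
have -> : (\int[P]_x `|(EFin \o f) x| = 0)%E.
  under eq_integral do rewrite /= ger0_norm//.
  by rewrite -Exp_EFin// Ef.
by move=> /(_ erefl); apply: filterS => x /(_ I) [].
Qed.

End IntegralTools.

(** * Changing the starting point on the Poisson boundary *)

Section Boundary.
Context (R : realType) (G : groupType) (G_countable : countable [set: G])
  (G_infinite : infinite_set [set: G]) (mu : G -> R)
  (mu_prob : prob_on_group mu) (mu_gen : supp_generates_semigroup mu)
  (P : probability (Omega G) R) (P_law : rw_law mu P).
Context d0 (B0 : measurableType d0) (a0 : G -> B0 -> B0) (beta : probability B0 R)
  (a0_meas : measurable_action a0) (p : Omega G -> B0)
  (p_inv : forall C, measurable C -> shift_invariant (p @^-1` C))
  (p_full : forall A, shift_invariant A -> exists C : set B0, measurable C /\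
        P ((A `\` p @^-1` C) `|` (p @^-1` C `\` A)) = 0%E)
  (p_law : forall C, measurable C -> beta C = P (p @^-1` C))
  (p_act : forall g, P.-negligible [set w | p (path_act g w) <> a0 g (p w)]).
Implicit Types (w : Omega G) (x g k : G) (C : set B0) (r : B0 -> R).

Lemma measurable_boundary_map : measurable_fun setT p.
Proof. by move=> _ C mC; rewrite setTI; have [] := p_inv mC. Qed.

(** Translating a path by [x] translates its end point by [x] almost surely, by [p_act]. *)
Lemma boundary_hit C x : measurable C ->
  hit_prob P (p @^-1` C) x = fine (beta (a0 x @^-1` C)).
Proof.
move=> mC; have mxC : measurable (a0 x @^-1` C).
  by rewrite -[_ @^-1` _]setTI; exact: a0_meas.2.
rewrite p_law// -Exp_indic; last by have [] := p_inv mxC.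
apply: ae_eq_Rintegral.
- exact: (@bdd_meas_hit R G G_countable _ x (p_inv mC).1).1.
- exact: (bdd_meas_indic R (p_inv mxC).1).1.
apply: (negligibleS _ (p_act x)) => w /=; apply: contra_not => E.
by rewrite !indicE; congr (nat_of_bool _)%:R; apply/idP/idP; rewrite !inE/= E.
Qed.

Lemma density_path k r : measurable_fun setT r -> (forall b, 0 <= r b) ->
  (forall C, measurable C -> (beta (a0 k @^-1` C) = \int[beta]_(b in C) (r b)%:E)%E) ->
  P.-integrable setT (EFin \o (r \o p)) /\ \int[P]_w r (p w) = 1.
Proof.
move=> mr r0 rk.
have mp := measurable_boundary_map.
have E : (\int[P]_w (r (p w))%:E = 1)%E.
  rewrite -(Rintegral_pushforward_eq mp p_law mr r0) -rk//.
  by rewrite preimage_setT probability_setT.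
split; last by rewrite /Rintegral E.
apply/integrableP; split; first by apply/measurable_EFinP; exact: measurableT_comp.
rewrite (_ : integral _ _ _ = 1%E) ?ltry// -[RHS]E.
by apply: eq_integral => w _; rewrite /= ger0_norm.
Qed.

(** A shift-invariant function of the path is, up to null sets, a function of the end point, whose
    law from the start [k] has density [r]. By [linear_ext] it suffices to treat the sets where
    [phi] lies in a given Borel set; these are shift-invariant as well. *)
Lemma boundary_change_start k r (phi : Omega G -> R) :
  measurable_fun setT r -> (forall b, 0 <= r b) ->
  (forall C, measurable C -> (beta (a0 k @^-1` C) = \int[beta]_(b in C) (r b)%:E)%E) ->
  bdd_meas phi -> (forall w, phi (walk_shift w) = phi w) ->
  \int[P]_w phi (path_act k w) = \int[P]_w (phi w * r (p w)).
Proof.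
move=> mr r0 rk bphi phi_shift.
have mp := measurable_boundary_map.
have [irp E1] := density_path mr r0 rk.
have bact f : bdd_meas f -> bdd_meas (fun w : Omega G => f (path_act k w) : R).
  by move=> bf; apply: (@bdd_meas_comp _ _ _ _ _ f) => //; exact: measurable_path_act.
apply/eqP; rewrite -subr_eq0; apply/eqP.
apply: (@linear_ext _ _ _ (fun f =>
  \int[P]_w f (path_act k w) - \int[P]_w (f w * r (p w))) 2) => //.
- move=> f g bf bg; under [X in _ - X]eq_Rintegral do rewrite mulrDl.
  rewrite [X in X - _](ExpD _ (bact _ bf) (bact _ bg)).
  by rewrite RintegralD//; [ring|exact: bdd_measM_int..].
- move=> c f bf; under [X in _ - X]eq_Rintegral do rewrite -mulrA.
  rewrite [X in X - _](ExpZ _ _ (bact _ bf)).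
  by rewrite RintegralZl//; [ring|exact: bdd_measM_int].
- move=> f K bf fK; rewrite (le_trans (ler_normB _ _))// (_ : 2 * K = K + K); last by ring.
  apply: lerD; first by apply: (@normr_Exp_le _ _ _ P (fun w => f (path_act k w)) K) => [|w //]; exact: (bact f).
  rewrite (le_trans (le_normr_Rintegral _ _))//; first exact: bdd_measM_int.
  apply: (@le_trans _ _ (\int[P]_w (K * r (p w)))); last by rewrite RintegralZl// E1 mulr1.
  apply: le_Rintegral => //.
  + rewrite (_ : EFin \o _ = abse \o (EFin \o (fun w => f w * r (p w)))).
      by apply: integrable_abse; exact: bdd_measM_int.
    by apply/funext => w.
  + by apply: bdd_measM_int => //; exact: bdd_meas_cst.
  + by move=> w _; rewrite normrM [`|r _|]ger0_norm// ler_wpM2r.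
- move=> S mS; set D := phi @^-1` S.
  have mD : measurable D by rewrite -[D]setTI; apply: bphi.1.
  have iD : shift_invariant D.
    by split => //; apply/seteqP; split => w; rewrite /D /= phi_shift.
  have [C [mC DC0]] := p_full iD.
  (* The exceptional set [E] is null for the walk started at [1]; being shift-invariant, it is null
     from [k] too, by [hit_prob_null]. *)
  set E := _ `|` _ in DC0; set D' := p @^-1` C in E DC0.
  have iD' : shift_invariant D' by exact: p_inv.
  have mD' := iD'.1.
  have mE : measurable E by apply: measurableU; apply: measurableD.
  have iE : shift_invariant E.
    split => //; apply/funext => w.
    transitivity ((D (walk_shift w) /\ ~ D' (walk_shift w)) \/
      (D' (walk_shift w) /\ ~ D (walk_shift w))) => //.
    by rewrite (shift_invariantE w iD) (shift_invariantE w iD').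
  have E10 : hit_prob P E 1%g = 0.
    rewrite /hit_prob (_ : (fun w => _) = \1_E) ?Exp_indic ?DC0//.
    by apply/funext => w; congr (\1_E _); apply/funext => n; rewrite /path_act mul1g.
  have Ek := hit_prob_null G_countable G_infinite P_law mu_prob mu_gen iE E10 k.
  have Eindic w : `|\1_D w - \1_D' w| = \1_E w :> R.
    rewrite !indicE /E in_setU !in_setD.
    by case: (w \in D); case: (w \in D'); rewrite /= ?subrr ?subr0 ?sub0r ?normrN ?normr1 ?normr0.
  have bI A : measurable A -> bdd_meas (\1_A : Omega G -> R) by exact: bdd_meas_indic.
  have -> : \int[P]_w \1_D (path_act k w : Omega G) = hit_prob P D' k.
    apply/eqP; rewrite -subr_eq0 -normr_le0 -Ek /hit_prob -ExpB; [|exact: bdd_meas_hit..].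
    rewrite (le_trans (normr_Exp _ _))//; first by apply: bdd_measB; exact: bdd_meas_hit.
    by under eq_Rintegral do rewrite Eindic.
  have -> : \int[P]_w (\1_D w * r (p w)) = \int[P]_w (\1_D' w * r (p w)).
    apply: ae_eq_Rintegral.
    + by apply: measurable_funM; [exact: (bI _ mD).1|exact: measurableT_comp].
    + by apply: measurable_funM; [exact: (bI _ mD').1|exact: measurableT_comp].
    + apply: (@negligibleS _ _ _ _ E); last by apply/negligibleP.
      move=> w /= Nw; apply: contrapT => nE; apply: Nw.
      congr (_ * _); apply/eqP; rewrite -subr_eq0 -normr_eq0 Eindic indicE memNset//.
  rewrite boundary_hit// rk//; apply/eqP; rewrite subr_eq0; apply/eqP; congr fine.
  rewrite [LHS]integral_mkcond.
  rewrite (_ : (fun b => (r b)%:E) \_ C = (fun b => (\1_C b * r b)%:E)); last first.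
    apply/funext => b; rewrite patchE indicE; case: (b \in C); by rewrite ?mul1r ?mul0r.
  rewrite (Rintegral_pushforward_eq (f := fun b => \1_C b * r b) mp p_law)//.
  + by apply: measurable_funM => //; exact: measurable_indic.
  + by move=> b; rewrite mulr_ge0.
Qed.

(** With [phi] representing [h], the left side is the integral of [phi * (r - c)]. Since
    [|phi| <= 1] and [phi] vanishes unless the path ends in [C], only the part of [|r - c|] over [C]
    is paid. *)
Lemma harmonic_boundary_bound h k C c r : harmonic P h ->
  (forall g, `|h g| <= fine (beta (a0 g @^-1` C))) -> measurable C ->
  measurable_fun setT r -> (forall b, 0 <= r b) ->
  (forall C, measurable C -> (beta (a0 k @^-1` C) = \int[beta]_(b in C) (r b)%:E)%E) ->
  `|h k - c * h 1%g| <= \int[beta]_b (\1_C b * `|r b - c|).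
Proof.
move=> hh hC mC mr r0 rk.
have mp := measurable_boundary_map.
have [irp E1] := density_path mr r0 rk.
have iD := p_inv mC; set D := p @^-1` C in iD; have mD := iD.1.
have hD g : `|h g| <= hit_prob P D g by rewrite boundary_hit.
have h1 g : `|h g| <= 1 by rewrite (le_trans (hD g))// (le_trans (ler_norm _))// hit_prob_norm.
have [phi [mphi phi1 phi_shift H]] :=
  boundary_representation G_countable G_infinite P_law 1%g k hh h1.
have bphi : bdd_meas phi by split => //; exists 1.
have [Hk _] := H k (or_intror erefl); have [H1 /(_ D iD hD) N1] := H 1%g (or_introl erefl).
have act1 w : path_act 1%g w = w by apply/funext => n; rewrite /path_act mul1g.
have {}H1 : h 1%g = \int[P]_w phi w.
  by rewrite H1; apply: eq_Rintegral => w _; rewrite act1.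
have {}N1 : \int[P]_w (\1_(~` D) w * `|phi w|) = 0.
  by rewrite -[RHS]N1; apply: eq_Rintegral => w _; rewrite act1.
rewrite Hk (boundary_change_start mr r0 rk)// H1 -ExpZ// -RintegralB//; last 2 first.
- exact: bdd_measM_int.
- by apply: bdd_meas_int; exact: bdd_measZ.
have ibr : P.-integrable setT (EFin \o (fun w => r (p w) - c)).
  rewrite (_ : EFin \o _ = ((EFin \o (r \o p)) \- (EFin \o (fun=> c)))%E)//.
  by apply: integrableB => //; apply: bdd_meas_int; exact: bdd_meas_cst.
have ibra : P.-integrable setT (EFin \o (fun w => `|r (p w) - c|)).
  by rewrite (_ : EFin \o _ = abse \o (EFin \o (fun w => r (p w) - c)))//; exact: integrable_abse.
have -> : \int[P]_w (phi w * r (p w) - c * phi w) = \int[P]_w (phi w * (r (p w) - c)).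
  by apply: eq_Rintegral => w _; ring.
rewrite (le_trans (le_normr_Rintegral _ _))//; first exact: bdd_measM_int.
have bD : bdd_meas (\1_D : Omega G -> R) by exact: bdd_meas_indic.
have ae0 : {ae P, forall w, \1_(~` D) w * `|phi w| = 0}.
  have bb : bdd_meas (fun w => \1_(~` D) w * `|phi w|).
    by apply: bdd_measM; [apply: bdd_meas_indic; exact: measurableC|exact: bdd_meas_norm].
  by apply: (Exp_eq0_ae bb N1) => w; apply: mulr_ge0 => //; rewrite indicE.
have mprod : measurable_fun setT (fun w => phi w * (r (p w) - c)).
  by have := measurable_int _ (bdd_measM_int bphi ibr) => /measurable_EFinP.
have bDphi : bdd_meas (fun w => \1_D w * `|phi w|).
  by apply: bdd_measM => //; exact: bdd_meas_norm.
have mDprod := measurable_int _ (bdd_measM_int bDphi ibra).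
rewrite (@ae_eq_Rintegral _ _ _ P _ (fun w => \1_D w * `|phi w| * `|r (p w) - c|)); last 3 first.
- exact: measurableT_comp.
- exact/measurable_EFinP.
- apply: filterS ae0 => w; rewrite !indicE in_setC normrM.
  by case: (w \in D) => /=; rewrite ?mul1r// mul0r => ->; rewrite mul0r.
have ibD := bdd_measM_int bD ibra.
apply: (@le_trans _ _ (\int[P]_w (\1_D w * `|r (p w) - c|))).
  apply: le_Rintegral => //; first exact: bdd_measM_int.
  by move=> w _; rewrite ler_wpM2r// ler_piMr.
rewrite le_eqVlt; apply/orP; left; apply/eqP; congr fine; apply/esym.
rewrite (Rintegral_pushforward_eq (f := fun b => \1_C b * `|r b - c|) mp p_law)//.
apply: measurable_funM; first exact: measurable_indic.
by apply: measurableT_comp => //; exact: measurable_funB.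
Qed.

End Boundary.

(** * Cesaro averages of the Markov operator *)

Section MarkovAverages.
Context (R : realType) (G : groupType) (G_countable : countable [set: G])
  (G_infinite : infinite_set [set: G]) (mu : G -> R)
  (P : probability (Omega G) R) (P_law : rw_law mu P).
Implicit Types (M c e : R) (w : Omega G) (x y g k : G) (u v h : G -> R).

Let bop u M x : (forall g, `|u g| <= M) -> bdd_meas (fun w : Omega G => u (x * w 0%N)%g).
Proof. exact: bdd_meas_coord. Qed.

Lemma markov_op_norm u M x : (forall g, `|u g| <= M) -> `|markov_op P u x| <= M.
Proof. by move=> uM; apply: normr_Exp_le => //; exact: bop uM. Qed.

Lemma markov_op_le u v M x : (forall g, `|u g| <= M) -> (forall g, `|v g| <= M) ->
  (forall g, u g <= v g) -> markov_op P u x <= markov_op P v x.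
Proof. by move=> uM vM uv; apply: le_Exp => //; [exact: bop uM|exact: bop vM]. Qed.

Lemma markov_op_le_norm u v M x : (forall g, `|u g| <= v g <= M) ->
  `|markov_op P u x| <= markov_op P v x.
Proof.
move=> uv; have uM g : `|u g| <= M by have /andP[? ?] := uv g; exact: le_trans (_ : _ <= v g) _.
have vM g : `|v g| <= M by have /andP[uvg ?] := uv g; rewrite ger0_norm// (le_trans _ uvg).
rewrite (le_trans (normr_Exp _ (bop x uM)))//.
apply: le_Exp => [||w]; [exact/bdd_meas_norm/(bop x uM)|exact: bop vM|].
by have /andP[] := uv (x * w 0%N)%g.
Qed.

Lemma markov_opZ u M c x : (forall g, `|u g| <= M) ->
  markov_op P (fun g => c * u g) x = c * markov_op P u x.
Proof. by move=> uM; apply: ExpZ; exact: bop uM. Qed.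

Lemma markov_op_sum I (s : seq I) (F : I -> G -> R) M x :
  (forall i g, `|F i g| <= M) ->
  markov_op P (fun g => \sum_(i <- s) F i g) x = \sum_(i <- s) markov_op P (F i) x.
Proof. by move=> FM; apply: Exp_sum => i; exact: bop (FM i). Qed.

Lemma markov_op_translate u y x :
  markov_op P (fun g => u (y * g)%g) x = markov_op P u (y * x)%g.
Proof. by apply: eq_Rintegral => w _; rewrite mulgA. Qed.

(** Dominated convergence along an arbitrary filter, as ultralimits require. All but a small part of
    the first step lies in a finite set, where convergence is a finite sum of limits. *)
Lemma markov_op_cvg (F : set_system nat) (FF : Filter F) (v : nat -> G -> R) h M :
  (forall j g, `|v j g| <= M) -> (forall g, `|h g| <= M) ->
  (forall g, (fun j => v j g) @ F --> h g) ->
  forall x, (fun j => markov_op P (v j) x) @ F --> markov_op P h x.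
Proof.
move=> vM hM vh x; have [en [rk [enK rkK]]] := countable_infinite_bij G_countable G_infinite.
have M0 : 0 <= M by exact: le_trans (hM 1%g).
pose S n w : R := \sum_(i < n) \1_[set w' : Omega G | w' 0%N = en i] w.
have bI i : bdd_meas (\1_[set w' : Omega G | w' 0%N = en i] : Omega G -> R).
  by apply: bdd_meas_indic; exact: measurable_coord.
have bS n : bdd_meas (S n) by apply: bdd_meas_sum => i; exact: bI.
have SE n w : S n w = \sum_(i < n) \1_[set w' : Omega G | w' 0%N = en i] w * 1.
  by apply: eq_bigr => i _; rewrite mulr1.
have S1 n w : `|S n w| <= 1.
  by rewrite SE; apply: (@walk_start_bounded _ _ en rk (fun=> 1)) => // g; rewrite normr1.
have cS : (fun n => \int[P]_w S n w) @ \oo --> (1 : R).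
  rewrite -[X in _ --> X](Exp_cst P); apply: (@Exp_cvg _ _ _ P S _ 1) => // [n|].
    exact: (bS n).1.
  apply: aeW => w; under eq_fun do rewrite SE.
  exact: (@walk_start_cvg _ _ en rk (fun=> 1)).
apply/cvgrPdist_le => e e0.
have e1 : 0 < e / 2 / (2 * M + 1) by rewrite !divr_gt0//; lra.
move/cvgrPdist_le : cS => /(_ _ e1)[n _ /(_ n (leqnn n))]; rewrite ler_norml => /andP[_ Hn].
have c2 : (fun j => \sum_(i < n) mu (en i) * (h (x * en i)%g - v j (x * en i)%g)) @ F -->
    \sum_(i < n) mu (en i) * (h (x * en i)%g - h (x * en i)%g).
  apply: cvg_sumr => i.
  by apply: cvgMr; apply: cvgB; [exact: cvg_cst|exact: vh].
have z0 : \sum_(i < n) mu (en i) * (h (x * en i)%g - h (x * en i)%g) = 0.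
  by rewrite big1// => i _; rewrite subrr mulr0.
rewrite z0 in c2.
move/cvgrPdist_le : c2 => /(_ _ (divr_gt0 e0 (ltr0n _ 2))); apply: filterS => j.
rewrite sub0r normrN => Hj.
set f := fun w : Omega G => h (x * w 0%N)%g - v j (x * w 0%N)%g.
have bf : bdd_meas f by apply: bdd_measB; [exact: bop hM|exact: bop (vM j)].
have fM w : `|f w| <= 2 * M.
  by rewrite (le_trans (ler_normB _ _))// (_ : 2 * M = M + M) ?lerD//; ring.
rewrite /markov_op -ExpB; [|exact: bop hM|exact: bop (vM j)].
have -> : \int[P]_w f w = \sum_(i < n) mu (en i) * (h (x * en i)%g - v j (x * en i)%g) +
    \int[P]_w ((1 - S n w) * f w).
  have -> : \sum_(i < n) mu (en i) * (h (x * en i)%g - v j (x * en i)%g) = \int[P]_w (S n w * f w).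
    rewrite [RHS](_ : _ = \int[P]_w \sum_(i < n) (h (x * en i)%g - v j (x * en i)%g) * \1_[set w' : Omega G | w' 0%N = en i] w).
      rewrite Exp_sum; last by move=> i; exact: bdd_measZ.
      apply: eq_bigr => i _; rewrite ExpZ// Exp_indic; last exact: measurable_coord.
      by rewrite (walk_start P_law) mulrC.
    apply: eq_Rintegral => w _; rewrite mulr_suml; apply: eq_bigr => i _.
    by rewrite indicE; have [|_] := boolP (w \in _); rewrite ?mul0r ?mulr0// inE/= /f => ->; rewrite mulrC.
  rewrite -ExpD; [|exact: bdd_measM|]; last first.
    by apply: bdd_measM => //; apply: bdd_measB => //; exact: bdd_meas_cst.
  by apply: eq_Rintegral => w _; ring.
rewrite (le_trans (ler_normD _ _))// [leRHS](splitr e) lerD//.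
have b1S : bdd_meas (fun w => 1 - S n w) by apply: bdd_measB => //; exact: bdd_meas_cst.
rewrite (le_trans (normr_Exp _ _))//; first exact: bdd_measM.
apply: (@le_trans _ _ (\int[P]_w ((2 * M + 1) * (1 - S n w)))).
  apply: le_Exp => [||w]; [exact/bdd_meas_norm/bdd_measM|exact: bdd_measZ|].
  have S0 : 0 <= 1 - S n w by have := S1 n w; rewrite ler_norml => /andP[]; lra.
  by rewrite normrM ger0_norm// mulrC ler_wpM2r// (le_trans (fM w))// lerDl.
rewrite ExpZ// ExpB//; last exact: bdd_meas_cst.
by rewrite Exp_cst -ler_pdivlMl ?(mulrC _^-1)//; lra.
Qed.

Definition markov_avg N u x : R := N.+1%:R^-1 * \sum_(n < N.+1) iter n (markov_op P) u x.

Lemma markov_iter_norm u M n : (forall g, `|u g| <= M) ->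
  forall x, `|iter n (markov_op P) u x| <= M.
Proof. by move=> uM; elim: n => [|n IH] x //=; exact: markov_op_norm. Qed.

Lemma markov_iter_le u h M n : harmonic P h -> (forall g, `|u g| <= h g <= M) ->
  forall x, `|iter n (markov_op P) u x| <= h x.
Proof.
move=> hh uh; elim: n => [|n IH] x /=; first by have /andP[] := uh x.
rewrite -hh; apply: (@markov_op_le_norm _ _ M) => g.
by rewrite IH; have /andP[] := uh g.
Qed.

Lemma markov_avg_le N u h M : harmonic P h -> (forall g, `|u g| <= h g <= M) ->
  forall x, `|markov_avg N u x| <= h x.
Proof.
move=> hh uh x; exact: (normr_avg N (fun n => markov_iter_le n hh uh x)).
Qed.

Lemma markov_avg_harmonic N h x : harmonic P h -> markov_avg N h x = h x.
Proof.
move=> hh; rewrite /markov_avg (eq_bigr (fun=> h x)) => [|n _].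
  by rewrite sumr_const card_ord -[h x *+ _]mulr_natl mulKf// pnatr_eq0.
by elim: (nat_of_ord n) x => //= m IH x; rewrite -[RHS]hh; congr markov_op; apply/funext.
Qed.

(** Telescoping leaves only the first and the last iterate, so long averages are nearly harmonic,
    uniformly in [u] and [x]. *)
Lemma markov_avg_op N u M x : (forall g, `|u g| <= M) ->
  `|markov_op P (markov_avg N u) x - markov_avg N u x| <= 2 * M / N.+1%:R.
Proof.
move=> uM; rewrite /markov_avg.
have -> : markov_op P (fun y => N.+1%:R^-1 * \sum_(n < N.+1) iter n (markov_op P) u y) x =
  N.+1%:R^-1 * \sum_(n < N.+1) iter n.+1 (markov_op P) u x.
  rewrite (@markov_opZ _ (\sum_(n < N.+1) M)); last first.
    by move=> g; rewrite (le_trans (ler_norm_sum _ _ _))//; apply: ler_sum => n _; exact: markov_iter_norm.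
  by rewrite (@markov_op_sum _ _ _ M)// => n g; exact: markov_iter_norm.
rewrite -mulrBr.
have -> : \sum_(n < N.+1) iter n.+1 (markov_op P) u x =
    \sum_(n < N) iter n.+1 (markov_op P) u x + iter N.+1 (markov_op P) u x.
  by rewrite big_ord_recr.
have -> : \sum_(n < N.+1) iter n (markov_op P) u x =
    u x + \sum_(n < N) iter n.+1 (markov_op P) u x by rewrite big_ord_recl.
set S := \sum_(n < N) _; rewrite (_ : S + _ - _ = iter N.+1 (markov_op P) u x - u x); last by ring.
rewrite normrM ger0_norm ?invr_ge0// mulrC ler_wpM2r ?invr_ge0//.
rewrite (le_trans (ler_normB _ _))// (_ : 2 * M = M + M); last by ring.
by rewrite lerD//; exact: markov_iter_norm.
Qed.

End MarkovAverages.

(** * Asymptotically equivariant counts on the boundary *)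

Section Theta.
Context (R : realType) (G : groupType) (G_countable : countable [set: G])
  (G_infinite : infinite_set [set: G]) (mu : G -> R)
  (P : probability (Omega G) R) (P_law : rw_law mu P).
Implicit Types (M c e : R) (w : Omega G) (x y g k : G) (u v h : G -> R) (K : seq G).

Lemma markov_iter_sum (s : seq G) (c : G -> R) (F : G -> G -> R) n x :
  (forall i g, `|F i g| <= 1) ->
  iter n (markov_op P) (fun g => \sum_(i <- s) c i * F i g) x =
  \sum_(i <- s) c i * iter n (markov_op P) (F i) x.
Proof.
move=> F1; elim: n x => [//|n IH] x /=.
rewrite [in LHS](_ : iter n _ _ = fun y => \sum_(i <- s) c i * iter n (markov_op P) (F i) y); last exact/funext.
rewrite /markov_op Exp_sum.
  by apply: eq_bigr => i _; rewrite ExpZ//; apply: (@bdd_meas_coord _ _ G_countable _ 1) => g; exact: markov_iter_norm.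
by move=> i; apply: bdd_measZ; apply: (@bdd_meas_coord _ _ G_countable _ 1) => g; exact: markov_iter_norm.
Qed.

Lemma markov_avg_sum N (s : seq G) (c : G -> R) (F : G -> G -> R) x :
  (forall i g, `|F i g| <= 1) ->
  markov_avg P N (fun g => \sum_(i <- s) c i * F i g) x =
  \sum_(i <- s) c i * markov_avg P N (F i) x.
Proof.
move=> F1; rewrite /markov_avg.
under eq_bigr do rewrite markov_iter_sum//.
rewrite exchange_big mulr_sumr; apply: eq_bigr => i _ /=.
by rewrite -mulr_sumr mulrCA.
Qed.

Lemma markov_avg_translate N u y x :
  markov_avg P N (fun g => u (y * g)%g) x = markov_avg P N u (y * x)%g.
Proof.
rewrite /markov_avg; congr (_ * _); apply: eq_bigr => n _.
elim: (nat_of_ord n) x => //= m IH x; rewrite -markov_op_translate.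
by congr markov_op; apply/funext.
Qed.

Definition delta g x : R := (x == g)%:R.

Definition theta N g : R := markov_avg P N (delta g) 1%g.

Lemma delta_norm g x : `|delta g x| <= 1.
Proof. by rewrite /delta; case: eqP; rewrite ?normr1 ?normr0. Qed.

Lemma markov_avg_delta N g x : markov_avg P N (delta g) x = theta N (x^-1 * g)%g.
Proof.
rewrite /theta -[in LHS](mulg1 x) -markov_avg_translate; congr markov_avg.
apply/funext => y; rewrite /delta; congr (nat_of_bool _)%:R.
by apply/eqP/eqP => [<-|->]; rewrite ?mulKg ?mulVKg.
Qed.

Lemma sum_delta K (c : G -> R) x : uniq K ->
  \sum_(g <- K) c g * delta g x = if x \in K then c x else 0.
Proof.
move=> uK; case: ifPn => xK.
  rewrite (bigD1_seq x)//= /delta eqxx mulr1 big1 ?addr0// => g gx.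
  by rewrite eq_sym (negbTE gx) mulr0.
rewrite big_seq big1// => g gK; rewrite /delta; case: eqP => [xg|_]; rewrite ?mulr0//.
by rewrite xg gK in xK.
Qed.

Lemma markov_avg_finite N K (c : G -> R) x :
  markov_avg P N (fun y => \sum_(g <- K) c g * delta g y) x =
  \sum_(g <- K) c g * theta N (x^-1 * g)%g.
Proof.
rewrite markov_avg_sum; last by move=> i g; exact: delta_norm.
by apply: eq_bigr => g _; rewrite markov_avg_delta.
Qed.

Lemma markov_avg_mono N u v M x : (forall g, `|u g| <= M) -> (forall g, `|v g| <= M) ->
  (forall g, u g <= v g) -> markov_avg P N u x <= markov_avg P N v x.
Proof.
move=> uM vM uv; rewrite /markov_avg ler_wpM2l ?invr_ge0//; apply: ler_sum => n _.
elim: (nat_of_ord n) x => //= m IH x.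
by apply: (@markov_op_le _ _ G_countable _ _ _ M) => // g; exact: markov_iter_norm.
Qed.

Lemma theta_ge0 N g : 0 <= theta N g.
Proof.
rewrite /theta /markov_avg mulr_ge0 ?invr_ge0//; apply: sumr_ge0 => n _.
elim: (nat_of_ord n) (1%g : G) => [|m IH] x /=; first by rewrite /delta.
by apply: Exp_ge0 => w; exact: IH.
Qed.

Lemma theta_le N K h M : uniq K -> harmonic P h -> (forall g, 0 <= h g <= M) ->
  \sum_(g <- K) theta N g * h g <= h 1%g.
Proof.
move=> uK hh hM.
have h0 g : 0 <= h g by have /andP[] := hM g.
have M0 : 0 <= M by have /andP[/le_trans h1 /h1] := hM 1%g.
rewrite -[leRHS](markov_avg_harmonic N _ hh).
rewrite (_ : \sum_(g <- K) _ = markov_avg P N (fun y => \sum_(g <- K) h g * delta g y) 1%g).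
  apply: (@markov_avg_mono _ _ _ M) => g; rewrite ?sum_delta//; have /andP[? ?] := hM g.
  - by case: ifP => _; rewrite ?normr0// ger0_norm.
  - by rewrite ger0_norm.
  - by case: ifP.
by rewrite markov_avg_finite; apply: eq_bigr => g _; rewrite mulrC invg1 mul1g.
Qed.

Lemma harmonic_cst c : harmonic P (fun=> c).
Proof. by move=> x; rewrite /markov_op Exp_cst. Qed.

Lemma theta_sum_le1 N K : uniq K -> \sum_(g <- K) theta N g <= 1.
Proof.
move=> uK; have := @theta_le N K (fun=> 1) 1 uK (harmonic_cst 1).
under eq_bigr do rewrite mulr1.
by apply => g; rewrite ler01 lexx.
Qed.

(** Apply [theta_le] to the nonnegative harmonic functions [1 - v] and [1 + v]: the error is then
    the mass missing from [K]. *)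
Lemma theta_harmonic N K v : uniq K -> harmonic P v -> (forall g, `|v g| <= 1) ->
  `|\sum_(g <- K) theta N g * v g - v 1%g| <= 1 - \sum_(g <- K) theta N g.
Proof.
move=> uK hv v1.
have sgn s : s = 1 \/ s = -1 -> s * (v 1%g - \sum_(g <- K) theta N g * v g) <= 1 - \sum_(g <- K) theta N g.
  move=> s1; have ns : `|s| = 1 by case: s1 => ->; rewrite ?normrN normr1.
  have hs : harmonic P (fun g => 1 - s * v g).
    move=> x; have bv := bdd_meas_coord G_countable x 0 v1.
    rewrite /markov_op ExpB; [|exact: bdd_meas_cst|exact: bdd_measZ].
    by rewrite Exp_cst ExpZ// -/(markov_op P v x) hv.
  have sv g : -1 <= s * v g <= 1 by rewrite -ler_norml normrM ns mul1r.
  have E : \sum_(g <- K) theta N g * (1 - s * v g) =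
      \sum_(g <- K) theta N g - s * (\sum_(g <- K) theta N g * v g).
    by rewrite mulr_sumr -sumrB; apply: eq_bigr => g _; ring.
  have : \sum_(g <- K) theta N g * (1 - s * v g) <= 1 - s * v 1%g.
    by apply: (@theta_le N K (fun g => 1 - s * v g) 2) => // g; have := sv g; lra.
  rewrite E.
  by rewrite mulrBr; lra.
have s1 := sgn 1 (or_introl erefl); have s2 := sgn (-1) (or_intror erefl).
by rewrite ler_norml; apply/andP; split; lra.
Qed.

(** The indicators of the first [n] elements tend to 1, hence so do their averages, by
    [markov_op_cvg]; larger sets [K] follow by monotonicity. *)
Lemma theta_mass N e : 0 < e -> exists K0, forall K, uniq K -> {subset K0 <= K} ->
  1 - e <= \sum_(g <- K) theta N g.
Proof.
move=> e0; have [en [rk [enK rkK]]] := countable_infinite_bij G_countable G_infinite.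
pose f n (g : G) : R := (rk g < n)%N%:R.
have f1 n g : `|f n g| <= 1 by rewrite /f; case: (_ < _)%N; rewrite ?normr1 ?normr0.
have n1 (g : G) : `|(fun=> 1 : R) g| <= 1 by rewrite normr1.
have cf m : forall x, (fun n => iter m (markov_op P) (f n) x) @ \oo --> (1 : R).
  elim: m => [|m IH] x /=.
    by apply: cvg_near_cst; exists (rk x).+1 => // n /= ?; rewrite /f; have -> : (rk x < n)%N by [].
  rewrite -[X in _ --> X](harmonic_cst 1 x).
  apply: (@markov_op_cvg _ _ G_countable G_infinite _ _ P_law _ _ (fun n => iter m (markov_op P) (f n)) _ 1) => // j g.
  by apply: markov_iter_norm.
have cA : (fun n => markov_avg P N (f n) 1%g) @ \oo --> (1 : R).
  rewrite -[X in _ --> X](markov_avg_harmonic N 1%g (harmonic_cst 1)).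
  apply: cvgMr; apply: cvg_sumr => i.
  rewrite [X in _ --> X](_ : _ = 1); first exact: cf.
  by elim: (nat_of_ord i) (1%g : G) => //= m IH x; rewrite -[RHS](harmonic_cst 1 x); congr markov_op; apply/funext.
move/cvgrPdist_le : cA => /(_ _ e0)[n _ /(_ n (leqnn n))]; rewrite ler_norml => /andP[_ Hn].
exists (map en (iota 0 n)) => K uK K0K.
rewrite (_ : \sum_(g <- K) _ = markov_avg P N (fun y => \sum_(g <- K) 1 * delta g y) 1%g); last first.
  by rewrite markov_avg_finite; apply: eq_bigr => g _; rewrite mul1r invg1 mul1g.
apply: (@le_trans _ _ (markov_avg P N (f n) 1%g)); first by rewrite lerBlDr -lerBlDl.
apply: (@markov_avg_mono _ _ _ 1) => // g; rewrite ?sum_delta//; case: ifPn => // gK; rewrite ?normr1 ?normr0//.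
  by rewrite /f lern1; case: (_ < _)%N.
rewrite /f; case: ltnP => // gn; case/negP: gK; apply: K0K.
by apply/mapP; exists (rk g); rewrite ?mem_iota ?rkK.
Qed.

End Theta.

Lemma ultra_segment_cvg (R : realType) (U : set_system nat) (v : nat -> R) M :
  UltraFilter U -> (forall j, `|v j| <= M) -> exists l, `|l| <= M /\ v @ U --> l.
Proof.
move=> UU vM.
have cM : compact (`[- M, M] : set R) by exact: segment_compact.
have UP : ProperFilter U by exact: ultra_proper.
have [|l [lM cl]] := cM (v @ U) (fmap_proper_filter _ _).
  apply: (@filterS _ U _ setT); last exact: filterT.
  by move=> j _; rewrite /= in_itv/= -ler_norml.
exists l; split; first by move: lM; rewrite /= in_itv/= -ler_norml.
move=> A nA; have [//|nUA] := in_ultra_setVsetC (v @^-1` A) UU.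
by have [y [/= nAy Ay]] := cl (~` A) A nUA nA.
Qed.

(** * Averages dominated by a boundary set *)

Section BoundaryAverages.
Context (R : realType) (G : groupType) (G_countable : countable [set: G])
  (G_infinite : infinite_set [set: G]) (mu : G -> R)
  (mu_prob : prob_on_group mu) (mu_gen : supp_generates_semigroup mu)
  (P : probability (Omega G) R) (P_law : rw_law mu P).
Context d0 (B0 : measurableType d0) (a0 : G -> B0 -> B0) (beta : probability B0 R)
  (a0_meas : measurable_action a0) (p : Omega G -> B0)
  (p_inv : forall C, measurable C -> shift_invariant (p @^-1` C))
  (p_full : forall A, shift_invariant A -> exists C : set B0, measurable C /\
        P ((A `\` p @^-1` C) `|` (p @^-1` C `\` A)) = 0%E)
  (p_law : forall C, measurable C -> beta C = P (p @^-1` C))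
  (p_act : forall g, P.-negligible [set w | p (path_act g w) <> a0 g (p w)]).
Implicit Types (c e : R) (w : Omega G) (x g k : G) (C : set B0) (r : B0 -> R) (u h : G -> R).

(* If the bound failed for arbitrarily long averages, an ultralimit of the
   offending averages would be a harmonic function violating
   [harmonic_boundary_bound]. *)
Lemma markov_avg_boundary k C c r e : measurable C ->
  measurable_fun setT r -> (forall b, 0 <= r b) ->
  (forall C, measurable C -> (beta (a0 k @^-1` C) = \int[beta]_(b in C) (r b)%:E)%E) ->
  0 < e ->
  exists N0, forall N, (N0 <= N)%N -> forall u,
    (forall g, `|u g| <= fine (beta (a0 g @^-1` C))) ->
    `|markov_avg P N u k - c * markov_avg P N u 1%g| <=
      \int[beta]_b (\1_C b * `|r b - c|) + e.
Proof.
move=> mC mr r0 rk e0; apply: contrapT => /forallNP noN.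
have {}noN j : exists Nu : nat * (G -> R), [/\ (j <= Nu.1)%N,
    forall g, `|Nu.2 g| <= fine (beta (a0 g @^-1` C)) &
    \int[beta]_b (\1_C b * `|r b - c|) + e <
    `|markov_avg P Nu.1 Nu.2 k - c * markov_avg P Nu.1 Nu.2 1%g|].
  have /existsNP[N /not_implyP[jN /existsNP[u /not_implyP[uC /negP]]]] := noN j.
  by rewrite -ltNge => H; exists (N, u).
have [Nu HNu] := choice noN.
pose D := p @^-1` C; have iD : shift_invariant D by exact: p_inv.
have CE g := esym (boundary_hit G_countable a0_meas p_inv p_law p_act g mC).
have hD := hit_prob_harmonic G_countable G_infinite P_law iD.
have D1 g : hit_prob P D g <= 1 by rewrite (le_trans (ler_norm _))// hit_prob_norm//; exact: iD.1.
have uD j g : `|(Nu j).2 g| <= hit_prob P D g <= 1.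
  by rewrite D1 andbT -CE; have [_ ->] := HNu j.
have u1 j g : `|(Nu j).2 g| <= 1 by have /andP[+ ?] := uD j g => /le_trans; apply.
pose v j x := markov_avg P (Nu j).1 (Nu j).2 x.
have vD j x : `|v j x| <= hit_prob P D x.
  exact: (markov_avg_le G_countable (Nu j).1 hD (uD j)).
have v1 j x : `|v j x| <= 1 by exact: le_trans (D1 x).
have [U [UU oU]] := ultraFilterLemma (@eventually_filter).
have UP : ProperFilter U by exact: ultra_proper.
have [h hP] := choice (fun x => ultra_segment_cvg UU (vD^~ x)).
have h1 g : `|h g| <= 1 by have [/le_trans + _] := hP g; apply.
have hh : harmonic P h.
  move=> x.
  have c1 := @markov_op_cvg _ _ G_countable G_infinite _ _ P_law U UP v h 1 v1 h1 (fun g => (hP g).2) x.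
  have c2 : (fun j => markov_op P (v j) x - v j x) @ U --> (0 : R).
    apply: (cvg_trans (G := (fun j => markov_op P (v j) x - v j x) @ \oo)).
      by move=> A; exact: oU.
    apply/cvgrPdist_le => eps eps0; near=> j.
    rewrite sub0r normrN; apply: (@le_trans _ _ (2 * 1 / (Nu j).1.+1%:R)).
      by apply: markov_avg_op.
    rewrite mulr1 ler_pdivrMr// -ler_pdivrMl//.
    apply: (@le_trans _ _ j%:R); last by have [jN _ _] := HNu j; rewrite ler_nat leqW.
    by near: j; exact: nbhs_infty_ger.
  have c3 : (fun j => markov_op P (v j) x - v j x) @ U --> markov_op P h x - h x.
    by apply: cvgB => //; exact: (hP x).2.
  by apply/eqP; rewrite -subr_eq0; apply/eqP; exact: (cvg_unique (@Rhausdorff R) c3 c2).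
have hb : forall g, `|h g| <= fine (beta (a0 g @^-1` C)) by move=> g; rewrite CE; have [] := hP g.
have := harmonic_boundary_bound G_countable G_infinite mu_prob mu_gen P_law a0_meas
  p_inv p_full p_law p_act c hh hb mC mr r0 rk.
apply/negP; rewrite -ltNge.
have ck : (fun j => `|v j k - c * v j 1%g|) @ U --> `|h k - c * h 1%g|.
  apply: cvg_norm; apply: cvgB; first exact: (hP k).2.
  by apply: cvgMr; exact: (hP 1%g).2.
rewrite (@lt_le_trans _ _ (\int[beta]_b (\1_C b * `|r b - c|) + e))// ?ltrDl//.
rewrite -(cvg_lim (@Rhausdorff R) ck); apply: limr_ge.
  by apply/cvg_ex; eexists; exact: ck.
by apply: nearW => j; have [_ _ /ltW] := HNu j.
Unshelve. all: by end_near. Qed.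

End BoundaryAverages.

(** * The Radon-Nikodym cocycle *)

Section Densities.
Context (R : realType) (G : groupType) d0 (B0 : measurableType d0)
  (a0 : G -> B0 -> B0) (beta : probability B0 R) (a0_meas : measurable_action a0).
Implicit Types (g k : G) (r f : B0 -> R).

(** The density with respect to [beta] of the image of [beta] under [g], stated for nonnegative
    functions rather than sets because it serves for changes of variables. *)
Definition is_density g r := [/\ measurable_fun setT r, forall b, 0 <= r b &
  forall f, measurable_fun setT f -> (forall b, 0 <= f b) ->
    (\int[beta]_b (f (a0 g b))%:E = \int[beta]_b (f b * r b)%:E)%E].

Lemma density_exists g :
  (forall C, measurable C -> beta C = 0%E -> beta (a0 g @^-1` C) = 0%E) ->
  exists r, is_density g r.
Proof.
move=> qinv.
pose ag : {mfun B0 >-> B0} := HB.pack (a0 g) (isMeasurableFun.Build _ _ _ _ _ (a0_meas.2 g)).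
pose nu := distribution beta ag.
have dom : nu `<< beta by apply/null_content_dominatesP => C mC; exact: qinv.
pose F := Radon_Nikodym_SigmaFinite.f nu beta.
have F0 := Radon_Nikodym_SigmaFinite.f_ge0 dom.
have Ffin := Radon_Nikodym_SigmaFinite.f_fin_num dom.
have mF := measurable_int _ (Radon_Nikodym_SigmaFinite.f_integrable dom).
exists (fun b => fine (F b)); split.
- exact: measurableT_comp.
- by move=> b; exact/fine_ge0/F0.
move=> f mf f0.
have mfE : measurable_fun setT (EFin \o f) by exact/measurable_EFinP.
have f0E b : (0 <= (EFin \o f) b)%E by rewrite lee_fin.
have := @ge0_integral_distribution _ _ _ _ _ beta ag _ mfE f0E.
rewrite -(Radon_Nikodym_SigmaFinite.change_of_variables dom f0E measurableT mfE) => <-.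
by apply: eq_integral => b _; rewrite EFinM fineK.
Qed.

Lemma density_set g r C : is_density g r -> measurable C ->
  (beta (a0 g @^-1` C) = \int[beta]_(b in C) (r b)%:E)%E.
Proof.
move=> [mr r0 H] mC.
have mgC : measurable (a0 g @^-1` C) by rewrite -[_ @^-1` _]setTI; exact: a0_meas.2.
rewrite integral_mkcond -[a0 g @^-1` C]setIT -integral_indic//.
have mI : measurable_fun setT (\1_C : B0 -> R) by exact: measurable_indic.
rewrite (H _ mI)//.
apply: eq_integral => b _; rewrite patchE indicE.
by case: (b \in C); rewrite ?mul1r ?mul0r.
Qed.

Lemma density_integrable g r : is_density g r -> beta.-integrable setT (EFin \o r).
Proof.
move=> Hr; have [mr r0 _] := Hr; apply/integrableP; split; first exact/measurable_EFinP.
rewrite (_ : integral _ _ _ = 1%E) ?ltry//.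
have := density_set Hr measurableT; rewrite preimage_setT probability_setT => ->.
by apply: eq_integral => b _; rewrite /= ger0_norm.
Qed.

Lemma density_unique r1 r2 : beta.-integrable setT (EFin \o r1) ->
  measurable_fun setT r2 ->
  (forall C, measurable C -> (\int[beta]_(b in C) (r1 b)%:E = \int[beta]_(b in C) (r2 b)%:E)%E) ->
  {ae beta, forall b, r1 b = r2 b}.
Proof.
move=> i1 m2 H.
have : ae_eq beta setT (EFin \o r1) (EFin \o r2).
  by apply: integral_ae_eq => // [|E _ mE]; [exact/measurable_EFinP|exact: H].
by apply: filterS => b /(_ I) [].
Qed.

Lemma density_cocycle g k rg rk rkg : is_density g rg -> is_density k rk ->
  is_density (k * g)%g rkg ->
  {ae beta, forall b, rkg b = rg (a0 k^-1%g b) * rk b}.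
Proof.
move=> [mg g0 Hg] [mk k0 Hk] Hkg; have [mkg kg0 _] := Hkg.
have mgk : measurable_fun setT (fun b => rg (a0 k^-1%g b)).
  by apply: measurableT_comp => //; exact: a0_meas.2.
apply: density_unique => [||C mC].
- exact: density_integrable Hkg.
- exact: measurable_funM.
rewrite -(density_set Hkg mC) integral_mkcond.
have mIC : measurable_fun setT (\1_C : B0 -> R) by exact: measurable_indic.
transitivity (\int[beta]_b ((\1_C b * rg (a0 k^-1%g b)) * rk b)%:E)%E; last first.
  apply: eq_integral => b _; rewrite patchE indicE.
  by case: (b \in C); rewrite ?mul1r ?mul0r.
rewrite -(Hk (fun b => \1_C b * rg (a0 k^-1%g b))); [|exact: measurable_funM|]; last first.
  by move=> b; rewrite mulr_ge0.
transitivity (\int[beta]_b (\1_C (a0 k b) * rg b)%:E)%E; last first.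
  by apply: eq_integral => b _; rewrite -a0_meas.1.2 mulVg a0_meas.1.1.
rewrite -(Hg (fun b => \1_C (a0 k b)))//; last first.
  by apply: measurableT_comp => //; exact: a0_meas.2.
have mkgC : measurable (a0 (k * g)%g @^-1` C) by rewrite -[_ @^-1` _]setTI; exact: a0_meas.2.
rewrite -[a0 _ @^-1` C]setIT -integral_indic//.
by apply: eq_integral => b _; rewrite !indicE /= -a0_meas.1.2; congr (nat_of_bool _)%:R%:E; apply/idP/idP; rewrite !inE.
Qed.

Lemma density1 r : is_density 1%g r -> {ae beta, forall b, r b = 1}.
Proof.
move=> Hr; apply: density_unique => [||C mC].
- exact: density_integrable Hr.
- exact: measurable_cst.
rewrite -(density_set Hr mC) integral_cst// mul1e; congr (beta _).
by apply/seteqP; split => b /=; rewrite a0_meas.1.1.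
Qed.

(** By the cocycle identities for [k * g] and [k * k^-1], the left integrand at [b] is the right one
    at [k^-1 b] times [rho k b], a factor absorbed by the change of variables. The left side
    compares counts at [b] and [k^-1 b]; the right side is what [theta_reiter] bounds. *)
Lemma density_swap (th : G -> R) (rho : G -> B0 -> R) g k :
  (forall g, is_density g (rho g)) ->
  (\int[beta]_b `|th g * rho g (a0 k^-1%g b) - th (k * g)%g * rho (k * g)%g b|%:E =
   \int[beta]_b (`|th g * rho k^-1%g b - th (k * g)%g| * rho g b)%:E)%E.
Proof.
move=> dens; have mrho h : measurable_fun setT (rho h) by have [] := dens h.
have rho0 h b : 0 <= rho h b by have [] := dens h.
have mact h (f : B0 -> R) : measurable_fun setT f -> measurable_fun setT (fun b => f (a0 h b)).
  by move=> mf; apply: measurableT_comp => //; exact: a0_meas.2.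
pose F b := `|th g * rho k^-1%g b - th (k * g)%g| * rho g b.
have F0 b : 0 <= F b by rewrite mulr_ge0.
have mF : measurable_fun setT F.
  apply: measurable_funM => //; apply: measurableT_comp => //.
  by apply: measurable_funB; [apply: measurable_funM|]; try exact: measurable_cst.
have [_ _ Hk] := dens k.
have -> : (\int[beta]_b (F b)%:E = \int[beta]_b (F (a0 k^-1%g b) * rho k b)%:E)%E.
  rewrite -(Hk (fun b => F (a0 k^-1%g b)))//; last exact: mact.
  by apply: eq_integral => b _; rewrite -a0_meas.1.2 mulVg a0_meas.1.1.
apply: ae_eq_integral => //.
- apply/measurable_EFinP; apply: measurableT_comp => //; apply: measurable_funB;
    apply: measurable_funM; by [exact: measurable_cst|exact: mact|].
- by apply/measurable_EFinP; apply: measurable_funM => //; exact: mact.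
have c1 := density_cocycle (dens g) (dens k) (dens (k * g)%g).
have d1 := dens (k * k^-1)%g; rewrite mulgV in d1.
have c2 := density_cocycle (dens k^-1%g) (dens k) (dens (k * k^-1)%g).
rewrite mulgV in c2; have c3 := density1 d1.
apply: filterS3 c1 c2 c3 => b E1 E2 E3 _; congr (_%:E).
rewrite E3 in E2; rewrite E1 /F.
set s := rho k^-1%g _ in E2 *; set q := rho g _; set t := rho k b in E2 *.
rewrite (_ : th g * q - th (k * g)%g * (q * t) = (q * t) * (th g * s - th (k * g)%g)).
  by rewrite normrM ger0_norm ?mulr_ge0 ?rho0// mulrC mulrA.
rewrite mulrBr (_ : q * t * (th g * s) = (s * t) * (th g * q)); last by ring.
by rewrite -E2; ring.
Qed.

End Densities.

Section IntegrableTools.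
Context (R : realType) d (T : measurableType d) (P : probability T R).
Implicit Types (f g : T -> R).

Lemma Rintegral_sum (I : Type) (s : seq I) (c : I -> R) (F : I -> T -> R) :
  (forall i, P.-integrable setT (EFin \o F i)) ->
  P.-integrable setT (EFin \o (fun x => \sum_(i <- s) c i * F i x)) /\
  \int[P]_x (\sum_(i <- s) c i * F i x) = \sum_(i <- s) c i * \int[P]_x F i x.
Proof.
move=> iF; elim: s => [|i s [IHi IHE]].
  have -> : (fun x => \sum_(i <- [::]) c i * F i x) = fun=> 0.
    by apply/funext => x; rewrite big_nil.
  by rewrite big_nil Exp_cst; split => //; exact: integrable0.
have icF : P.-integrable setT (EFin \o (fun x => c i * F i x)).
  exact: (integrableZl measurableT (c i) (iF i)).
have -> : (fun x => \sum_(j <- i :: s) c j * F j x) =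
    (fun x => c i * F i x + \sum_(j <- s) c j * F j x).
  by apply/funext => x; rewrite big_cons.
rewrite big_cons RintegralD// RintegralZl// IHE; split => //.
exact: (integrableD measurableT icF IHi).
Qed.

Lemma Rintegral_eq0_ae f : P.-integrable setT (EFin \o f) -> (forall x, 0 <= f x) ->
  \int[P]_x f x <= 0 -> {ae P, forall x, f x = 0}.
Proof.
move=> if_ f0 Ef; have [+ _] := ae_eq_integral_abs P measurableT (measurable_int _ if_).
have fin := integrable_fin_num measurableT if_.
have -> : (\int[P]_x `|(EFin \o f) x| = 0)%E.
  transitivity (\int[P]_x (EFin \o f) x)%E.
    by apply: eq_integral => x _; rewrite /= ger0_norm.
  rewrite -(fineK fin); congr (_%:E); apply/eqP; rewrite eq_le Ef /=.
  by apply: fine_ge0; apply: integral_ge0 => x _; rewrite lee_fin.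
by move=> /(_ erefl); apply: filterS => x /(_ I) [].
Qed.

Lemma le_integrableR f g : measurable_fun setT f -> P.-integrable setT (EFin \o g) ->
  (forall x, `|f x| <= g x) -> P.-integrable setT (EFin \o f).
Proof.
move=> mf ig fg; apply: le_integrable ig => //; first exact/measurable_EFinP.
by move=> x _ /=; rewrite lee_fin (le_trans (fg x))// ler_norm.
Qed.

End IntegrableTools.

(** * Asymptotic equivariance in mean *)

Section ReiterFunctions.
Context (R : realType) (G : groupType) (G_countable : countable [set: G])
  (G_infinite : infinite_set [set: G]) (mu : G -> R)
  (mu_prob : prob_on_group mu) (mu_gen : supp_generates_semigroup mu)
  (P : probability (Omega G) R) (P_law : rw_law mu P).
Context d0 (B0 : measurableType d0) (a0 : G -> B0 -> B0) (beta : probability B0 R)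
  (a0_meas : measurable_action a0) (p : Omega G -> B0)
  (p_inv : forall C, measurable C -> shift_invariant (p @^-1` C))
  (p_full : forall A, shift_invariant A -> exists C : set B0, measurable C /\
        P ((A `\` p @^-1` C) `|` (p @^-1` C `\` A)) = 0%E)
  (p_law : forall C, measurable C -> beta C = P (p @^-1` C))
  (p_act : forall g, P.-negligible [set w | p (path_act g w) <> a0 g (p w)]).
Context (rho : G -> B0 -> R) (dens : forall g, is_density a0 beta g (rho g)).
Implicit Types (c e : R) (g k : G) (C : set B0) (r : B0 -> R) (K : seq G).

Let mrho g : measurable_fun setT (rho g). Proof. by have [] := dens g. Qed.
Let rho0 g b : 0 <= rho g b. Proof. by have [] := dens g. Qed.
Let irho g : beta.-integrable setT (EFin \o rho g).
Proof. exact: density_integrable (dens g). Qed.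

Let hitE C g : measurable C -> fine (beta (a0 g @^-1` C)) = hit_prob P (p @^-1` C) g.
Proof. by move=> mC; rewrite (boundary_hit G_countable a0_meas p_inv p_law p_act g mC). Qed.

Let hit1 C g : measurable C -> 0 <= fine (beta (a0 g @^-1` C)) <= 1.
Proof.
move=> mC; rewrite hitE// hit_prob_ge0 (le_trans (ler_norm _))// hit_prob_norm//.
by have [] := p_inv mC.
Qed.

Lemma theta_boundary_le N K C : uniq K -> measurable C ->
  \sum_(g <- K) theta P N g * fine (beta (a0 g @^-1` C)) <= fine (beta C).
Proof.
move=> uK mC; have -> : beta C = beta (a0 1%g @^-1` C).
  by congr (beta _); apply/seteqP; split => b /=; rewrite a0_meas.1.1.
apply: (@theta_le _ _ G_countable P N K (fun g => fine (beta (a0 g @^-1` C))) 1) => //.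
  move=> x; rewrite hitE// -[RHS](hit_prob_harmonic G_countable G_infinite P_law (p_inv mC)).
  by congr markov_op; apply/funext => g; exact: hitE.
by move=> g; exact: hit1.
Qed.

(** Over the set [C] where the sum exceeds 1, its integral is at most [beta C] by
    [theta_boundary_le], so its excess over 1 vanishes almost everywhere. *)
Lemma theta_density_le1 N K : uniq K ->
  {ae beta, forall b, \sum_(g <- K) theta P N g * rho g b <= 1}.
Proof.
move=> uK; pose S b := \sum_(g <- K) theta P N g * rho g b.
have [iS _] := Rintegral_sum K (theta P N) irho.
have mS : measurable_fun setT S by apply/measurable_EFinP; exact: measurable_int iS.
pose C := S @^-1` `]1, +oo[%classic.
have mC : measurable C by rewrite -[C]setTI; apply: mS => //; exact: measurable_itv.
have bC : bdd_meas (\1_C : B0 -> R) by exact: bdd_meas_indic.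
have iCS : beta.-integrable setT (EFin \o (fun b => \1_C b * S b)) by exact: bdd_measM_int.
have CE b : (b \in C) = (1 < S b) by apply/idP/idP; rewrite inE /C /= in_itv /= andbT.
pose q b := \1_C b * S b - \1_C b.
have q0 b : 0 <= q b.
  by rewrite /q indicE CE; case: ltP => [/ltW|_]; rewrite ?mul1r ?mul0r ?subrr// subr_ge0.
have iC : beta.-integrable setT (EFin \o (\1_C : B0 -> R)) by exact: bdd_meas_int.
have iq : beta.-integrable setT (EFin \o q) by exact: (integrableB measurableT iCS iC).
have Eq : \int[beta]_b q b <= 0.
  rewrite RintegralB// Exp_indic// subr_le0.
  have -> : \int[beta]_b (\1_C b * S b) = \sum_(g <- K) theta P N g * fine (beta (a0 g @^-1` C)).
    have iCr g : beta.-integrable setT (EFin \o (fun b => \1_C b * rho g b)) by exact: bdd_measM_int.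
    transitivity (\int[beta]_b \sum_(g <- K) theta P N g * (\1_C b * rho g b)).
      by apply: eq_Rintegral => b _; rewrite mulr_sumr; apply: eq_bigr => g _; rewrite mulrCA.
    rewrite (Rintegral_sum K (theta P N) iCr).2; apply: eq_bigr => g _.
    by rewrite -Rintegral_indic// (density_set a0_meas (dens g) mC).
  exact: theta_boundary_le.
have := Rintegral_eq0_ae iq q0 Eq; apply: filterS => b.
rewrite /q indicE CE -/(S b); case: ltP => // Sb; rewrite mul1r => /eqP.
by rewrite subr_eq0 => /eqP Sb1; rewrite Sb1 ltxx in Sb.
Qed.

Import HBSimple.

Lemma simple_approx r e : beta.-integrable setT (EFin \o r) -> 0 < e ->
  exists (s : seq R) (r' : B0 -> R), [/\ measurable_fun setT r', uniq s, forall b, r' b \in s,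
    beta.-integrable setT (EFin \o (fun b => `|r b - r' b|)) &
    \int[beta]_b `|r b - r' b| <= e].
Proof.
move=> ir e0; have [g_ [ig _ cg]] := approximation_sfun_integrable measurableT ir.
have iabs n : beta.-integrable setT (EFin \o (fun b => `|r b - g_ n b|)).
  rewrite (_ : EFin \o _ = abse \o ((EFin \o r) \- (EFin \o g_ n))%E)//.
  by apply: integrable_abse; apply: integrableB => //; exact: ig.
have fE n : (\int[beta]_b `|r b - g_ n b|)%:E = (\int[beta]_z `|(EFin \o r) z - (g_ n z)%:E|)%E.
  by rewrite fineK//; exact: integrable_fin_num (iabs n).
have {}cg : (fun n => \int[beta]_b `|r b - g_ n b|) @ \oo --> (0 : R).
  rewrite (_ : (fun n => _) = fine \o (fun n => \int[beta]_z `|(EFin \o r) z - (g_ n z)%:E|)%E).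
    exact: fine_cvg cg.
  by apply/funext => n /=; rewrite -fE.
move/cvgrPdist_le : cg => /(_ _ e0)[n _ /(_ n (leqnn n))].
rewrite sub0r normrN ger0_norm; last by apply: Rintegral_ge0 => b _.
move=> Hn; have /finite_seqP[s sE] : finite_set (range (g_ n)) by [].
exists (undup s), (g_ n); split => //; first exact: undup_uniq.
by move=> b; rewrite mem_undup; have : range (g_ n) (g_ n b) by []; rewrite sE.
Qed.

Lemma theta_reiter k e : 0 < e -> exists N0, forall N, (N0 <= N)%N -> forall K, uniq K ->
  (\sum_(g <- K) \int[beta]_b
     (`|theta P N g * rho k b - theta P N (k^-1 * g)%g| * rho g b)%:E <= e%:E)%E.
Proof.
move=> e0; have e4 : 0 < e / 4 by exact: divr_gt0.
have [s [r' [mr' us r's ir' Hr']]] := simple_approx (irho k) e4.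
pose C c := r' @^-1` [set c].
have mC c : measurable (C c) by rewrite -[C c]setTI; exact: mr'.
(* One share of [e / 4] for each level set of [r']; the successor avoids dividing by 0. *)
have e2 : 0 < e / 4 / (size s).+1%:R by exact: divr_gt0.
have [N0 HN0] := choice (fun c => markov_avg_boundary G_countable G_infinite mu_prob mu_gen
  P_law a0_meas p_inv p_full p_law p_act c (mC c) (mrho k) (rho0 k)
  (fun D mD => density_set a0_meas (dens k) mD) e2).
exists (\max_(c <- s) N0 c)%N => N N0N K uK.
pose th := theta P N; pose th' g := theta P N (k^-1 * g)%g.
have th0 g : 0 <= th g by exact: theta_ge0.
pose hC c g := fine (beta (a0 g @^-1` C c)).
have bC c : bdd_meas (\1_(C c) : B0 -> R) by exact: bdd_meas_indic.
have r'E (F : R -> R) b : \sum_(c <- s) F c * \1_(C c) b = F (r' b).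
  rewrite (bigD1_seq (r' b))//= indicE mem_set// mulr1 big1 ?addr0// => c cr'.
  by rewrite indicE memNset ?mulr0//= => /esym/eqP; rewrite (negbTE cr').
have mabs : measurable_fun setT (fun b => `|rho k b - r' b|).
  by apply/measurable_EFinP; exact: measurable_int ir'.
have pos1 g b : 0 <= th g * `|rho k b - r' b| * rho g b.
  exact: mulr_ge0 (mulr_ge0 (th0 g) (normr_ge0 _)) (rho0 g b).
have pos2 g (f : B0 -> R) b : 0 <= `|th g * f b - th' g| * rho g b.
  exact: mulr_ge0 (normr_ge0 _) (rho0 g b).
have split_le g : (\int[beta]_b (`|th g * rho k b - th' g| * rho g b)%:E <=
    \int[beta]_b (th g * `|rho k b - r' b| * rho g b)%:E +
    (\sum_(c <- s) `|th g * c - th' g| * hC c g)%:E)%E.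
  have -> : (\sum_(c <- s) `|th g * c - th' g| * hC c g)%:E =
      (\int[beta]_b (`|th g * r' b - th' g| * rho g b)%:E)%E.
    have iCr c : beta.-integrable setT (EFin \o (fun b => \1_(C c) b * rho g b)) by exact: bdd_measM_int.
    have [iS ES] := Rintegral_sum s (fun c => `|th g * c - th' g|) iCr.
    have SE : (fun b => \sum_(c <- s) `|th g * c - th' g| * (\1_(C c) b * rho g b)) =
       (fun b => `|th g * r' b - th' g| * rho g b).
      apply/funext => b; rewrite -(r'E (fun c => `|th g * c - th' g|)) mulr_suml.
      by apply: eq_bigr => c _; rewrite mulrA.
    rewrite SE in iS ES.
    rewrite -(fineK (integrable_fin_num measurableT iS)); congr (_%:E).
    rewrite [RHS]ES; apply: eq_bigr => c _; congr (_ * _).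
    by rewrite /hC (density_set a0_meas (dens g) (mC c)) -Rintegral_indic.
  have m1 : measurable_fun setT (fun b => th g * `|rho k b - r' b| * rho g b).
    by apply: measurable_funM => //; apply: measurable_funM => //; exact: measurable_cst.
  have mm (f : B0 -> R) : measurable_fun setT f -> measurable_fun setT (fun b => `|th g * f b - th' g| * rho g b).
    move=> mf; apply: measurable_funM => //; apply: measurableT_comp => //.
    by apply: measurable_funB; [apply: measurable_funM => //|]; exact: measurable_cst.
  rewrite -ge0_integralD//; last 4 first.
  - by move=> b _; rewrite lee_fin.
  - exact/measurable_EFinP.
  - by move=> b _; rewrite lee_fin.
  - by apply/measurable_EFinP; exact: mm.
  apply: ge0_le_integral => //.
  - by move=> b _; rewrite lee_fin.
  - by apply/measurable_EFinP; exact: mm.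
  - by apply: emeasurable_funD; apply/measurable_EFinP => //; exact: mm.
  move=> b _; rewrite -EFinD lee_fin -mulrDl ler_wpM2r//.
  rewrite -[X in X * `|_|]ger0_norm// -normrM.
  by rewrite (_ : th g * rho k b - th' g = th g * (rho k b - r' b) + (th g * r' b - th' g)) ?ler_normD//; ring.
apply: (@le_trans _ _ (\sum_(g <- K) (\int[beta]_b (th g * `|rho k b - r' b| * rho g b)%:E +
    (\sum_(c <- s) `|th g * c - th' g| * hC c g)%:E))%E).
  by apply: lee_sum => g _; exact: split_le.
rewrite big_split /= sumEFin.
(* Replacing [rho k] by its simple approximation costs little for all [g] together, since the
   weights [th g * rho g] add up to at most 1. *)
have A : (\sum_(g <- K) \int[beta]_b (th g * `|rho k b - r' b| * rho g b)%:E <= (e / 4)%:E)%E.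
  rewrite -ge0_integral_sum//; last 2 first.
  - move=> g; apply/measurable_EFinP; apply: measurable_funM => //.
    by apply: measurable_funM => //; exact: measurable_cst.
  - by move=> g b _; rewrite lee_fin.
  apply: (@le_trans _ _ (\int[beta]_b `|rho k b - r' b|%:E)%E); last first.
    by rewrite -(fineK (integrable_fin_num measurableT ir')) lee_fin.
  apply: ae_ge0_le_integral => //.
  - by move=> b _; apply: sume_ge0 => g _; rewrite lee_fin.
  - apply: emeasurable_sum => g; apply/measurable_EFinP; apply: measurable_funM => //.
    by apply: measurable_funM => //; exact: measurable_cst.
  - exact/measurable_EFinP.
  - apply: filterS (theta_density_le1 N uK) => b Hb _.
    rewrite sumEFin lee_fin (eq_bigr (fun g => `|rho k b - r' b| * (th g * rho g b))); last first.
      by move=> g _; ring.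
    by rewrite -mulr_sumr ler_piMr.
have Bc c : c \in s -> \sum_(g <- K) `|th g * c - th' g| * hC c g <=
    \int[beta]_b (\1_(C c) b * `|rho k b - c|) + e / 4 / (size s).+1%:R.
  move=> cs.
  have N0cN : (N0 c <= N)%N by apply: leq_trans N0N; rewrite (bigD1_seq c)//= leq_maxl.
  (* The signs make every term of the difference of averages of [u] an absolute value. They depend
     on [N] and [K], which is why the bound had to be uniform in [u]. *)
  pose sg g := Num.sg (th g * c - th' g) * hC c g.
  pose u y := \sum_(g <- K) sg g * delta R g y.
  have hC0 g : 0 <= hC c g by have /andP[] := hit1 g (mC c).
  have uC y : `|u y| <= fine (beta (a0 y @^-1` C c)).
    rewrite /u sum_delta//; case: ifP => _; last by rewrite normr0; exact: hC0.
    rewrite /sg normrM [`|hC _ _|]ger0_norm// ler_piMl//.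
    by rewrite normr_sg; case: (_ != 0).
  have := HN0 c N N0cN u uC; rewrite !markov_avg_finite//.
  apply: le_trans; rewrite -normrN opprB.
  apply: le_trans (ler_norm _); rewrite mulr_sumr -sumrB le_eqVlt; apply/orP; left; apply/eqP.
  apply: eq_bigr => g _; rewrite invg1 mul1g -/(th g) -/(th' g) /sg normrEsg; ring.
have B : \sum_(g <- K) \sum_(c <- s) `|th g * c - th' g| * hC c g <= e / 2.
  rewrite exchange_big /=.
  apply: (@le_trans _ _ (\sum_(c <- s) (\int[beta]_b (\1_(C c) b * `|rho k b - c|) + e / 4 / (size s).+1%:R))).
    by rewrite big_seq [leRHS]big_seq; apply: ler_sum => c; exact: Bc.
  rewrite big_split /= big_const_seq count_predT iter_addr addr0.
  have -> : e / 2 = e / 4 + e / 4 by field.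
  apply: lerD; last first.
    by rewrite -[leLHS]mulr_natl mulrCA ger_pMr// ler_pdivrMr// mul1r ler_nat.
  apply: le_trans Hr'; rewrite le_eqVlt; apply/orP; left; apply/eqP.
  have iCr c : beta.-integrable setT (EFin \o (fun b => \1_(C c) b * `|rho k b - r' b|)) by exact: bdd_measM_int.
  have [_ ES] := Rintegral_sum s (fun=> 1) iCr.
  transitivity (\sum_(c <- s) 1 * \int[beta]_b (\1_(C c) b * `|rho k b - r' b|)).
    apply: eq_bigr => c _; rewrite mul1r; apply: eq_Rintegral => b _.
    by rewrite indicE; have [|_] := boolP (b \in C c); rewrite ?mul0r// inE /C /= => ->.
  rewrite -ES; apply: eq_Rintegral => b _.
  transitivity (\sum_(c <- s) `|rho k b - r' b| * \1_(C c) b); last exact: (r'E (fun=> `|rho k b - r' b|)).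
  by apply: eq_bigr => c _; rewrite mul1r mulrC.
rewrite -lee_fin in B; apply: (le_trans (leeD A B)).
by rewrite -EFinD lee_fin; lra.
Qed.

Lemma theta_reiter_swap k e : 0 < e -> exists N0, forall N, (N0 <= N)%N -> forall K, uniq K ->
  (\sum_(g <- K) \int[beta]_b `|theta P N g * rho g (a0 k^-1%g b) -
     theta P N (k * g)%g * rho (k * g)%g b|%:E <= e%:E)%E.
Proof.
move=> e0; have [N0 HN0] := theta_reiter k^-1%g e0; exists N0 => N NN K uK.
apply: le_trans (HN0 N NN K uK); rewrite le_eqVlt; apply/orP; left; apply/eqP.
by apply: eq_bigr => g _; rewrite (density_swap a0_meas (theta P N) g k dens) invgK.
Qed.

End ReiterFunctions.

(** * Rounding densities to integer counts *)

Section ReiterCounts.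
Context (R : realType) (G : groupType) (G_countable : countable [set: G])
  (G_infinite : infinite_set [set: G]) (mu : G -> R)
  (mu_prob : prob_on_group mu) (mu_gen : supp_generates_semigroup mu)
  (P : probability (Omega G) R) (P_law : rw_law mu P).
Context d0 (B0 : measurableType d0) (a0 : G -> B0 -> B0) (beta : probability B0 R)
  (a0_meas : measurable_action a0) (p : Omega G -> B0)
  (p_inv : forall C, measurable C -> shift_invariant (p @^-1` C))
  (p_full : forall A, shift_invariant A -> exists C : set B0, measurable C /\
        P ((A `\` p @^-1` C) `|` (p @^-1` C `\` A)) = 0%E)
  (p_law : forall C, measurable C -> beta C = P (p @^-1` C))
  (p_act : forall g, P.-negligible [set w | p (path_act g w) <> a0 g (p w)]).
Implicit Types (c e : R) (g k : G) (C : set B0) (K : seq G).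

Lemma ae_le_Rintegral d (T : measurableType d) (Q : probability T R) (f g : T -> R) :
  Q.-integrable setT (EFin \o f) -> Q.-integrable setT (EFin \o g) ->
  {ae Q, forall x, f x <= g x} -> \int[Q]_x f x <= \int[Q]_x g x.
Proof.
move=> if_ ig fg.
have mf : measurable_fun setT f by apply/measurable_EFinP; exact: measurable_int if_.
have mg : measurable_fun setT g by apply/measurable_EFinP; exact: measurable_int ig.
have mm : measurable_fun setT (fun x => Num.max (f x) (g x)) by exact: measurable_maxr.
rewrite [leRHS](@ae_eq_Rintegral _ _ _ Q g (fun x => Num.max (f x) (g x)))//; last first.
  by apply: filterS fg => x /max_idPr.
apply: le_Rintegral => // [|x _]; last by rewrite le_max lexx.
apply: (@le_integrableR _ _ _ _ _ (fun x => `|f x| + `|g x|)) => // [|x].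
  exact: (integrableD measurableT (integrable_abse if_) (integrable_abse ig)).
by case: (leP (f x) (g x)) => _; rewrite ?lerDl ?lerDr.
Qed.

Lemma boundary_quasi_invariant g C : measurable C -> beta C = 0%E -> beta (a0 g @^-1` C) = 0%E.
Proof.
move=> mC C0; have iD := p_inv mC.
have hE x := boundary_hit G_countable a0_meas p_inv p_law p_act x mC.
have h1 : hit_prob P (p @^-1` C) 1%g = 0.
  rewrite hE (_ : a0 1%g @^-1` C = C) ?C0//.
  by apply/seteqP; split => b /=; rewrite a0_meas.1.1.
have := hit_prob_null G_countable G_infinite P_law mu_prob mu_gen iD h1 g.
have mgC : measurable (a0 g @^-1` C) by rewrite -[_ @^-1` _]setTI; exact: a0_meas.2.
by rewrite hE => /(congr1 (@EFin R)); rewrite fineK// fin_num_measure.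
Qed.

Lemma exists_densities : exists rho : G -> B0 -> R, forall g, is_density a0 beta g (rho g).
Proof.
have H g := density_exists a0_meas (fun C mC => @boundary_quasi_invariant g C mC).
by have [rho Hrho] := choice H; exists rho.
Qed.

Lemma big_uniq_sub (K hs : seq G) (f : G -> R) : uniq K -> uniq hs ->
  (forall h, 0 <= f h) -> {subset hs <= K} -> \sum_(h <- hs) f h <= \sum_(h <- K) f h.
Proof.
move=> uK uhs f0 sub; rewrite [leRHS](bigID (mem hs)) /=.
rewrite [X in _ <= X + _](_ : _ = \sum_(h <- hs) f h); first by rewrite lerDl sumr_ge0.
rewrite -big_filter; apply/perm_big/uniq_perm => //; first exact: filter_uniq.
by move=> h; rewrite mem_filter andb_idr//; exact: sub.
Qed.

(** The cap at [M] holds at every point, also on the null set where the rounded quantity exceeds 1,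
    so that slots can be numbered by ['I_M]. *)
Definition truncated_count (M : nat) (x : R) : nat := minn (Num.truncn (M%:R * x)) M.

Lemma truncated_count_lip M x y : 0 <= x -> 0 <= y ->
  `|(truncated_count M x)%:R - (truncated_count M y)%:R| <= M%:R * `|x - y| + 1 :> R.
Proof.
move=> x0 y0; wlog xy : x y x0 y0 / x <= y.
  move=> H; have [|/ltW] := leP x y; first exact: H.
  by rewrite distrC [`|x - y|]distrC; exact: H.
have tm : (truncated_count M x <= truncated_count M y)%N.
  by rewrite /truncated_count leq_min geq_minr andbT geq_min le_truncn// ler_wpM2l.
rewrite distrC ger0_norm ?subr_ge0 ?ler_nat// [`|x - y|]distrC ger0_norm ?subr_ge0//.
have My0 : 0 <= M%:R * y by exact: mulr_ge0.
have Mx0 : 0 <= M%:R * x by exact: mulr_ge0.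
have /andP[ty _] := truncn_itv My0; have /andP[_ tx] := truncn_itv Mx0.
have txy : M%:R * x <= M%:R * y by rewrite ler_wpM2l.
rewrite /truncated_count; set ny := Num.truncn (M%:R * y) in ty *; set nx := Num.truncn (M%:R * x) in tx *.
rewrite lerBlDr; have [nM|nM] := leqP nx M; last first.
  rewrite (le_trans (y := M%:R))//; first by rewrite ler_nat geq_minr.
  by rewrite lerDr addr_ge0// mulr_ge0// subr_ge0.
apply: (@le_trans _ _ ny%:R); first by rewrite ler_nat geq_minl.
by move: ty tx; rewrite -natr1; lra.
Qed.

Lemma truncated_count_le M x : 0 <= x -> (truncated_count M x)%:R <= M%:R * x :> R.
Proof.
move=> x0; have Mx0 : 0 <= M%:R * x by exact: mulr_ge0.
by apply: (@le_trans _ _ (Num.truncn (M%:R * x))%:R); [rewrite ler_nat geq_minl|rewrite truncn_le].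
Qed.

Lemma truncated_count_ge M x : 0 <= x <= 1 -> M%:R * x <= (truncated_count M x)%:R + 1 :> R.
Proof.
move=> /andP[x0 x1]; have Mx0 : 0 <= M%:R * x by exact: mulr_ge0.
have /andP[tx1 tx2] := truncn_itv Mx0; rewrite /truncated_count; case: leqP => _.
  by rewrite natr1 ltW.
by rewrite (le_trans (ler_piMr _ x1))// lerDl.
Qed.

Lemma measurable_truncated_count d (T : measurableType d) M (f : T -> R) n :
  measurable_fun setT f -> (forall x, 0 <= f x) ->
  measurable [set x | truncated_count M (f x) = n].
Proof.
move=> mf f0.
have mge m : measurable [set x | (m <= truncated_count M (f x))%N].
  have [mM|Mm] := leqP m M; last first.
    rewrite (_ : mkset _ = set0)//; apply/seteqP; split => // x /=.
    by rewrite /truncated_count leq_min => /andP[_]; rewrite leqNgt Mm.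
  have mMf : measurable_fun setT (fun x => M%:R * f x).
    by apply: measurable_funM => //; exact: measurable_cst.
  rewrite (_ : mkset _ = setT `&` (fun x => M%:R * f x) @^-1` `[m%:R, +oo[%classic).
    by apply: mMf => //; exact: measurable_itv.
  rewrite setTI; apply/seteqP; split => x /=;
    by rewrite in_itv/= andbT /truncated_count leq_min mM andbT truncn_ge_nat// mulr_ge0.
rewrite (_ : mkset _ = [set x | (n <= truncated_count M (f x))%N] `\`
    [set x | (n < truncated_count M (f x))%N]); first exact: measurableD.
apply/seteqP; split => x /= => [->|[nx /negP]]; first by split => //; rewrite ltnn.
by rewrite -leqNgt => xn; apply/eqP; rewrite eqn_leq nx xn.
Qed.

End ReiterCounts.

Section BoundaryCounts.
Context (R : realType) (G : groupType) (G_countable : countable [set: G])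
  (G_infinite : infinite_set [set: G]) (mu : G -> R)
  (mu_prob : prob_on_group mu) (mu_gen : supp_generates_semigroup mu)
  (P : probability (Omega G) R) (P_law : rw_law mu P).
Context d0 (B0 : measurableType d0) (a0 : G -> B0 -> B0) (beta : probability B0 R)
  (a0_meas : measurable_action a0) (p : Omega G -> B0)
  (p_inv : forall C, measurable C -> shift_invariant (p @^-1` C))
  (p_full : forall A, shift_invariant A -> exists C : set B0, measurable C /\
        P ((A `\` p @^-1` C) `|` (p @^-1` C `\` A)) = 0%E)
  (p_law : forall C, measurable C -> beta C = P (p @^-1` C))
  (p_act : forall g, P.-negligible [set w | p (path_act g w) <> a0 g (p w)]).
Implicit Types (c e : R) (g k : G) (C : set B0) (K F : seq G).

Lemma bdd_meas_nat (f : B0 -> nat) M : (forall n, measurable [set b | f b = n]) ->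
  (forall b, (f b <= M)%N) -> bdd_meas (fun b => (f b)%:R : R).
Proof.
move=> mf fM; split; last by exists M%:R => b; rewrite ger0_norm ?ler_nat.
move=> _ Y mY; rewrite setTI (_ : _ @^-1` Y = \bigcup_(n in [set n : nat | Y n%:R]) [set b | f b = n]).
  exact: bigcup_measurable.
by apply/seteqP; split => [b Yb|b [n /= Yn fb]]; [exists (f b)|rewrite /= fb].
Qed.

(** The counts are [theta g * rho g], scaled by [M] and rounded down. The list [hs] stays arbitrary
    because slots are laid out only once [K] is known. *)
Lemma boundary_counts F e : 0 < e -> exists K (M : nat) (N : G -> B0 -> nat),
  [/\ uniq K /\ (0 < M)%N,
    (forall g n, measurable [set b | N g b = n]) /\ (forall g b, (N g b <= M)%N) /\
    (forall g b, g \notin K -> N g b = 0%N),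
    forall k hs, k \in F -> uniq hs ->
      \int[beta]_b (\sum_(h <- hs) `|(N (k^-1 * h)%g (a0 k^-1%g b))%:R - (N h b)%:R|) <= e * M%:R,
    \int[beta]_b `|M%:R - \sum_(h <- K) (N h b)%:R| <= e * M%:R &
    forall v : G -> R, harmonic P v -> (forall g, `|v g| <= 1) ->
      `|\sum_(h <- K) (\int[beta]_b (N h b)%:R) / M%:R * v h - v 1%g| <= e].
Proof.
move=> e0.
have e4 : 0 < e / 4 by exact: divr_gt0.
have [rho dens] := exists_densities G_countable G_infinite mu_prob mu_gen P_law a0_meas
  p_inv p_law p_act.
have mrho g : measurable_fun setT (rho g) by have [] := dens g.
have rho0 g b : 0 <= rho g b by have [] := dens g.
have irho g : beta.-integrable setT (EFin \o rho g) by exact: density_integrable (dens g).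
have Erho g : \int[beta]_b rho g b = 1.
  have := density_set a0_meas (dens g) measurableT.
  by rewrite preimage_setT probability_setT /Rintegral => <-.
have [N0 HN0] := choice (fun k => theta_reiter_swap G_countable G_infinite mu_prob mu_gen
  P_law a0_meas p_inv p_full p_law p_act dens k e4).
pose n := (\max_(k <- F) N0 k)%N; pose th := theta P n.
have th0 g : 0 <= th g by exact: theta_ge0.
have [K0 HK0] := theta_mass G_countable G_infinite P_law n e4.
(* Besides [K0], the list contains every [k^-1 K0], so that [K] and all its translates [k K] carry
   almost the whole mass of [theta]. *)
pose K := undup (K0 ++ [seq (k^-1 * g)%g | k <- F, g <- K0]).
have uK : uniq K by exact: undup_uniq.
have thK : 1 - e / 4 <= \sum_(g <- K) th g.
  by apply: HK0 => // g gK0; rewrite mem_undup mem_cat gK0.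
have uKk k : uniq [seq (k * g)%g | g <- K] by rewrite map_inj_uniq//; exact: mulgI.
have thKk k : k \in F -> 1 - e / 4 <= \sum_(g <- [seq (k * g)%g | g <- K]) th g.
  move=> kF; apply: HK0 => // g gK0; apply/mapP; exists (k^-1 * g)%g; last by rewrite mulVKg.
  by rewrite mem_undup mem_cat; apply/orP; right; apply/allpairsP; exists (k, g).
(* Rounding costs at most 1 per element, over at most twice [size K] elements, hence at most [e / 4]
   relative to [M]. *)
pose M := (Num.truncn ((size K).*2%:R / (e / 4))).+1.
have M0 : 0 < M%:R :> R by rewrite ltr0n.
have KM : (size K).*2%:R / M%:R <= e / 4.
  by rewrite ler_pdivrMr// -ler_pdivrMl// mulrC ltW// truncnS_gt.
have KM1 : (size K)%:R / M%:R <= e / 4.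
  apply: le_trans KM; rewrite ler_pM2r ?invr_gt0// ler_nat -addnn; exact: leq_addr.
pose lam g b := th g * rho g b.
have lam0 g b : 0 <= lam g b by exact: mulr_ge0.
have mlam g : measurable_fun setT (lam g) by apply: measurable_funM => //; exact: measurable_cst.
have ilam g : beta.-integrable setT (EFin \o lam g) by exact: (integrableZl measurableT (th g) (irho g)).
have Elam g : \int[beta]_b lam g b = th g by rewrite RintegralZl// Erho mulr1.
pose N g b := if g \in K then truncated_count M (lam g b) else 0%N.
have mN g m : measurable [set b | N g b = m].
  rewrite /N; have [gK|gK] := boolP (g \in K); first exact: measurable_truncated_count.
  have [->|m0] := eqVneq 0%N m; first by rewrite (_ : mkset _ = setT)//; apply/seteqP; split.
  by rewrite (_ : mkset _ = set0)//; apply/seteqP; split => // b /= /eqP; rewrite (negbTE m0).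
have NM g b : (N g b <= M)%N by rewrite /N; case: ifP => // _; rewrite geq_minr.
have bN g : bdd_meas (fun b => (N g b)%:R : R) by exact: (bdd_meas_nat (mN g) (NM g)).
have iN g : beta.-integrable setT (EFin \o (fun b => (N g b)%:R : R)) by exact: bdd_meas_int.
have sumlam (K' : seq G) : uniq K' -> {ae beta, forall b, \sum_(g <- K') lam g b <= 1}.
  by move=> uK'; exact: (theta_density_le1 G_countable G_infinite P_law a0_meas p_inv p_law p_act dens n uK').
have ae1 : {ae beta, forall b, \sum_(g <- K) lam g b <= 1} by exact: sumlam.
have lamN g b : lam g b <= 1 -> g \in K -> lam g b <= (N g b)%:R / M%:R + M%:R^-1.
  move=> l1 gK; rewrite /N gK -[X in _ <= _ + X]mul1r -mulrDl.
  by rewrite ler_pdivlMr// mulrC truncated_count_ge// lam0.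
have Nlam g b : (N g b)%:R / M%:R <= lam g b.
  rewrite /N; case: ifP => _; last by rewrite mul0r.
  by rewrite ler_pdivrMr// mulrC truncated_count_le.
have lam1 g b : g \in K -> \sum_(g <- K) lam g b <= 1 -> lam g b <= 1.
  by move=> gK; apply: le_trans; rewrite (bigD1_seq g)//= lerDl sumr_ge0.
exists K, M, N; split => //.
- by split => //; split => // g b gK; rewrite /N (negbTE gK).
- move=> k hs kF uhs.
  pose K' := undup (K ++ [seq (k * g)%g | g <- K]).
  have uK' : uniq K' by exact: undup_uniq.
  have szK' : (size K' <= (size K).*2)%N.
    by rewrite (leq_trans (size_undup _))// size_cat size_map addnn.
  pose f h b := `|(N (k^-1 * h)%g (a0 k^-1%g b))%:R - (N h b)%:R| : R.
  pose D h b := `|lam (k^-1 * h)%g (a0 k^-1%g b) - lam h b|.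
  (* [I] marks the elements missing from [K] or from [k K], where a count is zero because it was cut
     off; there the whole of [lam h] is paid, in addition to [D h]. *)
  pose I h : R := ((h \notin K) || (h \notin [seq (k * g)%g | g <- K]))%:R.
  have mact (q : B0 -> R) : measurable_fun setT q -> measurable_fun setT (fun b => q (a0 k^-1%g b)).
    by move=> mq; apply: measurableT_comp => //; exact: a0_meas.2.
  have bf h : bdd_meas (f h).
    apply: bdd_meas_norm; apply: bdd_measB => //.
    by apply: (@bdd_meas_comp _ _ _ _ _ (fun b => (N (k^-1 * h)%g b)%:R)) => //; exact: a0_meas.2.
  have kKE h : (h \in [seq (k * g)%g | g <- K]) = ((k^-1 * h)%g \in K).
    apply/mapP/idP => [[g gK ->]|hK]; first by rewrite mulKg.
    by exists (k^-1 * h)%g; rewrite ?mulVKg.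
  have fle h b : f h b <= M%:R * (D h b + M%:R^-1 + I h * lam h b).
    have MV : M%:R * M%:R^-1 = 1 :> R by rewrite divff// gt_eqF.
    have DM0 : 0 <= M%:R * D h b by rewrite mulr_ge0// /D.
    have LM0 : 0 <= M%:R * lam h b by rewrite mulr_ge0.
    rewrite !mulrDr MV /f /N /I kKE.
    have [hK|hK] := boolP (h \in K); have [kK|kK] := boolP ((k^-1 * h)%g \in K) => /=.
    - by rewrite mul0r mulr0 addr0 truncated_count_lip.
    - rewrite sub0r normrN ger0_norm// mul1r.
      by rewrite (le_trans (truncated_count_le M (lam0 h b)))// lerDr addr_ge0.
    - rewrite subr0 ger0_norm// mul1r.
      rewrite (le_trans (truncated_count_le M (lam0 (k^-1 * h)%g (a0 k^-1%g b))))//.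
      apply: (@le_trans _ _ (M%:R * D h b + M%:R * lam h b)); last by rewrite lerD2r lerDl.
      by rewrite -mulrDr ler_wpM2l// -lerBlDr ler_norm.
    - by rewrite subrr normr0 mul1r !addr_ge0.
  have f0 h b : h \notin K' -> f h b = 0.
    rewrite mem_undup mem_cat negb_or kKE => /andP[hK kK].
    by rewrite /f /N (negbTE hK) (negbTE kK) subrr normr0.
  have sumle b : \sum_(h <- hs) f h b <= \sum_(h <- K') f h b.
    rewrite (bigID (mem K')) /= [X in _ + X]big1 ?addr0; last by move=> h; exact: f0.
    rewrite -big_filter; apply: big_uniq_sub => //; first exact: filter_uniq.
    - by move=> h; exact: normr_ge0.
    - by move=> h; rewrite mem_filter => /andP[].
  have bD : (\sum_(h <- K') \int[beta]_b (D h b)%:E <= (e / 4)%:E)%E.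
    have := HN0 k n _ [seq (k^-1 * h)%g | h <- K'] _; rewrite big_map.
    rewrite (eq_bigr (fun h => \int[beta]_b (D h b)%:E)%E); last first.
      move=> h _; apply: eq_integral => b _; by rewrite mulVKg.
    apply; last by rewrite map_inj_uniq//; exact: mulgI.
    by rewrite /n; apply: leq_bigmax_seq.
  have mD h : measurable_fun setT (D h).
    by apply: measurableT_comp => //; apply: measurable_funB => //; exact: mact.
  have iD h : h \in K' -> beta.-integrable setT (EFin \o D h).
    move=> hK'; apply/integrableP; split; first exact/measurable_EFinP.
    apply: (@le_lt_trans _ _ (e / 4)%:E); last by rewrite ltry.
    apply: le_trans bD; rewrite (bigD1_seq h)//=.
    rewrite (_ : (\int[beta]_b `|(D h b)%:E|)%E = (\int[beta]_b (D h b)%:E)%E).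
      by rewrite leeDl// sume_ge0// => g _; apply: integral_ge0 => b _; rewrite lee_fin /D.
    by apply: eq_integral => b _; rewrite gee0_abs// lee_fin /D.
  (* Off [K'] the function [D h] is replaced by 0, since [Rintegral_sum] asks for integrability at
     every index. *)
  pose D' h b := if h \in K' then D h b else 0.
  have iD' h : beta.-integrable setT (EFin \o D' h).
    rewrite /D'; case: (boolP (h \in K')) => hK'; first exact: iD.
    exact: integrable0.
  have ED' : \sum_(h <- K') \int[beta]_b D' h b <= e / 4.
    rewrite -lee_fin -sumEFin; apply: le_trans bD.
    rewrite big_seq [leRHS]big_seq; apply: lee_sum => h hK'.
    by rewrite /D' hK' fineK//; exact: integrable_fin_num (iD h hK').
  have Isum : \sum_(h <- K') I h * th h <= e / 2.
    have sumK'1 : \sum_(h <- K') th h <= 1 by exact: theta_sum_le1.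
    have part (A : seq G) : uniq A -> {subset A <= K'} -> 1 - e / 4 <= \sum_(g <- A) th g ->
        \sum_(h <- K') (h \notin A)%:R * th h <= e / 4.
      move=> uA sA HA.
      have -> : \sum_(h <- K') (h \notin A)%:R * th h = \sum_(h <- K') th h - \sum_(h <- A) th h.
        rewrite [\sum_(h <- K') th h](bigID (mem A)) /=.
        rewrite [X in X + _ - _](_ : _ = \sum_(h <- A) th h); last first.
          rewrite -big_filter; apply/perm_big/uniq_perm => //; first exact: filter_uniq.
          by move=> h; rewrite mem_filter andb_idr//; exact: sA.
        rewrite addrAC subrr add0r [RHS]big_mkcond /=; apply: eq_bigr => h _.
        by case: ifP; rewrite ?mul1r ?mul0r.
      lra.
    apply: (@le_trans _ _ (\sum_(h <- K') (h \notin K)%:R * th h +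
        \sum_(h <- K') (h \notin [seq (k * g)%g | g <- K])%:R * th h)).
      rewrite -big_split /=; apply: ler_sum => h _; rewrite /I -mulrDl ler_wpM2r//.
      by case: (_ \notin K); case: (_ \notin _); rewrite /= ?addr0 ?add0r// lerDl.
    have sub1 : {subset K <= K'} by move=> h hK; rewrite mem_undup mem_cat hK.
    have sub2 : {subset [seq (k * g)%g | g <- K] <= K'}.
      by move=> h hK; rewrite mem_undup mem_cat hK orbT.
    rewrite (_ : e / 2 = e / 4 + e / 4); last by field.
    by apply: lerD; [exact: part thK|exact: part (uKk k) sub2 (thKk k kF)].
  have [iDs EDs] := Rintegral_sum K' (fun=> 1) iD'.
  have [iLs ELs] := Rintegral_sum K' I ilam.
  pose B1 b := M%:R * ((\sum_(h <- K') 1 * D' h b + (size K')%:R / M%:R) + \sum_(h <- K') I h * lam h b).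
  have ic : beta.-integrable setT (EFin \o (fun=> (size K')%:R / M%:R)).
    by apply: bdd_meas_int; exact: bdd_meas_cst.
  have i1 : beta.-integrable setT (EFin \o (fun b => \sum_(h <- K') 1 * D' h b + (size K')%:R / M%:R)).
    exact: (integrableD measurableT iDs ic).
  have i2 : beta.-integrable setT (EFin \o (fun b => (\sum_(h <- K') 1 * D' h b + (size K')%:R / M%:R) + \sum_(h <- K') I h * lam h b)).
    exact: (integrableD measurableT i1 iLs).
  apply: (@le_trans _ _ (\int[beta]_b B1 b)).
    apply: le_Rintegral => //.
    - by apply: bdd_meas_int; exact: bdd_meas_sum.
    - exact: (integrableZl measurableT M%:R i2).
    move=> b _; apply: le_trans (sumle b) _.
    apply: (@le_trans _ _ (\sum_(h <- K') M%:R * (D' h b + M%:R^-1 + I h * lam h b))).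
      rewrite big_seq [leRHS]big_seq; apply: ler_sum => h hK'.
      by rewrite /D' hK'; exact: fle.
    rewrite -mulr_sumr /B1 ler_wpM2l// !big_split /= big_const_seq count_predT iter_addr addr0.
    rewrite -[M%:R^-1 *+ _]mulr_natl le_eqVlt; apply/orP; left; apply/eqP.
    by congr (_ + _ + _); apply: eq_bigr => h _; rewrite mul1r.
  rewrite /B1 RintegralZl// [e * _]mulrC ler_pM2l// RintegralD// RintegralD// Exp_cst EDs ELs.
  rewrite (eq_bigr (fun h => \int[beta]_b D' h b)) => [|h _]; last by rewrite mul1r.
  rewrite [X in _ + X](eq_bigr (fun h => I h * th h)) => [|h _]; last by rewrite Elam.
  have : (size K')%:R / M%:R <= e / 4.
    by apply: le_trans KM; rewrite ler_pM2r ?invr_gt0// ler_nat.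
  by lra.
- rewrite (_ : e * M%:R = M%:R * e); last exact: mulrC.
  have bS : bdd_meas (fun b => `|M%:R - \sum_(h <- K) (N h b)%:R| : R).
    by apply: bdd_meas_norm; apply: bdd_measB; [exact: bdd_meas_cst|exact: bdd_meas_sum].
  have [iL EL] := Rintegral_sum K (fun=> 1) ilam.
  have ic : beta.-integrable setT (EFin \o (fun=> 1 + (size K)%:R / M%:R)).
    by apply: bdd_meas_int; exact: bdd_meas_cst.
  have i1 : beta.-integrable setT (EFin \o (fun b => 1 + (size K)%:R / M%:R - \sum_(h <- K) 1 * lam h b)).
    exact: (integrableB measurableT ic iL).
  have iR := integrableZl measurableT M%:R i1.
  apply: (@le_trans _ _ (\int[beta]_b (M%:R * ((1 + (size K)%:R / M%:R) - \sum_(h <- K) 1 * lam h b)))).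
    apply: ae_le_Rintegral => //; first exact: bdd_meas_int.
    apply: filterS ae1 => b Hb.
    have S1 : \sum_(h <- K) (N h b)%:R / M%:R <= 1 :> R.
      by apply: le_trans Hb; apply: ler_sum => h _; exact: Nlam.
    have S2 : \sum_(h <- K) lam h b <= \sum_(h <- K) (N h b)%:R / M%:R + (size K)%:R / M%:R.
      apply: (@le_trans _ _ (\sum_(h <- K) ((N h b)%:R / M%:R + M%:R^-1))).
        by rewrite big_seq [leRHS]big_seq; apply: ler_sum => h hK; apply: lamN => //; exact: lam1.
      by rewrite big_split /= big_const_seq count_predT iter_addr addr0 -[X in _ + X]mulr_natl.
    rewrite -mulr_suml in S1 S2; move: S1; rewrite ler_pdivrMr// mul1r => S1.
    have SL : \sum_(h <- K) 1 * lam h b = \sum_(h <- K) lam h b.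
      by apply: eq_bigr => h _; rewrite mul1r.
    rewrite ger0_norm ?subr_ge0// SL.
    move: S2; set S := \sum_(h <- K) lam h b; set T := \sum_(h <- K) (N h b)%:R.
    rewrite -mulrDl ler_pdivlMr// => S2.
    rewrite mulrBr mulrDr mulr1 [M%:R * (_ / _)]mulrC divfK ?gt_eqF// [M%:R * S]mulrC.
    by lra.
  rewrite RintegralZl// ler_pM2l// RintegralB//.
  rewrite EL Exp_cst (eq_bigr th) => [|h _]; last by rewrite mul1r Elam.
  by lra.
- move=> v hv v1.
  have d1 h : h \in K -> `|\int[beta]_b (N h b)%:R / M%:R - th h| <= M%:R^-1.
    move=> hK; rewrite -Elam.
    have iNM : beta.-integrable setT (EFin \o (fun b => M%:R^-1 * (N h b)%:R)) by exact: (integrableZl measurableT M%:R^-1 (iN h)).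
    have -> : \int[beta]_b (N h b)%:R / M%:R = \int[beta]_b (M%:R^-1 * (N h b)%:R).
      by rewrite RintegralZl// mulrC.
    rewrite distrC -RintegralB//.
    have id : beta.-integrable setT (EFin \o (fun b => lam h b - M%:R^-1 * (N h b)%:R)) by exact: (integrableB measurableT (ilam h) iNM).
    rewrite (le_trans (le_normr_Rintegral _ _))// -[leRHS](Exp_cst beta).
    apply: ae_le_Rintegral; [|by apply: bdd_meas_int; exact: bdd_meas_cst|].
      exact: (integrable_abse id).
    apply: filterS ae1 => b Hb; have := lamN h b (lam1 h b hK Hb) hK; have := Nlam h b.
    by rewrite (mulrC _ M%:R^-1) => ? ?; rewrite ger0_norm ?subr_ge0// lerBlDl.
  rewrite (_ : _ - v 1%g = \sum_(h <- K) (\int[beta]_b (N h b)%:R / M%:R - th h) * v h +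
     (\sum_(h <- K) th h * v h - v 1%g)); last first.
    rewrite addrA -big_split /=; congr (_ - _); apply: eq_bigr => h _; ring.
  rewrite (le_trans (ler_normD _ _))// (_ : e = e / 2 + e / 2); last by field.
  apply: lerD.
    rewrite (le_trans (ler_norm_sum _ _ _))//.
    apply: (@le_trans _ _ (\sum_(h <- K) M%:R^-1)).
      rewrite big_seq [leRHS]big_seq; apply: ler_sum => h hK.
      by rewrite normrM; apply: le_trans (ler_piMr _ (v1 h)) (d1 h hK).
    rewrite big_const_seq count_predT iter_addr addr0 -[leLHS]mulr_natl.
    by lra.
  have := theta_harmonic G_countable n uK hv v1; rewrite -/th; lra.
Qed.

End BoundaryCounts.

(** * Independent labels *)

Section ProductWeights.
Context (R : realType) (Z : finType) (om : Z -> R) (om1 : \sum_v om v = 1).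

Definition pweight (S : finType) (z : {ffun S -> Z}) : R := \prod_s om (z s).

Lemma pweight_sum (S : finType) (F : S -> Z -> R) :
  \sum_(z : {ffun S -> Z}) pweight z * \prod_s F s (z s) =
  \prod_s \sum_v om v * F s v.
Proof.
rewrite bigA_distr_bigA /=; apply: eq_bigr => z _.
by rewrite /pweight -big_split.
Qed.

Lemma pweight_sum1 (S : finType) : \sum_(z : {ffun S -> Z}) pweight z = 1.
Proof.
transitivity (\sum_(z : {ffun S -> Z}) pweight z * \prod_(s : S) 1).
  by apply: eq_bigr => z _; rewrite big1// mulr1.
rewrite (pweight_sum (fun=> fun=> 1)) big1// => s _.
by rewrite -[RHS]om1; apply: eq_bigr => v _; rewrite mulr1.
Qed.

Section Injection.
Context (S S' : finType) (i : S -> S') (i_inj : injective i).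

(** Writes the event that [C], read along [i], equals [z] as a product over the points of [S'], so
    that weighted sums over [C] factor. *)
Definition agree (z : {ffun S -> Z}) (x : S') (v : Z) : R :=
  [forall s, (i s == x) ==> (z s == v)]%:R.

Lemma agree_prod z (C : {ffun S' -> Z}) :
  ([ffun s => C (i s)] == z)%:R = \prod_x agree z x (C x).
Proof.
case: eqP => [<-|Cz].
  rewrite big1// => x _; rewrite /agree; case: forallP => // H; exfalso; apply: H => s.
  by apply/implyP => /eqP <-; rewrite ffunE.
have [s Hs] : exists s, C (i s) != z s.
  apply/existsP; apply: contra_notT Cz; rewrite negb_exists => /forallP H.
  by apply/ffunP => s; rewrite ffunE; have := H s; rewrite negbK => /eqP.
rewrite (bigD1 (i s))//= /agree; case: forallP => [/(_ s)|_]; last by rewrite mul0r.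
by rewrite eqxx/= eq_sym (negbTE Hs).
Qed.

Definition agree_weight z x := \sum_v om v * agree z x v.

Lemma agree_weight_im z s : agree_weight z (i s) = om (z s).
Proof.
rewrite /agree_weight (bigD1 (z s))//= big1 ?addr0; last first.
  move=> v vz; rewrite /agree; case: forallP => [/(_ s)|_]; last by rewrite mulr0.
  by rewrite eqxx/= eq_sym (negbTE vz).
rewrite /agree; case: forallP => [_|H]; first by rewrite mulr1.
by exfalso; apply: H => t; apply/implyP => /eqP/i_inj ->.
Qed.

Lemma agree_out z x v : x \notin codom i -> agree z x v = 1.
Proof.
move=> xi; rewrite /agree; case: forallP => // H; exfalso; apply: H => s.
by apply/implyP => /eqP xs; rewrite -xs codom_f in xi.
Qed.

Lemma agree_weight_out z x : x \notin codom i -> agree_weight z x = 1.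
Proof. by move=> xi; rewrite /agree_weight -om1; apply: eq_bigr => v _; rewrite agree_out// mulr1. Qed.

Lemma agree_weight_prod z : \prod_x agree_weight z x = pweight z.
Proof.
rewrite (bigID (mem (codom i))) /= [X in _ * X]big1 ?mulr1; last by move=> x; exact: agree_weight_out.
rewrite -big_uniq /=; last by rewrite map_inj_uniq// enum_uniq.
by rewrite big_map big_enum; apply: eq_bigr => s _; rewrite agree_weight_im.
Qed.

End Injection.

(** Independence of the families of labels read along injections with disjoint images. By
    bilinearity it is enough to take indicators of single labellings, where every point of [S'] is
    constrained by at most one of the two. *)
Lemma pweight_indep (S1 S2 S' : finType) (i1 : S1 -> S') (i2 : S2 -> S')
  (F1 : {ffun S1 -> Z} -> R) (F2 : {ffun S2 -> Z} -> R) :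
  injective i1 -> injective i2 -> (forall s1 s2, i1 s1 != i2 s2) ->
  \sum_(C : {ffun S' -> Z}) pweight C * (F1 [ffun s => C (i1 s)] * F2 [ffun s => C (i2 s)]) =
  (\sum_z pweight z * F1 z) * (\sum_z pweight z * F2 z).
Proof.
move=> inj1 inj2 dis.
have FE (S : finType) (F : {ffun S -> Z} -> R) z0 : F z0 = \sum_z (z0 == z)%:R * F z.
  by rewrite (bigD1 z0)//= eqxx mul1r big1 ?addr0// => z; rewrite eq_sym => /negbTE ->; rewrite mul0r.
have key z1 z2 : \sum_(C : {ffun S' -> Z}) pweight C *
    (([ffun s => C (i1 s)] == z1)%:R * ([ffun s => C (i2 s)] == z2)%:R) =
    pweight z1 * pweight z2.
  transitivity (\sum_(C : {ffun S' -> Z}) pweight C * \prod_x (agree i1 z1 x (C x) * agree i2 z2 x (C x))).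
    by apply: eq_bigr => C _; rewrite !agree_prod -big_split.
  rewrite (pweight_sum (fun x v => agree i1 z1 x v * agree i2 z2 x v)).
  rewrite -(agree_weight_prod inj1) -(agree_weight_prod inj2) -big_split /=; apply: eq_bigr => x _.
  have [x1|x1] := boolP (x \in codom i1).
    have x2 : x \notin codom i2.
      by apply/negP => /codomP[s2 xs2]; move/codomP : x1 => [s1 xs1]; have := dis s1 s2; rewrite -xs1 -xs2 eqxx.
    rewrite [X in _ * X](agree_weight_out _ x2) mulr1; apply: eq_bigr => v _.
    by rewrite [agree i2 _ _ _](agree_out _ _ x2) mulr1.
  rewrite [X in X * _](agree_weight_out _ x1) mul1r; apply: eq_bigr => v _.
  by rewrite [agree i1 _ _ _](agree_out _ _ x1) mul1r.
transitivity (\sum_(C : {ffun S' -> Z}) \sum_z1 \sum_z2 (F1 z1 * F2 z2) * (pweight C *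
    (([ffun s => C (i1 s)] == z1)%:R * ([ffun s => C (i2 s)] == z2)%:R))).
  apply: eq_bigr => C _; rewrite [F1 _]FE [F2 _]FE big_distrlr /= mulr_sumr.
  by apply: eq_bigr => z1 _; rewrite mulr_sumr; apply: eq_bigr => z2 _; ring.
rewrite exchange_big big_distrlr /=; apply: eq_bigr => z1 _.
rewrite exchange_big /=; apply: eq_bigr => z2 _.
by rewrite -mulr_sumr key; ring.
Qed.

End ProductWeights.

(** * Finite-valued measurable maps *)

Section FiniteValued.
Context (R : realType) d (T : measurableType d).

(** Measurability into a finite type, without putting a sigma-algebra on it. *)
Definition fin_meas (Y : finType) (D : T -> Y) := forall y, measurable [set b | D b = y].

Lemma fin_meas_pred (Y : finType) (D : T -> Y) (Q : Y -> Prop) :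
  fin_meas D -> measurable [set b | Q (D b)].
Proof.
move=> mD; rewrite (_ : mkset _ = \bigcup_(y in [set y | Q y]) [set b | D b = y]).
  by apply: fin_bigcup_measurable => // ; exact: finite_finset.
by apply/seteqP; split => [b Qb|b [y Qy /= Dy]]; [exists (D b)|rewrite Dy].
Qed.

Lemma fin_meas_comp (Y Y' : finType) (D : T -> Y) (g : Y -> Y') :
  fin_meas D -> fin_meas (fun b => g (D b)).
Proof. by move=> mD y; exact: (fin_meas_pred (fun v => g v = y)). Qed.

Lemma fin_meas_ffun (I Y : finType) (D : I -> T -> Y) :
  (forall i, fin_meas (D i)) -> fin_meas (fun b => [ffun i => D i b]).
Proof.
move=> mD f; rewrite (_ : mkset _ = \bigcap_(i in [set: I]) [set b | D i b = f i]).
  by apply: fin_bigcap_measurable => [|i _]; [exact: finite_finset|exact: mD].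
apply/seteqP; split => [b /= <- i _ /=|b /= H]; first by rewrite ffunE.
by apply/ffunP => i; rewrite ffunE; exact: H.
Qed.

Lemma fin_meas_pair (Y Y' : finType) (D : T -> Y) (D' : T -> Y') :
  fin_meas D -> fin_meas D' -> fin_meas (fun b => (D b, D' b)).
Proof.
move=> mD mD' [y y']; rewrite (_ : mkset _ = [set b | D b = y] `&` [set b | D' b = y']).
  exact: measurableI.
by apply/seteqP; split => b /= [-> ->].
Qed.

Lemma fin_meas_bool (A : set T) : measurable A -> fin_meas (fun b => `[< A b >]).
Proof.
move=> mA [].
  rewrite (_ : mkset _ = A)//; apply/seteqP.
  by split => b /=; [move/asboolP|move=> ?; exact/asboolP].
rewrite (_ : mkset _ = ~` A); first exact: measurableC.
apply/seteqP; split => b /=; first by move=> H Ab; move/asboolP : Ab; rewrite H.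
by move=> nA; apply/negbTE/asboolP.
Qed.

Lemma fin_bdd_meas (Y : finType) (D : T -> Y) (F : Y -> T -> R) :
  fin_meas D -> (forall y, bdd_meas (F y)) -> bdd_meas (fun b => F (D b) b).
Proof.
move=> mD bF; rewrite (_ : (fun b => _) = fun b => \sum_y \1_[set b | D b = y] b * F y b).
  by apply: bdd_meas_sum => y; apply: bdd_measM => //; exact: bdd_meas_indic.
apply/funext => b; rewrite (bigD1 (D b))//= indicE mem_set// mul1r big1 ?addr0// => y yD.
by rewrite indicE memNset ?mul0r// => /= Db; rewrite Db eqxx in yD.
Qed.

Lemma fin_bdd (Y : finType) (D : T -> Y) (F : Y -> R) :
  fin_meas D -> bdd_meas (fun b => F (D b)).
Proof. by move=> mD; apply: (fin_bdd_meas (F := fun y _ => F y) mD) => y; exact: bdd_meas_cst. Qed.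

End FiniteValued.

Lemma fin_meas_precomp d (T : measurableType d) d' (T' : measurableType d')
  (Y : finType) (D : T -> Y) (q : T' -> T) :
  measurable_fun setT q -> fin_meas D -> fin_meas (fun b => D (q b)).
Proof. by move=> mq mD y; rewrite -[mkset _]setTI; exact: (mq measurableT _ (mD y)). Qed.

(** * Stationary measures and absence of atoms *)

Section StationaryMeasures.
Context (R : realType) (G : groupType) (G_countable : countable [set: G])
  (G_infinite : infinite_set [set: G]) (mu : G -> R) (mu_prob : prob_on_group mu)
  (P : probability (Omega G) R) (P_law : rw_law mu P).

Lemma walk_start_esum (u : G -> R) M : (forall g, 0 <= u g <= M) ->
  (\esum_(g in [set: G]) ((mu g)%:E * (u g)%:E))%E = (\int[P]_w u (w 0%N))%:E.
Proof.
move=> uM; have mu0 := mu_prob.1.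
have uN g : `|u g| <= M by have /andP[? ?] := uM g; rewrite ger0_norm.
have [en [rk [enK rkK]]] := countable_infinite_bij G_countable G_infinite.
rewrite (@reindex_esum _ _ _ [set: nat] _ en); last first.
- split => // [i j _ _|g _]; first by move/(can_inj enK).
  by exists (rk g).
rewrite -nneseries_esumT => [|n]; last first.
  by rewrite -EFinM lee_fin mulr_ge0//; have /andP[] := uM (en n).
have cvg1 : (fun n => \sum_(i < n) mu (en i) * u (en i)) @ \oo --> \int[P]_w u (w 0%N).
  have bS n : bdd_meas (fun w : Omega G => \sum_(i < n) \1_[set w' : Omega G | w' 0%N = en i] w * u (en i)).
    apply: bdd_meas_sum => i; apply: bdd_measM; last exact: bdd_meas_cst.
    by apply: bdd_meas_indic; exact: measurable_coord.
  have := @Exp_cvg _ _ _ P (fun n w => \sum_(i < n) \1_[set w' : Omega G | w' 0%N = en i] w * u (en i))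
    (fun w => u (w 0%N)) M (fun n => (bS n).1) (measurable_coordfun G_countable _ _)
    (fun n w => @walk_start_bounded _ _ en rk u w n M enK uN).
  move=> /(_ _)/=; rewrite (_ : (fun n => \int[P]_w _) = (fun n => \sum_(i < n) mu (en i) * u (en i))).
    apply; apply: aeW => w; exact: walk_start_cvg.
  apply/funext => n; rewrite Exp_sum => [|i].
    apply: eq_bigr => i _.
    under eq_Rintegral do rewrite mulrC.
    rewrite ExpZ; last by apply: bdd_meas_indic; exact: measurable_coord.
    rewrite Exp_indic; last exact: measurable_coord.
    by rewrite (walk_start P_law) mulrC.
  apply: bdd_measM; last exact: bdd_meas_cst.
  by apply: bdd_meas_indic; exact: measurable_coord.
apply/cvg_lim => //.
rewrite (_ : (fun n => _) = EFin \o (fun n => \sum_(i < n) mu (en i) * u (en i))).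
  exact: cvg_comp cvg1 _.
by apply/funext => n /=; rewrite sumEFin big_mkord; congr (_%:E).
Qed.

Section Action.
Context d (X : measurableType d) (a : G -> X -> X) (nu : probability X R)
  (a_meas : measurable_action a) (nu_stat : stationary mu a nu).

Lemma measurable_act_preimage g A : measurable A -> measurable (a g @^-1` A).
Proof. by move=> mA; rewrite -[_ @^-1` _]setTI; exact: a_meas.2. Qed.

Lemma stationary_walk A : measurable A ->
  fine (nu A) = \int[P]_w fine (nu (a (w 0%N) @^-1` A)).
Proof.
move=> mA; apply: EFin_inj; rewrite -(@walk_start_esum (fun g => fine (nu (a g @^-1` A))) 1).
  rewrite fineK ?fin_num_measure// nu_stat//; apply: eq_esum => g _.
  by rewrite fineK ?fin_num_measure//; exact: measurable_act_preimage.
move=> g; have mg := measurable_act_preimage g mA.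
by rewrite -!lee_fin fineK ?fin_num_measure// measure_ge0/= probability_le1.
Qed.

Lemma stationary_exp F : bdd_meas F ->
  \int[nu]_x F x = \int[P]_w \int[nu]_x F (a (w 0%N) x).
Proof.
move=> bF.
have ba f g : bdd_meas f -> bdd_meas (fun x => f (a g x) : R).
  by move=> bf; apply: bdd_meas_comp => //; exact: a_meas.2.
have bw f : bdd_meas f -> bdd_meas (fun w : Omega G => \int[nu]_x f (a (w 0%N) x) : R).
  move=> bf; have [_ [M fM]] := bf; split.
    exact: (measurable_coordfun G_countable _ (fun g => \int[nu]_x f (a g x))).
  by exists M => w; apply: normr_Exp_le => //; exact: ba.
pose L f : R := \int[nu]_x f x - \int[P]_w \int[nu]_x f (a (w 0%N) x).
suff : L F = 0 by move/eqP; rewrite subr_eq0 => /eqP.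
apply: (@linear_ext _ _ _ L 2) => //.
- move=> f g bf bg; rewrite /L ExpD//.
  under [X in _ - X]eq_Rintegral => w _ do rewrite (ExpD nu (ba _ _ bf) (ba _ _ bg)).
  by rewrite (ExpD P (bw _ bf) (bw _ bg)) opprD addrACA.
- move=> c f bf; rewrite /L ExpZ//.
  under [X in _ - X]eq_Rintegral => w _ do rewrite (ExpZ nu _ (ba _ _ bf)).
  by rewrite (ExpZ P _ (bw _ bf)) mulrBr.
- move=> f K bf fK; rewrite /L (le_trans (ler_normB _ _))// mulr_natl mulr2n lerD//.
    exact: normr_Exp_le.
  by apply: normr_Exp_le => [|w]; [exact: bw|apply: normr_Exp_le => //; exact: ba].
- move=> C mC; have mFC : measurable (F @^-1` C).
    by rewrite -[_ @^-1` _]setTI; exact: bF.1.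
  rewrite /L Exp_indic// stationary_walk//; apply/eqP; rewrite subr_eq0; apply/eqP.
  apply: eq_Rintegral => w _.
  by rewrite -(@Exp_indic _ _ _ nu (a (w 0%N) @^-1` (F @^-1` C)))//; exact: measurable_act_preimage.
Qed.

(** By essential freeness an atom [x0] has trivial stabiliser, so the masses [v g] of the points
    [g^-1 x0] add up to at most 1 and [v] attains its maximum. It is harmonic by stationarity, hence
    constant by the maximum principle, and a positive constant has infinite sum over [G]. The
    inverse in [v] matches steps multiplied on the right. *)
Lemma nonatomic (mu_gen : supp_generates_semigroup mu) (a_free : essentially_free a nu) :
  (forall x : X, measurable [set x]) -> forall x, nu [set x] = 0%E.
Proof.
move=> m1 x0; have [a1 aM] := a_meas.1.
apply/eqP; apply/contraT => n0.
pose v g := fine (nu [set a g^-1%g x0]).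
have v0 g : 0 <= v g by rewrite fine_ge0.
have orb_inj g h : a g x0 = a h x0 -> g = h.
  move=> gh; apply: contrapT => gneh.
  have ne2 : (h^-1 * g)%g <> 1%g.
    by move=> hg; apply: gneh; rewrite -[LHS](mulVKg h) hg mulg1.
  have [N [mN N0 fixN]] := a_free _ ne2.
  have : nu [set x0] = 0%E.
    apply/eqP; rewrite eq_le measure_ge0 andbT -N0; apply: le_measure; rewrite ?inE//.
    by move=> _ ->; apply: fixN => /=; rewrite aM gh -aM mulVg a1.
  by move=> z; rewrite z eqxx in n0.
have vsum s : uniq s -> \sum_(g <- s) v g <= 1.
  move=> us; rewrite -(Exp_cst nu 1).
  rewrite (eq_bigr (fun g => \int[nu]_x \1_[set a g^-1%g x0] x)); last first.
    by move=> g _; rewrite Exp_indic.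
  rewrite -Exp_sum; last by move=> g; exact: bdd_meas_indic.
  apply: le_Exp; [by apply: bdd_meas_sum => g; exact: bdd_meas_indic|exact: bdd_meas_cst|].
  move=> x; have [[g gs xg]|H] := pselect (exists2 g, g \in s & x = a g^-1%g x0).
    rewrite (big_rem g gs)/= big_seq big1 ?addr0 ?indicE ?lern1 ?leq_b1//.
    move=> h hs; rewrite indicE memNset// => /= xh; move: hs; rewrite mem_rem_uniq// inE.
    by rewrite (_ : h = g) ?eqxx//; apply: invg_inj; apply: orb_inj; rewrite -xh.
  rewrite big_seq big1// => g gs; rewrite indicE memNset// => /= xg.
  by apply: H; exists g.
have fin t : 0 < t -> finite_set [set g | t <= v g].
  move=> t0; apply: contrapT => /(infinite_set_fset (Num.truncn t^-1).+1)[S' SA].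
  have := finmap.fset_uniq S'; move: SA; rewrite /mkset; set S := finmap.enum_fset S' => SA uS Sn.
  have := vsum _ uS; apply/negP; rewrite -ltNge.
  apply: (@lt_le_trans _ _ (\sum_(g <- S) t)).
    rewrite big_const_seq count_predT iter_addr addr0 -mulr_natl -ltr_pdivrMr// mul1r.
    by apply: lt_le_trans (truncnS_gt _) _; rewrite ler_nat.
  by rewrite big_seq [leRHS]big_seq; apply: ler_sum => g; exact: SA.
have v1 : 0 < v 1%g.
  rewrite lt_neqAle v0 andbT eq_sym; apply: contra n0 => /eqP; rewrite /v invg1 a1 => z.
  by rewrite -[nu _]fineK ?fin_num_measure// z.
have [s sE] := (finite_seqP _).1 (fin _ v1).
have [g [vg vmax]] : exists g, v 1%g <= v g /\ forall h, v h <= v g.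
  have s1 : 1%g \in s by have : [set` s] 1%g by rewrite -sE /=.
  have [[g gs] _ gmax] := @Order.TotalTheory.arg_maxP _ R (seq_sub s) (SeqSub s1) xpredT (fun i => v (ssval i)) isT.
  exists g; split; first exact: (gmax (SeqSub s1)).
  move=> h; have [h1|/ltW h1] := leP (v 1%g) (v h); last by rewrite (le_trans h1)//; exact: (gmax (SeqSub s1)).
  have hs : h \in s by have : [set` s] h by rewrite -sE.
  exact: (gmax (SeqSub hs)).
have bv x : bdd_meas (fun w : Omega G => v (x * w 0%N)%g).
  split; first exact: (measurable_coordfun G_countable _ (fun h => v (x * h)%g)).
  by exists (v g) => w; rewrite ger0_norm.
have harm x : v x = \int[P]_w v (x * w 0%N)%g.
  rewrite {1}/v stationary_walk//; apply: eq_Rintegral => w _; congr (fine (nu _)).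
  apply/seteqP; split => y /= yx.
    by rewrite invgM aM -yx -aM mulVg a1.
  by rewrite yx invgM aM -aM mulgV a1.
have step x h : v x = v g -> 0 < mu h -> v (x * h)%g = v g.
  move=> xg h0; have b1 : bdd_meas (fun w : Omega G => v g - v (x * w 0%N)%g).
    by apply: bdd_measB => //; exact: bdd_meas_cst.
  have E0 : \int[P]_w (v g - v (x * w 0%N)%g) = 0.
    by rewrite ExpB ?Exp_cst -?harm ?xg ?subrr//; exact: bdd_meas_cst.
  have [N [mN N0 HN]] : {ae P, forall w : Omega G, v g - v (x * w 0%N)%g = 0}.
    by apply: Exp_eq0_ae => // w; rewrite subr_ge0.
  have [[w [/= wh Nw]]|H] := pselect (exists w : Omega G, w 0%N = h /\ ~ N w).
    have : v g - v (x * w 0%N)%g = 0 by apply: contrapT => /HN.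
    by rewrite wh => /eqP; rewrite subr_eq0 => /eqP.
  have : P [set w : Omega G | w 0%N = h] = 0%E.
    apply/eqP; rewrite eq_le measure_ge0 andbT -N0; apply: le_measure; rewrite ?inE//.
      exact: measurable_coord.
    by move=> w wh; apply: contrapT => Nw; apply: H; exists w.
  by rewrite (walk_start P_law) => h00; move: h0; rewrite (EFin_inj h00) ltxx.
have all x : v x = v g.
  have [l [_ [lmu E]]] := mu_gen (g^-1 * x)%g.
  have -> : x = (g * (foldr (fun h acc => (h * acc)%g) 1%g l))%g by rewrite -E mulVKg.
  elim/last_ind: l lmu {E} => [|l h IH] lmu /=; first by rewrite mulg1.
  have FR l' : foldr (fun h acc => (h * acc)%g) 1%g (rcons l' h) =
               (foldr (fun h acc => (h * acc)%g) 1%g l' * h)%g.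
    by elim: l' => [|k l' IH'] /=; rewrite ?mulg1 ?mul1g// IH' mulgA.
  rewrite FR mulgA; apply: step.
    by apply: IH => k kl; apply: lmu; rewrite mem_rcons inE kl orbT.
  by apply: lmu; rewrite mem_rcons inE eqxx.
exfalso; apply: G_infinite; apply: sub_finite_set (fin _ v1).
by move=> x _ /=; rewrite (all x).
Qed.

End Action.

End StationaryMeasures.

(** * Countable separation in standard Borel spaces *)

Lemma standard_borel_separating (R : realType) d (X : measurableType d) :
  standard_borel R X -> exists U : nat -> set X, (forall n, measurable (U n)) /\
    forall x y, (forall n, U n x <-> U n y) -> x = y.
Proof.
move=> [Q [phi [[psi phiK psiK] [hQ [[D [cD dD]] mX]]]]].
have [e eD] : exists e : nat -> Q, forall O : set Q, O !=set0 -> open O -> exists n, O (e n).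
  have x0 : [set: Q] !=set0 by exists (phi point).
  have [D0|[f]] := elimT pfcard_geP cD.
    by exfalso; have [q [_]] := dD _ x0 openT; rewrite D0.
  exists f => O O0 oO; have [q [Oq Dq]] := dD _ O0 oO.
  by have [n _ fn] := 'surj_f Dq; exists n; rewrite fn.
(* Interiors are taken because a ball need not be open here. *)
pose V (n k : nat) : set Q := (ball (e n) k.+1%:R^-1)^°.
have sep x y : (forall n k, V n k x <-> V n k y) -> x = y.
  move=> xy; apply: contrapT => /eqP ne; move: hQ; rewrite ball_hausdorff => /(_ x y ne)[[r s] /=].
  move=> /eqP rs0.
  have [k kr] : exists k : nat, 0 + k.+1%:R^-1 < Num.min r%:num s%:num / 2.
    by apply: ltr_add_invr; rewrite divr_gt0// lt_min !gt0.
  set t : R := k.+1%:R^-1 in kr; have t0 : 0 < t by rewrite invr_gt0.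
  have [n xn] : exists n, (ball x (t / 2))^° (e n).
    apply: eD; last exact: open_interior.
    by exists x; apply: nbhsx_ballx; rewrite divr_gt0.
  have bx : ball (e n) (t / 2) x by apply: ball_sym; exact: interior_subset xn.
  have Vx : V n k x.
    apply: filterS (nbhsx_ballx x (t / 2) _); last by rewrite divr_gt0.
    by move=> z xz; rewrite -/t [t]splitr; exact: ball_triangle bx xz.
  have /interior_subset by_ := (xy n k).1 Vx.
  suff : set0 y by [].
  rewrite -rs0; split; last exact: ballxx.
  have : ball x (t + t) y.
    apply: ball_triangle by_; apply: ball_sym; apply: le_ball bx.
    by rewrite ler_pdivrMr// ler_pMr// ler1n.
  apply: le_ball; move: kr; rewrite add0r ltr_pdivlMr// lt_min => /andP[/ltW + _].
  by rewrite mulr_natr mulr2n.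
exists (fun n => let: (i, k) := if @unpickle (nat * nat)%type n is Some p then p else (0%N, 0%N) in
                 phi @^-1` V i k); split.
  move=> n; case: (if _ is Some _ then _ else _) => i k; apply/mX.
  rewrite (_ : _ @` _ = V i k); first by apply: sub_sigma_algebra; exact: open_interior.
  by apply/seteqP; split => [_ [x Vx <-]//|q Vq]; exists (psi q) => //=; rewrite psiK.
move=> x y xy; rewrite -(phiK x) -(phiK y); congr psi; apply: sep => n k.
by have := xy (pickle (n, k)); rewrite pickleK.
Qed.

Lemma separated_singleton d (X : measurableType d) (U : nat -> set X) :
  (forall n, @measurable d X (U n)) -> (forall x y, (forall n, U n x <-> U n y) -> x = y) ->
  forall x, @measurable d X [set x].
Proof.
move=> mU sep x.
rewrite (_ : [set x] = \bigcap_n [set y | U n y <-> U n x]).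
  apply: bigcap_measurable => // n _; have [Ux|nUx] := pselect (U n x).
    by rewrite (_ : mkset _ = U n)//; apply/seteqP; split => y /=; [case=> _; apply|].
  rewrite (_ : mkset _ = ~` U n); first exact: measurableC.
  by apply/seteqP; split => y /=; [move=> yx Uy; apply: nUx; apply/yx|move=> nUy; split].
apply/seteqP; split => [_ -> n _ //|y /= H]; apply: sep => n; exact: H.
Qed.

(** * A fixed colouring in place of random labels *)

Section Derandomisation.
Context (R : realType) d (B : measurableType d) (nu : probability B R).
Context (U : nat -> set B) (mU : forall n, @measurable d B (U n))
  (sepU : forall x y, (forall n, U n x <-> U n y) -> x = y).

(** The cell of [b] in the partition generated by the first [n] separating sets; distinct points lie
    in distinct cells from some [n] on. *)
Definition code n (b : B) : {ffun 'I_n -> bool} := [ffun i => `[< U (val i) b >]].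

Lemma fin_meas_code n : fin_meas (code n).
Proof. by apply: fin_meas_ffun => i; exact: fin_meas_bool. Qed.

Lemma code_separates x y : x <> y -> \forall n \near \oo, code n x != code n y.
Proof.
move=> xy; have [m Um] : exists m, ~ (U m x <-> U m y).
  by apply: contrapT => H; apply: xy; apply: sepU => n; apply: contrapT => Hn; apply: H; exists n.
exists m.+1 => // n /= mn; apply/eqP => /ffunP/(_ (Ordinal mn)); rewrite !ffunE /= => E.
by apply: Um; rewrite -[U m x]asboolE E asboolE.
Qed.

Lemma fin_meas_code_comp n (s : B -> B) : measurable_fun setT s ->
  fin_meas (fun b => code n (s b)).
Proof. by move=> ms; apply: fin_meas_precomp => //; exact: fin_meas_code. Qed.

Lemma bdd_collide n (s1 s2 : B -> B) : measurable_fun setT s1 -> measurable_fun setT s2 ->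
  bdd_meas (fun b => (code n (s1 b) == code n (s2 b))%:R : R).
Proof.
move=> m1 m2; apply: (fin_bdd (D := fun b => (code n (s1 b), code n (s2 b)))
  (fun c => (c.1 == c.2)%:R)).
by apply: fin_meas_pair; exact: fin_meas_code_comp.
Qed.

Lemma collide_cvg (s1 s2 : B -> B) : measurable_fun setT s1 -> measurable_fun setT s2 ->
  nu.-negligible [set b | s1 b = s2 b] ->
  (fun n => \int[nu]_b (code n (s1 b) == code n (s2 b))%:R) @ \oo --> (0 : R).
Proof.
move=> m1 m2 neg; rewrite -[X in _ --> X](Exp_cst nu 0).
apply: (@Exp_cvg _ _ _ nu _ _ 1) => //.
- by move=> n; have [] := bdd_collide n m1 m2.
- by move=> n b; case: eqP; rewrite ?normr1 ?normr0.
- apply: (negligibleS _ neg) => b /= nb; apply: contrapT => ne; apply: nb.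
  apply: cvg_near_cst; near=> n; have /negbTE -> // : code n (s1 b) != code n (s2 b).
  by near: n; exact: code_separates.
Unshelve. all: by end_near. Qed.

Lemma bdd_collide2 n (s1 s2 : B -> B) : measurable_fun setT s1 -> measurable_fun setT s2 ->
  bdd_meas (fun b => \int[nu]_b' (code n (s1 b) == code n (s2 b'))%:R).
Proof.
move=> m1 m2; apply: (fin_bdd (D := fun b => code n (s1 b)) (fun c => \int[nu]_b' (c == code n (s2 b'))%:R)).
exact: fin_meas_code_comp.
Qed.

Lemma collide2_cvg (s1 s2 : B -> B) : measurable_fun setT s1 -> measurable_fun setT s2 ->
  (forall x, nu.-negligible [set b | s2 b = x]) ->
  (fun n => \int[nu]_b \int[nu]_b' (code n (s1 b) == code n (s2 b'))%:R) @ \oo --> (0 : R).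
Proof.
move=> m1 m2 neg; rewrite -[X in _ --> X](Exp_cst nu 0).
apply: (@Exp_cvg _ _ _ nu _ _ 1) => //.
- by move=> n; have [] := bdd_collide2 n m1 m2.
- move=> n b; apply: normr_Exp_le => [|b']; last by case: eqP; rewrite ?normr1 ?normr0.
  by apply: (bdd_collide n (s1 := fun=> s1 b)).
- apply: aeW => b; apply: (collide_cvg (s1 := fun=> s1 b)) => //.
  by apply: negligibleS (neg (s1 b)) => b' /= ->.
Qed.

Context (J T Z I : finType) (om : Z -> R) (om0 : forall v, 0 <= om v) (om1 : \sum_v om v = 1)
  (t : J -> B -> B) (t_meas : forall j, measurable_fun setT (t j))
  (t_free : forall j j', j != j' -> nu.-negligible [set b | t j b = t j' b])
  (t_nonatomic : forall j x, nu.-negligible [set b | t j b = x])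
  (Psi : I -> B -> {ffun J * T -> Z} -> R)
  (Psi_meas : forall i z, measurable_fun setT (Psi i ^~ z))
  (Psi_le1 : forall i b z, `|Psi i b z| <= 1).

Let colouring n := {ffun {ffun 'I_n -> bool} * T -> Z}.
Let idx n (b : B) (s : J * T) := (code n (t s.1 b), s.2).
Let Psibar i b := \sum_z pweight om z * Psi i b z.
Let Y n i (C : colouring n) b := Psi i b [ffun s => C (idx n b s)] - Psibar i b.

Lemma pweight_ge0 (S : finType) (z : {ffun S -> Z}) : 0 <= pweight om z.
Proof. by apply: prodr_ge0 => s _. Qed.

Let bPsi i z : bdd_meas (Psi i ^~ z).
Proof. by split => //; exists 1. Qed.

Let bPsibar i : bdd_meas (Psibar i).
Proof. by apply: bdd_meas_sum => z; exact: bdd_measZ. Qed.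

Let Psibar_le1 i b : `|Psibar i b| <= 1.
Proof.
rewrite (le_trans (ler_norm_sum _ _ _))// -[leRHS](pweight_sum1 om1 (J * T)%type).
by apply: ler_sum => z _; rewrite normrM (ger0_norm (pweight_ge0 _)) ler_piMr// pweight_ge0.
Qed.

Let fin_meas_z n (C : colouring n) : fin_meas (fun b => [ffun s => C (idx n b s)] : {ffun J * T -> Z}).
Proof.
apply: fin_meas_ffun => s; apply: (fin_meas_comp (D := fun b => code n (t s.1 b)) (fun c => C (c, s.2))).
exact: fin_meas_code_comp.
Qed.

Let bY n i (C : colouring n) : bdd_meas (Y i C).
Proof.
apply: bdd_measB => //.
exact: (fin_bdd_meas (F := fun z b => Psi i b z) (fin_meas_z C)).
Qed.

Let Y_le2 n i (C : colouring n) b : `|Y i C b| <= 2.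
Proof. by rewrite (le_trans (ler_normB _ _))// (_ : 2 = 1 + 1)// lerD. Qed.

Let bad1 n b := \sum_(p : J * J) (p.1 != p.2)%:R * (code n (t p.1 b) == code n (t p.2 b))%:R : R.
Let bad2 n b b' := \sum_(p : J * J) (code n (t p.1 b) == code n (t p.2 b'))%:R : R.

Let bad1_0 n b : bad1 n b < 1 -> injective (idx n b).
Proof.
move=> b1 [j s] [j' s'] [/= cE ->]; congr (_, _); apply/eqP; apply/contraT => ne.
move: b1; rewrite ltNge /bad1 (bigD1 (j, j'))//= cE eqxx ne mulr1 lerDl.
by rewrite sumr_ge0// => p _; rewrite mulr_ge0.
Qed.

Let bad2_0 n b b' : bad2 n b b' < 1 -> forall s s', idx n b s != idx n b' s'.
Proof.
move=> b1 [j s] [j' s']; apply/eqP => -[/= cE ss].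
move: b1; rewrite ltNge /bad2 (bigD1 (j, j'))//= cE eqxx lerDl.
by rewrite sumr_ge0.
Qed.

(* Colouring the cells of the partition [code n] independently at random, the
   labels read at [b] and at [b'] are independent families of independent
   labels, unless one of the coincidences counted by [bad1] and [bad2] occurs. *)
Let second_moment n i b b' :
  \sum_(C : colouring n) pweight om C * (Y i C b * Y i C b') <=
  4 * (bad1 n b + bad1 n b' + bad2 n b b').
Proof.
have b1 x : 0 <= bad1 n x by apply: sumr_ge0 => p _; rewrite mulr_ge0.
have b2 : 0 <= bad2 n b b' by apply: sumr_ge0.
(* The [bad] terms count coincidences, so a total below 1 means that there is none and the
   covariance vanishes. Otherwise the right side is at least 4, while each [|Y|] is at most 2. *)
have [small|large] := ltP (bad1 n b + bad1 n b' + bad2 n b b') 1; last first.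
  apply: (@le_trans _ _ 4); last by rewrite ler_peMr.
  rewrite -[leRHS]mulr1 -[X in _ * X](pweight_sum1 om1 ({ffun 'I_n -> bool} * T)%type) mulr_sumr.
  apply: ler_sum => C _; rewrite mulrC ler_wpM2r ?pweight_ge0//.
  rewrite (le_trans (ler_norm _))// normrM (_ : 4 = 2 * 2 :> R); last by ring.
  by rewrite ler_pM.
rewrite (_ : \sum_C _ = 0); first by rewrite mulr_ge0// !addr_ge0.
have := b1 b; have := b1 b' => b1' b1''.
have h1 : bad1 n b < 1 by lra.
have h2 : bad1 n b' < 1 by lra.
have h3 : bad2 n b b' < 1 by lra.
rewrite (pweight_indep om1 (fun z => Psi i b z - Psibar i b) (fun z => Psi i b' z - Psibar i b')
  (bad1_0 h1) (bad1_0 h2) (bad2_0 h3)).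
rewrite [X in X * _](_ : _ = 0) ?mul0r//.
under eq_bigr do rewrite mulrBr.
by rewrite sumrB -mulr_suml pweight_sum1// mul1r subrr.
Qed.

Let bbad1 n : bdd_meas (bad1 n).
Proof. by apply: bdd_meas_sum => p; apply: bdd_measZ; exact: bdd_collide. Qed.

Let err n := 4 * (2 * \int[nu]_b bad1 n b + \int[nu]_b \int[nu]_b' bad2 n b b').

Let Exp_bad2 n b : \int[nu]_b' bad2 n b b' =
  \sum_(p : J * J) \int[nu]_b' (code n (t p.1 b) == code n (t p.2 b'))%:R.
Proof. by rewrite Exp_sum// => p; exact: (bdd_collide n (s1 := fun=> t p.1 b)). Qed.

Let bbad2 n : bdd_meas (fun b => \int[nu]_b' bad2 n b b').
Proof.
by under eq_fun do rewrite Exp_bad2; apply: bdd_meas_sum => p; exact: bdd_collide2.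
Qed.

Let err_cvg : err @ \oo --> (0 : R).
Proof.
rewrite (_ : 0 = 4 * (2 * \sum_(p : J * J) 0 + \sum_(p : J * J) 0) :> R); last by rewrite big1//; ring.
apply: cvgMr; apply: cvgD; [apply: cvgMr|].
  rewrite (_ : (fun n => _) = fun n => \sum_(p : J * J)
    (p.1 != p.2)%:R * \int[nu]_b (code n (t p.1 b) == code n (t p.2 b))%:R).
    apply: cvg_sumr => p; have [->|ne] := eqVneq p.1 p.2.
      by under eq_fun do rewrite mul0r; exact: cvg_cst.
    by under eq_fun do rewrite mul1r; apply: collide_cvg => //; exact: t_free.
  apply/funext => n; rewrite Exp_sum => [|p]; last by apply: bdd_measZ; exact: bdd_collide.
  by apply: eq_bigr => p _; rewrite ExpZ//; exact: bdd_collide.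
rewrite (_ : (fun n => _) = fun n => \sum_(p : J * J)
    \int[nu]_b \int[nu]_b' (code n (t p.1 b) == code n (t p.2 b'))%:R).
  by apply: cvg_sumr => p; exact: collide2_cvg.
apply/funext => n; under eq_Rintegral do rewrite Exp_bad2.
by rewrite Exp_sum// => p; exact: bdd_collide2.
Qed.

Let mean_square n i : \sum_(C : colouring n) pweight om C * (\int[nu]_b Y i C b) ^+ 2 <= err n.
Proof.
have bYY b (C : colouring n) : bdd_meas (fun b' => Y i C b * Y i C b') by exact: bdd_measZ.
have bS b : bdd_meas (fun b' => \sum_(C : colouring n) pweight om C * (Y i C b * Y i C b')).
  by apply: bdd_meas_sum => C; exact: bdd_measZ.
have inner b : \int[nu]_b' \sum_(C : colouring n) pweight om C * (Y i C b * Y i C b') =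
    \sum_(C : colouring n) pweight om C * (Y i C b * \int[nu]_b' Y i C b').
  rewrite Exp_sum => [|C]; last exact: bdd_measZ.
  by apply: eq_bigr => C _; rewrite ExpZ// ExpZ.
have bYc (C : colouring n) : bdd_meas (fun b => Y i C b * \int[nu]_b' Y i C b').
  by apply: bdd_measM => //; exact: bdd_meas_cst.
(* The square of an integral is a double integral, so [second_moment] can be applied under both
   integrals. *)
rewrite (_ : \sum_C _ = \int[nu]_b \int[nu]_b' \sum_(C : colouring n) pweight om C * (Y i C b * Y i C b')); last first.
  under [RHS]eq_Rintegral do rewrite inner.
  rewrite Exp_sum => [|C]; last exact: bdd_measZ.
  apply: eq_bigr => C _; rewrite ExpZ//; congr (_ * _).
  by under [RHS]eq_Rintegral do rewrite mulrC; rewrite ExpZ// expr2.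
have b2 b : bdd_meas (bad2 n b).
  by apply: bdd_meas_sum => p; exact: (bdd_collide n (s1 := fun=> t p.1 b)).
have b12 b : bdd_meas (fun b' => bad1 n b + bad1 n b') by apply: bdd_measD => //; exact: bdd_meas_cst.
have bT b : bdd_meas (fun b' => 4 * (bad1 n b + bad1 n b' + bad2 n b b')).
  by apply: bdd_measZ; exact: bdd_measD.
have ET b : \int[nu]_b' (4 * (bad1 n b + bad1 n b' + bad2 n b b')) =
    4 * (bad1 n b + \int[nu]_b' bad1 n b' + \int[nu]_b' bad2 n b b').
  by rewrite ExpZ ?ExpD ?Exp_cst//; [exact: bdd_meas_cst|exact: bdd_measD].
have bc : bdd_meas (fun b => bad1 n b + \int[nu]_b' bad1 n b') by apply: bdd_measD => //; exact: bdd_meas_cst.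
apply: (@le_trans _ _ (\int[nu]_b (4 * (bad1 n b + \int[nu]_b' bad1 n b' + \int[nu]_b' bad2 n b b')))).
  apply: le_Exp => [||b].
  - by under eq_fun do rewrite inner; apply: bdd_meas_sum => C; exact: bdd_measZ.
  - by apply: bdd_measZ; exact: bdd_measD.
  - by rewrite -ET; apply: le_Exp => // b'; exact: second_moment.
rewrite ExpZ; last exact: bdd_measD.
rewrite (ExpD nu bc (bbad2 n)) ExpD ?Exp_cst// /err; last exact: bdd_meas_cst.
by rewrite [2 * _]mulr_natl mulr2n.
Qed.

(** The squared deviations, averaged over all colourings and summed over the finitely many
    statistics [i], tend to 0 as the partition is refined; hence one colouring serves all [i] at
    once. *)
Lemma derandomize (e : R) : 0 < e -> exists c : T -> B -> Z, (forall s, fin_meas (c s)) /\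
  forall i, `|\int[nu]_b Psi i b [ffun s => c s.2 (t s.1 b)] - \int[nu]_b \sum_z pweight om z * Psi i b z| < e.
Proof.
move=> e0.
have [n Hn] : exists n, #|I|%:R * err n < e ^+ 2.
  have : (fun n => #|I|%:R * err n) @ \oo --> (#|I|%:R * 0 : R) by exact: cvgMr.
  rewrite mulr0 => /cvgrPdist_lt/(_ _ (exprn_gt0 2 e0))[n _ /(_ n (leqnn n))] H.
  by exists n; move: H; rewrite /= sub0r normrN; exact: le_lt_trans (ler_norm _).
have [C HC] : exists C : {ffun {ffun 'I_n -> bool} * T -> Z}, \sum_i (\int[nu]_b Y (n := n) i C b) ^+ 2 < e ^+ 2.
  apply: contrapT => H.
  have H2 (C : colouring n) : e ^+ 2 <= \sum_i (\int[nu]_b Y i C b) ^+ 2.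
    by rewrite leNgt; apply/negP => HC; apply: H; exists C.
  move: Hn; apply/negP; rewrite -leNgt.
  apply: (@le_trans _ _ (\sum_i \sum_(C : colouring n) pweight om C * (\int[nu]_b Y i C b) ^+ 2)).
    rewrite exchange_big /= -[leLHS]mul1r -[X in X * _](pweight_sum1 om1 ({ffun 'I_n -> bool} * T)%type) mulr_suml.
    by apply: ler_sum => C _; rewrite -mulr_sumr ler_wpM2l// pweight_ge0.
  by rewrite mulr_natl -sumr_const; apply: ler_sum.
exists (fun s b => C (code n b, s)); split.
  move=> s; apply: (fin_meas_comp (fun c => C (c, s))); exact: fin_meas_code.
move=> i; rewrite -[X in _ - X]/(\int[nu]_b Psibar i b) -ExpB//; last exact: (fin_bdd_meas (F := fun z b => Psi i b z) (fin_meas_z C)).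
rewrite -(@ltr_pXn2r _ 2)// ?nnegrE ?(ltW e0)// real_normK ?num_real//.
apply: le_lt_trans HC; rewrite (bigD1 i)//= lerDl sumr_ge0// => j _; exact: sqr_ge0.
Qed.

End Derandomisation.

(** * Chances in a competition for the least priority *)

Lemma expn_succ_ge j m : (j ^ m.+1 + m.+1 * j ^ m <= j.+1 ^ m.+1)%N.
Proof.
elim: m => [|m IH]; first by rewrite !expn1 expn0 muln1 addn1.
rewrite [X in (_ <= X)%N]expnS; apply: leq_trans (leq_mul (leqnn j.+1) IH).
rewrite [in X in (_ <= X)%N]mulSn mulnDr !expnS !mulSn; lia.
Qed.

Lemma expn_succ_le j m : (j.+1 ^ m.+1 <= j ^ m.+1 + m.+1 * j.+1 ^ m)%N.
Proof.
elim: m => [|m IH]; first by rewrite !expn1 expn0 muln1 addn1.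
rewrite expnS mulSn [X in (_ <= X)%N]addnC mulSn -addnA leq_add2l.
apply: leq_trans (leq_mul (leqnn j) IH) _; rewrite mulnDr -expnS addnC leq_add2r.
by rewrite mulnCA leq_mul2l expnS leq_mul2r leqnSn !orbT.
Qed.

(** With [sum_expn_ge], the discrete form of integrating [t^m]. Divided by [L^(m+1)], the sum is the
    chance that a given one of [m + 1] entrants wins. *)
Lemma sum_expn_le L m : (m.+1 * \sum_(j < L) j ^ m <= L ^ m.+1)%N.
Proof.
elim: L => [|L IH]; first by rewrite big_ord0 muln0.
rewrite big_ord_recr/= mulnDr; apply: leq_trans (expn_succ_ge L m).
by rewrite leq_add2r.
Qed.

Lemma sum_expn_ge L m : (L ^ m.+1 <= m.+1 * (\sum_(j < L) j ^ m + L ^ m))%N.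
Proof.
elim: L => [|L IH]; first by rewrite exp0n.
apply: leq_trans (expn_succ_le L m) _; rewrite big_ord_recr/= mulnDr leq_add2r.
exact: IH.
Qed.

Section MinHash.
Context (R : realType) (L : nat) (L0 : (0 < L)%N) (X S : finType)
  (omX : X -> R) (omX1 : \sum_x omX x = 1).
Implicit Types (z : {ffun S -> 'I_L * X}) (U : {set S}) (e : S).

Definition label_weight (v : 'I_L * X) : R := L%:R^-1 * omX v.2.

Let L0R : L%:R != 0 :> R. Proof. by rewrite pnatr_eq0 -lt0n. Qed.

Lemma label_weight_sum (F : 'I_L -> X -> R) :
  \sum_v label_weight v * F v.1 v.2 = \sum_l L%:R^-1 * \sum_x omX x * F l x.
Proof.
rewrite -(pair_big xpredT xpredT (fun l x => label_weight (l, x) * F l x)) /=.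
by apply: eq_bigr => l _; rewrite mulr_sumr; apply: eq_bigr => x _; rewrite /label_weight mulrA.
Qed.

Lemma label_weight_sum1 : \sum_v label_weight v = 1.
Proof.
transitivity (\sum_(l < L) L%:R^-1 * \sum_x omX x * 1).
  by rewrite -(label_weight_sum (fun=> fun=> 1)); apply: eq_bigr => v _; rewrite mulr1.
under eq_bigr do (under eq_bigr do rewrite mulr1; rewrite omX1 mulr1).
by rewrite sumr_const card_ord -[LHS]mulr_natl divff.
Qed.

(* Least priority, ties having no winner: the winner of [U] also wins every
   subset of [U] it belongs to. *)
Definition wins z U e :=
  (e \in U) && [forall e', (e' \in U) && (e' != e) ==> ((z e).1 < (z e').1)%N].

Lemma wins_unique z U e e' : wins z U e -> wins z U e' -> e = e'.
Proof.
move=> /andP[eU /forallP H] /andP[e'U /forallP H']; apply/eqP/contraT => ne.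
have := H e'; have := H' e; rewrite eU e'U ne eq_sym ne /= => lt1 lt2.
by have := ltn_trans lt1 lt2; rewrite ltnn.
Qed.

(** The chance that a given member of a set of size [n] wins: it draws some priority [l], and each
    of the [n - 1] others draws a strictly larger one. *)
Definition win_weight n : R :=
  \sum_(l < L) L%:R^-1 * ((L - l.+1)%:R / L%:R) ^+ n.-1.

Let prod_bool (A : pred S) (b : S -> bool) :
  \prod_(s | A s) (b s)%:R = [forall s, A s ==> b s]%:R :> R.
Proof.
case: forallP => [H|H].
  by rewrite big1// => s As; have := H s; rewrite As /= => ->.
have [s As bs] : exists2 s, A s & ~~ b s.
  apply: contrapT => nH; apply: H => s; apply/implyP => As.
  by apply: contrapT => /negP bs; apply: nH; exists s.
by rewrite (bigD1 s)//= (negbTE bs) mul0r.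
Qed.

Let card_above (l : 'I_L) : \sum_(l' < L) (l < l')%:R = (L - l.+1)%:R :> R.
Proof.
rewrite -natr_sum -big_mkcond/= sum1_card; congr (_%:R).
rewrite -sum1_card -(big_mkord (fun l' => l < l')%N (fun=> 1%N)).
rewrite (big_cat_nat _ (n := l.+1))//= big_nat_cond big_pred0 ?add0n; last first.
  by move=> i; rewrite ltnS /=; case: (leqP i l).
rewrite big_nat_cond (eq_bigl (fun i => (l.+1 <= i < L)%N)); last by move=> i; case: (l < i)%N; rewrite ?andbT.
by rewrite -big_nat sum_nat_const_nat muln1.
Qed.

(** Winning depends on priorities alone, so the winner's sample still has law [omX]. Once the
    priority [l] of [e] is fixed, the event is a product over slots, given by [F]. *)
Lemma wins_sum U e (g : X -> R) : e \in U ->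
  \sum_z pweight label_weight z * ((wins z U e)%:R * g (z e).2) =
  win_weight #|U| * \sum_x omX x * g x.
Proof.
move=> eU.
pose F (l : 'I_L) s (v : 'I_L * X) : R :=
  if s == e then (v.1 == l)%:R * g v.2 else if s \in U then (l < v.1)%N%:R else 1.
have FE z : (wins z U e)%:R * g (z e).2 = \sum_l \prod_s F l s (z s).
  rewrite (bigD1 (z e).1)//= [X in _ + X]big1 ?addr0; last first.
    by move=> l ne; rewrite (bigD1 e)//= /F eqxx eq_sym (negbTE ne) !mul0r.
  rewrite (bigD1 e)//= {1}/F !eqxx mul1r mulrC; congr (_ * _).
  rewrite (bigID (mem U))/= [X in _ * X]big1 ?mulr1; last first.
    by move=> s /andP[/negbTE se /negbTE sU]; rewrite /F se sU.
  rewrite (eq_bigr (fun s => ((z e).1 < (z s).1)%N%:R)); last first.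
    by move=> s /andP[/negbTE se sU]; rewrite /F se sU.
  rewrite prod_bool /wins eU; congr (_%:R); congr (nat_of_bool _).
  by apply: eq_forallb => s; rewrite andbC.
under eq_bigr do rewrite FE mulr_sumr.
rewrite exchange_big /win_weight mulr_suml; apply: eq_bigr => l _.
rewrite pweight_sum (bigD1 e)//=.
have -> : \sum_v label_weight v * F l e v = L%:R^-1 * \sum_x omX x * g x.
  rewrite (label_weight_sum (fun l' x => F l e (l', x))) (bigD1 l)//= [X in _ + X]big1 ?addr0.
    by congr (_ * _); apply: eq_bigr => x _; rewrite /F !eqxx mul1r.
  move=> l' ne; rewrite big1 ?mulr0// => x _; by rewrite /F eqxx (negbTE ne) mul0r mulr0.
rewrite mulrAC; congr (_ * _ * _).
rewrite (bigID (mem U))/= [X in _ * X]big1 ?mulr1; last first.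
  move=> s /andP[/negbTE se /negbTE sU]; rewrite -[RHS]label_weight_sum1.
  by apply: eq_bigr => v _; rewrite /F se sU mulr1.
rewrite (eq_bigr (fun=> (L - l.+1)%:R / L%:R)); last first.
  move=> s /andP[/negbTE se sU].
  rewrite (label_weight_sum (fun l' x => F l s (l', x))).
  under eq_bigr => l' _.
    under eq_bigr do rewrite /F se sU /=.
    rewrite -mulr_suml omX1 mul1r.
    over.
  by rewrite -mulr_sumr card_above mulrC.
rewrite prodr_const; congr (_ ^+ _).
by rewrite (cardD1 e U) eU /= ; apply: eq_card => s; rewrite !inE.
Qed.

(** Without ties the chance would be exactly [1/n]; the finiteness of the set of priorities costs at
    most [1/L]. *)
Lemma win_weight_bound n : (0 < n)%N -> `|win_weight n - n%:R^-1| <= L%:R^-1.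
Proof.
case: n => // m _; set n := m.+1.
pose s := (\sum_(j < L) j ^ m)%N.
have -> : win_weight n = s%:R / L%:R ^+ n.
  rewrite /win_weight (reindex_inj rev_ord_inj)/= /s natr_sum mulr_suml.
  apply: eq_bigr => j _.
  have -> : (L - (L - j.+1).+1 = j)%N by have := ltn_ord j; lia.
  by rewrite expr_div_n natrX [in RHS]exprS invfM mulrCA.
have Ln0 : 0 < L%:R ^+ n :> R by rewrite exprn_gt0// ltr0n.
have n0 : 0 < n%:R :> R by rewrite ltr0n.
have up : n%:R * s%:R <= L%:R ^+ n :> R by rewrite -natrM -natrX ler_nat sum_expn_le.
have lo : L%:R ^+ n <= n%:R * (s%:R + L%:R ^+ m) :> R.
  by rewrite -!natrX -natrD -natrM ler_nat sum_expn_ge.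
have -> : L%:R^-1 = L%:R ^+ m / L%:R ^+ n :> R.
  by rewrite exprS invfM mulrCA divff ?mulr1// expf_neq0.
have up' : s%:R / L%:R ^+ n <= n%:R^-1 :> R.
  by rewrite ler_pdivrMr// ler_pdivlMl.
rewrite ler0_norm ?subr_le0// opprB lerBlDr -mulrDl [_ ^+ m + _]addrC.
by rewrite ler_pdivlMr// ler_pdivrMl.
Qed.

End MinHash.

Section WinAverage.
Context (R : realType) (L : nat) (L0 : (0 < L)%N) (X S : finType)
  (omX : X -> R) (omX1 : \sum_x omX x = 1) (M : nat) (M0 : (0 < M)%N).
Implicit Types (I E U : {set S}) (c : S -> R).

Lemma wins_average I U (g : S -> X -> R) : I \subset U ->
  \sum_(z : {ffun S -> 'I_L * X}) pweight (label_weight omX) z *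
     \sum_(e in I) (wins z U e)%:R * g e (z e).2 =
  win_weight R L #|U| * \sum_(e in I) \sum_x omX x * g e x.
Proof.
move=> /fintype.subsetP IU; under eq_bigr do rewrite mulr_sumr.
rewrite exchange_big mulr_sumr; apply: eq_bigr => e eI.
by rewrite (wins_sum L0 omX1 (g e))//; exact: IU.
Qed.

(** Three sources of error: ties of priorities, the deviation of the number of entrants [E] from
    [M], and the slots of [U] that are not in [I]. *)
Definition win_error I E U : R :=
  #|S|%:R / L%:R + 2 * (`|M%:R - #|E|%:R| / M%:R) + (#|U|%:R - #|I|%:R) / M%:R.

Let M0R : 0 < M%:R :> R. Proof. by rewrite ltr0n. Qed.

Section Bounds.
Context (I E U : {set S}) (IE : I \subset E) (EU : E \subset U).

Let iu : #|I|%:R <= #|E|%:R :> R. Proof. by rewrite ler_nat subset_leq_card. Qed.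
Let eu : #|E|%:R <= #|U|%:R :> R. Proof. by rewrite ler_nat subset_leq_card. Qed.

Let weight_bound : `|win_weight R L #|U| - M%:R^-1| * #|I|%:R <=
  #|S|%:R / L%:R + `|M%:R - #|E|%:R| / M%:R + (#|U|%:R - #|E|%:R) / M%:R.
Proof.
have i0 : 0 <= #|I|%:R :> R by [].
have [U0|U0] := posnP #|U|.
  have I0 : #|I| = 0%N by apply/eqP; rewrite -leqn0 -U0 subset_leq_card// (fintype.subset_trans IE).
  by rewrite I0 mulr0 !addr_ge0// divr_ge0// subr_ge0.
have u0 : 0 < #|U|%:R :> R by rewrite ltr0n.
have := win_weight_bound R L0 U0; set w := win_weight _ _ _ => wb.
have iS : #|I|%:R <= #|S|%:R :> R by rewrite ler_nat max_card.
apply: (@le_trans _ _ ((L%:R^-1 + `|#|U|%:R^-1 - M%:R^-1|) * #|I|%:R)).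
  rewrite ler_wpM2r// (_ : w - _ = (w - #|U|%:R^-1) + (#|U|%:R^-1 - M%:R^-1)); last by rewrite addrA subrK.
  by rewrite (le_trans (ler_normD _ _))// lerD2r.
rewrite mulrDl -addrA; apply: lerD; first by rewrite mulrC ler_wpM2r// invr_ge0.
have -> : #|U|%:R^-1 - M%:R^-1 = (M%:R - #|U|%:R) / (#|U|%:R * M%:R) :> R.
  by field; rewrite ?gt_eqF.
rewrite normrM normfV (ger0_norm (mulr_ge0 (ltW u0) (ltW M0R))) invfM mulrA mulrAC -mulrDl.
rewrite ler_wpM2r ?invr_ge0 ?ler0n// mulrAC ler_pdivrMr//.
apply: ler_pM => //; last by rewrite (le_trans iu).
rewrite (_ : M%:R - #|U|%:R = (M%:R - #|E|%:R) - (#|U|%:R - #|E|%:R)); last by ring.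
by rewrite (le_trans (ler_normB _ _))// lerD2l ger0_norm// subr_ge0.
Qed.

Lemma win_error_sum c : (forall e, `|c e| <= 1) ->
  `|win_weight R L #|U| * \sum_(e in I) c e - M%:R^-1 * \sum_(e in E) c e| <=
  win_error I E U.
Proof.
move=> c1.
have -> : \sum_(e in E) c e = \sum_(e in I) c e + \sum_(e in E :\: I) c e.
  by rewrite (big_setID I)/= (finset.setIidPr IE).
rewrite mulrDr opprD addrA -mulrBl (le_trans (ler_normB _ _))//.
have sumI (A : {set S}) : `|\sum_(e in A) c e| <= #|A|%:R.
  by rewrite (le_trans (ler_norm_sum _ _ _))// -sumr_const ler_sum.
have EI : #|E :\: I|%:R = #|E|%:R - #|I|%:R :> R.
  by rewrite cardsD (finset.setIidPr IE) natrB// subset_leq_card.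
apply: (@le_trans _ _ (`|win_weight R L #|U| - M%:R^-1| * #|I|%:R + M%:R^-1 * (#|E|%:R - #|I|%:R))).
  rewrite !normrM; apply: lerD; first by rewrite ler_wpM2l.
  by rewrite normfV (ger0_norm (ltW M0R)) -EI ler_wpM2l// invr_ge0 ltW.
rewrite [M%:R^-1 * _]mulrC; apply: (le_trans (lerD weight_bound (lexx _))).
rewrite /win_error -!addrA lerD2l -!mulrDl (_ : #|U|%:R - _ + _ = #|U|%:R - #|I|%:R); last by ring.
by rewrite mulrDl mulrA -mulrDl addrA -mulrDl -addrA ler_wpM2r ?invr_ge0 ?ler0n// lerD2r ler_peMl// ler1n.
Qed.

(** The left side is the chance that the competition in [U] is not won by a slot of [I]. *)
Lemma win_error_fail : 1 - win_weight R L #|U| * #|I|%:R <= win_error I E U.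
Proof.
have := weight_bound.
have H := ler_norm (M%:R^-1 * #|I|%:R - win_weight R L #|U| * #|I|%:R).
rewrite -mulrBl normrM (ger0_norm (ler0n _ _)) distrC in H.
have ME : (M%:R - #|E|%:R) / M%:R <= `|M%:R - #|E|%:R| / M%:R :> R.
  by rewrite ler_wpM2r ?invr_ge0 ?ler0n// ler_norm.
have one : (M%:R - #|E|%:R) / M%:R = 1 - #|E|%:R / M%:R :> R by rewrite mulrBl divff// gt_eqF.
have mulC : M%:R^-1 * #|I|%:R = #|I|%:R / M%:R :> R by rewrite mulrC.
rewrite mulrBl mulC in H; rewrite /win_error; rewrite one in ME.
rewrite !(mulrBl _ #|U|%:R); lra.
Qed.

End Bounds.

End WinAverage.

(** * Configurations *)

Lemma ultra_fmap (S T : Type) (h : S -> T) (V : set_system S) : UltraFilter V -> UltraFilter (h @ V).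
Proof.
move=> UV; have PV : ProperFilter V by exact: ultra_proper.
apply: Build_UltraFilter => H PH hVH; apply/seteqP; split => A; last exact: hVH.
move=> HA; have [//|nVA] := in_ultra_setVsetC (h @^-1` A) UV; exfalso.
apply: (@filter_not_empty _ H); rewrite -(setICr A); apply: filterI => //.
exact: hVH.
Qed.

Lemma ptws_cvgP (T : choiceType) (V : topologicalType) (F : set_system (T -> V)) (f : T -> V) :
  Filter F -> {ptws, F --> f} <-> forall t, (fun g => g t) @ F --> f t.
Proof.
move=> FF; rewrite cvg_sup; split.
  move=> + i => /(_ i); rewrite cvg_image; last by rewrite eqEsubset; split=> v // _; exists (cst v).
  apply: cvg_trans => Y /=; rewrite ?nbhs_simpl /fmap /= => [[Y' + <-]].
  by apply: filterS => g W'g /=; exists g.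
move=> + i => /(_ i) H; rewrite cvg_image; last by rewrite eqEsubset; split=> v // _; exists (cst v).
move=> Y /=; rewrite ?nbhs_simpl => /H Q'; exists (@^~ i @^-1` Y) => //.
by rewrite eqEsubset; split => [j [? + <-//]|j Wj]; exists (fun _ => j).
Qed.

Section ProductSpace.
Context (R : realType) (G : groupType) (W : pseudoPMetricType R)
  (W_compact : compact [set: W]) (en : nat -> G) (rk : G -> nat)
  (rkK : cancel rk en).

Definition agree_upto n (x y : WG G W) := forall i : nat, (i < n)%N -> y (en i) = x (en i).

Lemma nbhs_agree (x : WG G W) (O : set (WG G W)) : nbhs x O ->
  exists n, agree_upto n x `<=` O.
Proof.
move=> xO; pose F := filter_from setT (fun n => agree_upto n x).
have FF : Filter F.
  apply: filter_from_filter; first by exists 0%N.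
  move=> i j _ _; exists (maxn i j) => // y xy; split => k kl; apply: xy.
    by rewrite leq_max kl.
  by rewrite leq_max kl orbT.
have [n _ nO] : F O; last by exists n.
have : F `=>` nbhs x.
  apply/ptws_cvgP => t V xV; exists (rk t).+1 => // y xy.
  by move: xV => /nbhs_singleton; rewrite /mkset /= -[t]rkK xy.
exact.
Qed.

Lemma compact_WG : compact [set: WG G W].
Proof.
have := @tychonoff G (fun=> W) (fun=> setT) (fun=> W_compact).
by rewrite (_ : [set f | _] = setT)//; apply/seteqP; split.
Qed.

(** By compactness [f] nearly depends on finitely many letters. Otherwise there are pairs that agree
    on ever more letters and have distant values; along an ultrafilter both members converge to the
    same point, against continuity. *)
Lemma continuous_agree (f : WG G W -> R) (e : R) : continuous (f : WG G W -> R^o) -> 0 < e ->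
  exists n, forall x y, agree_upto n x y -> `|f x - f y| < e.
Proof.
move=> cf e0; apply: contrapT => H.
have /choice[x /choice[y xy]] : forall n, exists x y, agree_upto n x y /\ e <= `|f x - f y|.
  move=> n; apply: contrapT => Hn; apply: H; exists n => x y xy.
  by rewrite ltNge; apply/negP => exy; apply: Hn; exists x, y.
have [V [UV oV]] := ultraFilterLemma (@eventually_filter).
have PV : ProperFilter V by exact: ultra_proper.
have [p [_ /= xp]] : [set: WG G W] `&` [set p | x @ V --> p] !=set0.
  by have := compact_WG; rewrite compact_ultra => /(_ (x @ V) (ultra_fmap x UV) filterT).
have yp : y @ V --> p.
  apply/ptws_cvgP => t Q Qt.
  have xpt : V [set n | Q (x n t)] by exact: ((ptws_cvgP p (fmap_filter x _)).1 xp t Q Qt).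
  have : V [set n | (rk t < n)%N] by apply: oV; exact: nbhs_infty_gt.
  move=> Vt; suff : V [set n | Q (y n t)] by [].
  apply: filterS (filterI xpt Vt) => n [/= xQ tn].
  by move: ((xy n).1 _ tn); rewrite rkK /= => ->.
have fx : f (x n) @[n --> V] --> f p := cvg_comp _ _ xp (cf p).
have fy : f (y n) @[n --> V] --> f p := cvg_comp _ _ yp (cf p).
have d0 : `|f (x n) - f (y n)| @[n --> V] --> (0 : R).
  rewrite (_ : 0 = `|f p - f p|); last by rewrite subrr normr0.
  by apply: cvg_norm; exact: cvgB.
have /cvgrPdist_lt/(_ e e0)/filter_ex[n] := d0.
by rewrite /= sub0r normrN normr_id ltNge (xy n).2.
Qed.

Lemma continuous_bounded (f : WG G W -> R) : continuous (f : WG G W -> R^o) ->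
  exists M : R, forall x, `|f x| <= M.
Proof.
move=> cf.
have /compact_bounded[M [_ HM]] : compact ((f : WG G W -> R^o) @` setT).
  by apply: continuous_compact compact_WG; exact: continuous_subspaceT.
exists (M + 1) => x; apply: HM; first by rewrite ltrDl.
by exists x.
Qed.

Lemma measurable_continuous_WGB (f : WGB G W -> R) : continuous (f : WG G W -> R^o) ->
  measurable_fun setT f.
Proof.
move=> cf; apply: (measurability _ (RGenOpens.measurableE R)) => _ [_ [a [b ->]] <-].
rewrite setTI; apply: sub_sigma_algebra.
by move/continuousP : cf; apply; exact: interval_open.
Qed.

Lemma continuous_shiftW g : continuous (@shiftW G W g : WG G W -> WG G W).
Proof.
move=> x; apply/ptws_cvgP => t.
exact: ((ptws_cvgP (F := nbhs x) x _).1 (fun=> id) (g^-1 * t)%g).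
Qed.

Lemma measurable_shiftW g : measurable_fun setT (@shiftW G W g).
Proof.
apply: (@measurability _ _ (WGB G W) (WGB G W) setT _ (@open (WG G W))); first by [].
move=> _ [Q oQ <-].
rewrite setTI; apply: sub_sigma_algebra.
by move/continuousP : (@continuous_shiftW g); apply.
Qed.

Lemma measurable_shiftW_action : measurable_action (@shiftW G W).
Proof.
split; last exact: measurable_shiftW.
split => [x|g h x]; apply/funext => k; rewrite /shiftW; first by rewrite invg1 mul1g.
by rewrite invgM mulgA.
Qed.

(** No countable base is used: the preimage of an open set is the union over [n] of the events that
    the first [n] letters already force membership, and each such event is decided by a
    finite-valued map. *)
Lemma measurable_to_WGB d (B : measurableType d) (a : G -> B -> B) (Y : finType)
  (D : B -> Y) (w : Y -> W) : measurable_action a -> fin_meas D ->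
  measurable_fun setT (fun b => (fun k => w (D (a k^-1%g b))) : WGB G W).
Proof.
move=> [_ ma] mD; pose phi b : WGB G W := fun k => w (D (a k^-1%g b)).
suff : measurable_fun setT phi by [].
apply: (@measurability _ _ B (WGB G W) setT phi (@open (WG G W))) => // _ [Q oQ <-].
rewrite setTI (_ : _ @^-1` _ = \bigcup_n [set b | agree_upto n (phi b) `<=` Q]).
  apply: bigcup_measurable => n _.
  pose Dn b : {ffun 'I_n -> Y} := [ffun i => D (a (en (val i))^-1%g b)].
  have mDn : fin_meas Dn by apply: fin_meas_ffun => i; exact: fin_meas_precomp.
  rewrite (_ : mkset _ = [set b | [set y : WG G W | forall i : 'I_n, y (en (val i)) = w (Dn b i)] `<=` Q]).
    exact: (fin_meas_pred (fun c : {ffun 'I_n -> Y} => [set y : WG G W | forall i : 'I_n, y (en (val i)) = w (c i)] `<=` Q) mDn).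
  apply/seteqP; split => b /= H y yb; apply: H => i.
    by move=> ilt; rewrite (yb (Ordinal ilt)) ffunE.
  by rewrite yb // ffunE.
apply/seteqP; split => b /=.
  by move=> Qb; have [n nQ] := nbhs_agree (open_nbhs_nbhs (conj oQ Qb)); exists n.
by move=> [n _]; apply.
Qed.

End ProductSpace.

Lemma Exp_fin (R : realType) d (T : measurableType d) (P : probability T R) (Y : finType)
  (D : T -> Y) (F : Y -> R) : fin_meas D ->
  \int[P]_x F (D x) = \sum_y fine (P [set x | D x = y]) * F y.
Proof.
move=> mD; rewrite (_ : (fun x => F (D x)) = fun x => \sum_y F y * \1_[set x | D x = y] x).
  have b1 y : bdd_meas (\1_[set x | D x = y] : T -> R) by exact: bdd_meas_indic.
  rewrite Exp_sum => [|y]; last exact: bdd_measZ.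
  by apply: eq_bigr => y _; rewrite ExpZ// Exp_indic// mulrC.
apply/funext => x; rewrite (bigD1 (D x))//= indicE mem_set// mulr1 big1 ?addr0// => y yD.
by rewrite indicE memNset ?mulr0// => /= Dx; rewrite Dx eqxx in yD.
Qed.

(** Partition the space by the rounded values of all the test functions and keep one point of each
    cell, with the mass of the cell as its weight. *)
Lemma sample_points (R : realType) d (T : measurableType d) (P : probability T R)
  (J : finType) (F : J -> T -> R) (e : R) : 0 < e ->
  (forall j, measurable_fun setT (F j)) -> (forall j x, `|F j x| <= 1) ->
  exists (X : finType) (om : X -> R) (x : X -> T),
    [/\ forall v, 0 <= om v, \sum_v om v = 1 &
        forall j, `|\sum_v om v * F j (x v) - \int[P]_y F j y| <= e].
Proof.
move=> e0 mF F1; have e2 : 0 < e / 2 by rewrite divr_gt0.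
have [n [c [A [mA HA]]]] := uniform_step_approx 1 e2.
pose D y : {ffun J * 'I_n -> bool} := [ffun p => `[< A p.2 (F p.1 y) >]].
have mD : fin_meas D.
  apply: fin_meas_ffun => p; apply: (@fin_meas_bool _ _ (F p.1 @^-1` A p.2)).
  by rewrite -[_ @^-1` _]setTI; exact: mF.
have HD y y' j : D y = D y' -> `|F j y - F j y'| <= e.
  move=> /ffunP E.
  have EA : \sum_(i < n) c i * \1_(A i) (F j y) = \sum_(i < n) c i * \1_(A i) (F j y').
    apply: eq_bigr => i _; have := E (j, i); rewrite !ffunE /= !indicE => Ei.
    by have -> : (F j y \in A i) = (F j y' \in A i) by exact: Ei.
  have := HA _ (F1 j y); have := HA _ (F1 j y'); rewrite EA distrC => h1 h2.
  have := lerD h2 h1; rewrite -splitr; apply: le_trans.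
  by apply: le_trans (ler_normD _ _); rewrite addrA subrK.
have /choice[x xD] : forall v, exists y, (exists y', D y' = v) -> D y = v.
  move=> v; have [[y Dy]|H] := pselect (exists y', D y' = v); first by exists y.
  (* An empty cell has weight 0, so its representative does not matter. *)
  by exists point.
exists _, (fun v => fine (P [set y | D y = v])), x; split.
- by move=> v; rewrite fine_ge0.
- by rewrite -[RHS](Exp_cst P 1) (Exp_fin P (fun=> 1) mD); apply: eq_bigr => v _; rewrite mulr1.
- move=> j; rewrite -(Exp_fin P (fun v => F j (x v)) mD).
  have bF : bdd_meas (F j) by split => //; exists 1.
  have bx : bdd_meas (fun y => F j (x (D y))) by exact: (fin_bdd (fun v => F j (x v)) mD).
  rewrite -ExpB//; apply: normr_Exp_le; first exact: bdd_measB.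
  by move=> y; apply: HD; apply: xD; exists y.
Qed.

Section FiniteWinners.
Context (R : realType) (L : nat) (X S : finType).
Implicit Types (z : {ffun S -> 'I_L * X}) (I U : {set S}).

Lemma wins_sum_pick z U I (g : S -> R) :
  \sum_(e in I) (wins z U e)%:R * g e =
  if [pick e in I | wins z U e] is Some e then g e else 0.
Proof.
case: pickP => [e /andP[eI we]|none]; last first.
  by rewrite big1// => e eI; have := none e; rewrite eI /= => ->; rewrite mul0r.
rewrite (bigD1 e)//= we mul1r big1 ?addr0// => e' /andP[_ ne].
have [we'|_] := boolP (wins z U e'); last by rewrite mul0r.
by rewrite (wins_unique we we') eqxx in ne.
Qed.

(** The value of [g] at the winner of [U] if it lies in [I], and 0 otherwise; written as a sum so
    that expectations are computed termwise. *)
Definition score (g : S -> X -> R) I U z := \sum_(e in I) (wins z U e)%:R * g e (z e).2.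

Lemma score_le1 g I U z : (forall e y, `|g e y| <= 1) -> `|score g I U z| <= 1.
Proof.
by move=> g1; rewrite /score (wins_sum_pick z U I (fun e => g e (z e).2)); case: pickP => [//|_]; rewrite normr0.
Qed.

Lemma score_cst_ge0 I U z : 0 <= score (fun _ _ => 1) I U z.
Proof. by apply: sumr_ge0 => e _; rewrite mulr1. Qed.

End FiniteWinners.

(** * The equivariant competition *)

Section Competition.
Context (R : realType) (G : groupType) (W : pseudoPMetricType R).
Context d (B : measurableType d) (a : G -> B -> B) (a_meas : measurable_action a).
Context (K : seq G) (M : nat) (N : G -> B -> nat) (K_uniq : uniq K)
  (N_meas : forall g n, measurable [set b | N g b = n])
  (N_le : forall g b, (N g b <= M)%N) (N_out : forall g b, g \notin K -> N g b = 0%N).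
Context (F hs : seq G) (F1 : 1%g \in F) (hs_uniq : uniq hs)
  (hs_mul : forall k h, k \in F -> h \in K -> (k * h)%g \in hs).

Notation slots := (seq_sub hs * 'I_M)%type.

(* A slot [(h, t)] enters at [b], seen from [k], when [t] is below the count of
   [k^-1 h] at [k^-1 b]; its label [c t (h^-1 b)] does not depend on [k]. *)
Definition entrants (k : G) (b : B) : {set slots} :=
  [set s : slots | (s.2 < N (k^-1 * ssval s.1)%g (a k^-1%g b))%N].
(** A slot of [all_entrants] that wins among [some_entrants] wins simultaneously at all points
    [k^-1 b] with [k] in [F]; near-equivariance of the counts makes the gap between the two sets
    small. *)
Definition some_entrants b : {set slots} := [set s | has (fun k => s \in entrants k b) F].
Definition all_entrants b : {set slots} := [set s | all (fun k => s \in entrants k b) F].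

Lemma all_entrants_sub b : all_entrants b \subset entrants 1%g b.
Proof. by apply/fintype.subsetP => s; rewrite inE => /allP/(_ _ F1). Qed.

Lemma entrants_sub b k : k \in F -> entrants k b \subset some_entrants b.
Proof. by move=> kF; apply/fintype.subsetP => s sE; rewrite inE; apply/hasP; exists k. Qed.

Let act1 : a 1%g =1 id. Proof. exact: a_meas.1.1. Qed.
Let actM g h b : a (g * h)%g b = a g (a h b). Proof. exact: a_meas.1.2. Qed.

Let mem_entrants1 b s : (s \in entrants 1%g b) = (s.2 < N (ssval s.1) b)%N.
Proof. by rewrite inE invg1 mul1g act1. Qed.

Lemma fin_meas_entrants k : fin_meas (entrants k).
Proof.
have mf : fin_meas (fun b => [ffun s : slots => (s.2 < N (k^-1 * ssval s.1)%g (a k^-1%g b))%N]).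
  apply: fin_meas_ffun => s; apply: (@fin_meas_precomp _ _ _ _ _ (fun b => (s.2 < N (k^-1 * ssval s.1)%g b)%N)).
    exact: a_meas.2.
  set g := (k^-1 * _)%g => v.
  rewrite (_ : mkset _ = \bigcup_(n in [set n | (s.2 < n)%N = v]) [set b | N g b = n]).
    by apply: bigcup_measurable => n _; exact: N_meas.
  by apply/seteqP; split => [b /= <-|b [n /= <- ->]//]; exists (N g b).
have -> : entrants k = fun b => finset [ffun s : slots => (s.2 < N (k^-1 * ssval s.1)%g (a k^-1%g b))%N].
  by apply/funext => b; apply/setP => s; rewrite !inE ffunE.
exact: (fin_meas_comp (fun f : {ffun slots -> bool} => finset f) mf).
Qed.

Let fin_meas_entrants_seq :
  fin_meas (fun b => [ffun i : 'I_(size F) => entrants (nth 1%g F i) b]).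
Proof. by apply: fin_meas_ffun => i; exact: fin_meas_entrants. Qed.

Lemma fin_meas_some_entrants : fin_meas some_entrants.
Proof.
have -> : some_entrants = fun b => finset (fun s => [exists i : 'I_(size F),
    s \in [ffun i : 'I_(size F) => entrants (nth 1%g F i) b] i]).
  apply/funext => b; apply/setP => s; rewrite !inE; apply/hasP/existsP.
    move=> [k kF sk]; have kl : (index k F < size F)%N by rewrite index_mem.
    by exists (Ordinal kl); rewrite ffunE /= nth_index.
  by move=> [i]; rewrite ffunE => si; exists (nth 1%g F i) => //; exact: mem_nth.
exact: (fin_meas_comp (fun f : {ffun 'I_(size F) -> {set slots}} => finset (fun s => [exists i, s \in f i])) fin_meas_entrants_seq).
Qed.

Lemma fin_meas_all_entrants : fin_meas all_entrants.
Proof.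
have -> : all_entrants = fun b => finset (fun s => [forall i : 'I_(size F),
    s \in [ffun i : 'I_(size F) => entrants (nth 1%g F i) b] i]).
  apply/funext => b; apply/setP => s; rewrite !inE; apply/allP/forallP.
    by move=> H i; rewrite ffunE; apply: H; exact: mem_nth.
  move=> H k kF; have kl : (index k F < size F)%N by rewrite index_mem.
  by have := H (Ordinal kl); rewrite ffunE /= nth_index.
exact: (fin_meas_comp (fun f : {ffun 'I_(size F) -> {set slots}} => finset (fun s => [forall i, s \in f i])) fin_meas_entrants_seq).
Qed.

Let perm_slots : perm_eq (map (@ssval _ hs) (index_enum (seq_sub hs))) hs.
Proof.
apply: uniq_perm => //; first by rewrite map_inj_uniq ?index_enum_uniq//; exact: val_inj.
move=> h; apply/mapP/idP => [[j _ ->]|hh]; first exact: ssvalP.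
by exists (SeqSub hh); rewrite ?mem_index_enum.
Qed.

Let sum_lt n : (n <= M)%N -> (\sum_(t < M) (t < n)%N = n)%N.
Proof.
move=> nM; rewrite -(big_mkord xpredT (fun t => (t < n)%N : nat)) (big_cat_nat _ (n := n))//=.
rewrite [X in (_ + X)%N]big_nat_cond [X in (_ + X)%N]big1 ?addn0; last first.
  by move=> t /andP[/andP[nt _] _]; rewrite ltnNge nt.
rewrite big_nat_cond (eq_bigr (fun=> 1%N)); last by move=> t /andP[/andP[_ ->]].
by rewrite -big_nat_cond sum_nat_const_nat subn0 muln1.
Qed.

Lemma sum_entrants1 (c : G -> R) b :
  \sum_(s in entrants 1%g b) c (ssval s.1) = \sum_(h <- K) (N h b)%:R * c h.
Proof.
rewrite big_mkcond /=.
pose f (j : seq_sub hs) (t : 'I_M) : R := (t < N (ssval j) b)%N%:R * c (ssval j).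
rewrite (eq_bigr (fun s : slots => f s.1 s.2)) => [|s _]; last first.
  by rewrite mem_entrants1 /f; case: ifP => _; rewrite ?mul1r ?mul0r.
rewrite -(pair_big xpredT xpredT f) /= /f.
rewrite (eq_bigr (fun j : seq_sub hs => (N (ssval j) b)%:R * c (ssval j))) => [|j _]; last first.
  by rewrite -mulr_suml -natr_sum sum_lt.
transitivity (\sum_(h <- hs) (N h b)%:R * c h).
  by rewrite -(perm_big _ perm_slots)/= big_map.
rewrite (bigID (mem K))/= [X in _ + X]big1 ?addr0; last first.
  by move=> h hK; rewrite N_out// mul0r.
rewrite -big_filter; apply: perm_big; apply: uniq_perm; rewrite ?filter_uniq//.
move=> h; rewrite mem_filter /=; have [hK|//] := boolP (h \in K) => /=.
by have := hs_mul F1 hK; rewrite mul1g.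
Qed.

Lemma card_entrants1 b : #|entrants 1%g b|%:R = \sum_(h <- K) (N h b)%:R :> R.
Proof.
rewrite -sum1_card natr_sum (sum_entrants1 (fun=> 1)).
by apply: eq_bigr => h _; rewrite mulr1.
Qed.

(** A slot in one set but not in the other enters from some [k] in [F] and not from [1], or
    conversely. For given [k] and [h], the number of such slots is the difference of the two counts,
    as entering means lying below a threshold. *)
Lemma card_entrants_diff b : (#|some_entrants b|%:R - #|all_entrants b|%:R : R) <=
  \sum_(k <- F) \sum_(h <- hs) `|(N (k^-1 * h)%g (a k^-1%g b))%:R - (N h b)%:R|.
Proof.
have abs_lt n m : (n <= M)%N -> (m <= M)%N ->
    \sum_(t < M) `|(t < n)%N%:R - (t < m)%N%:R| = `|n%:R - m%:R| :> R.
  wlog nm : n m / (n <= m)%N.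
    move=> H nM mM; case: (leqP n m) => [|/ltnW] nm; first exact: H.
    by rewrite distrC -H//; apply: eq_bigr => t _; rewrite distrC.
  move=> nM mM; rewrite distrC (ger0_norm (_ : 0 <= m%:R - n%:R)) ?subr_ge0 ?ler_nat//.
  rewrite -{2}(sum_lt mM) -{2}(sum_lt nM) !natr_sum -sumrB; apply: eq_bigr => t _.
  rewrite distrC ger0_norm// subr_ge0 ler_nat.
  by case: (ltnP t n) => // tn; rewrite (leq_trans tn).
have card_sum (A : {set slots}) : #|A|%:R = \sum_(s : slots) (s \in A)%:R :> R.
  by rewrite -sum1_card natr_sum big_mkcond; apply: eq_bigr => s _; case: (s \in A).
rewrite !card_sum -sumrB.
apply: (@le_trans _ _ (\sum_(s : slots) \sum_(k <- F)
    `|(s \in entrants k b)%:R - (s \in entrants 1%g b)%:R|)).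
  apply: ler_sum => s _.
  have pos k : 0 <= `|(s \in entrants k b)%:R - (s \in entrants 1%g b)%:R| :> R by [].
  have one k : k \in F -> (s \in entrants k b) != (s \in entrants 1%g b) ->
      1 <= \sum_(k <- F) `|(s \in entrants k b)%:R - (s \in entrants 1%g b)%:R| :> R.
    move=> kF ne; rewrite (big_rem k kF)/= -[leLHS]addr0 lerD ?sumr_ge0//.
    by case: (s \in entrants k b) ne; case: (s \in entrants 1%g b) => //= _; rewrite ?mulr0n ?subr0 ?sub0r ?normrN normr1.
  have ge0 : 0 <= \sum_(k <- F) `|(s \in entrants k b)%:R - (s \in entrants 1%g b)%:R| :> R by exact: sumr_ge0.
  have [sU|sU] := boolP (s \in some_entrants b); last by rewrite sub0r (le_trans _ ge0)// oppr_le0.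
  have [sI|sI] := boolP (s \in all_entrants b); first by rewrite subrr.
  rewrite subr0; move: sU sI; rewrite [s \in some_entrants b]inE [s \in all_entrants b]inE => /hasP[k kF sk] /allPn[k' k'F sk'].
  case s1 : (s.2 < N (ssval s.1) b)%N.
    by apply: (one k') => //; rewrite (negbTE sk') mem_entrants1 s1.
  by apply: (one k) => //; rewrite sk mem_entrants1 s1.
rewrite exchange_big; apply: ler_sum => k _ /=.
pose f (j : seq_sub hs) (t : 'I_M) : R :=
  `|((j, t) \in entrants k b)%:R - ((j, t) \in entrants 1%g b)%:R|.
rewrite (eq_bigr (fun s : slots => f s.1 s.2)) => [|[] //].
rewrite -(pair_big xpredT xpredT f) /=.
rewrite [leRHS](_ : _ = \sum_(j : seq_sub hs)
    `|(N (k^-1 * ssval j)%g (a k^-1%g b))%:R - (N (ssval j) b)%:R|).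
  apply: ler_sum => j _; rewrite -abs_lt//; apply: ler_sum => t _.
  by rewrite /f mem_entrants1 inE.
by rewrite -(perm_big _ perm_slots)/= big_map.
Qed.

Section Labels.
Context (L : nat) (X : finType) (c : 'I_M -> B -> 'I_L * X) (x : X -> WGB G W).

Definition labels b : {ffun slots -> 'I_L * X} := [ffun s => c s.2 (a (ssval s.1)^-1%g b)].

(** The letter at [1] of the winner's sample translated by the [h] of its slot; [point] when nobody
    wins. *)
Definition winner_value (p : {set slots} * {ffun slots -> 'I_L * X}) : W :=
  if [pick s | wins p.2 p.1 s] is Some s then x (p.2 s).2 (ssval s.1)^-1%g else point.

Definition factor_map b : WGB G W :=
  fun k => winner_value (entrants 1%g (a k^-1%g b), labels (a k^-1%g b)).

(** Equivariance holds at every point because the letter at [k] is a fixed function of [k^-1 b]. *)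
Lemma factor_map_equivariant g b : factor_map (a g b) = shiftW g (factor_map b).
Proof.
apply/funext => k; rewrite /shiftW /factor_map.
by rewrite -!actM invgM invgK.
Qed.

Lemma measurable_factor_map (en : nat -> G) (rk : G -> nat) :
  cancel rk en -> (forall t, fin_meas (c t)) -> measurable_fun setT factor_map.
Proof.
move=> rkK mc.
suff mD : fin_meas (fun b => (entrants 1%g b, labels b)).
  exact: (measurable_to_WGB rkK winner_value a_meas mD).
apply: fin_meas_pair; first exact: fin_meas_entrants.
by apply: fin_meas_ffun => s; apply: fin_meas_precomp => //; exact: a_meas.2.
Qed.

(** The winner among [some_entrants] still wins in the smaller set of entrants seen from [k], as
    long as it belongs to that set. Hence a single sample dictates all letters at positions in
    [F]. *)
Lemma factor_map_winner b s k : k \in F -> s \in all_entrants b ->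
  wins (labels b) (some_entrants b) s ->
  factor_map b k = shiftW (ssval s.1) (x (labels b s).2) k.
Proof.
move=> kF; rewrite inE => /allP/(_ k kF) sE /andP[_ /forallP win].
set b' := a k^-1%g b; set h := ssval s.1; set h' := (k^-1 * h)%g.
have inK g t : (t < N g b')%N -> g \in K.
  by move=> tN; apply/contraT => /N_out gN; rewrite gN in tN.
have inhs g : g \in K -> g \in hs by move=> /(hs_mul F1); rewrite mul1g.
have h'K : h' \in K by apply: (@inK _ s.2); move: sE; rewrite inE.
pose s' : slots := (SeqSub (inhs _ h'K), s.2).
(* The slot [(g, t)] at [k^-1 b] and the slot [(k * g, t)] at [b] read the same point
   [g^-1 k^-1 b]. *)
have labels_shift g t (gh : g \in hs) (kgh : (k * g)%g \in hs) :
    labels b' (SeqSub gh, t) = labels b (SeqSub kgh, t).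
  by rewrite !ffunE /= /b' -actM invgM.
have hE : (k * h')%g = h by rewrite mulVKg.
have labels_s : labels b' s' = labels b s.
  rewrite (labels_shift _ _ _ (hs_mul kF h'K)); congr (labels b _).
  by apply: injective_projections => //; apply: val_inj; rewrite /= hE.
have win' : wins (labels b') (entrants 1%g b') s'.
  rewrite /wins mem_entrants1; apply/andP; split; first by move: sE; rewrite inE.
  apply/forallP => -[[g gh] t]; apply/implyP; rewrite mem_entrants1 /= => /andP[tN ne].
  have kgh := hs_mul kF (inK _ _ tN); rewrite (labels_shift g t gh kgh) labels_s.
  have := win (SeqSub kgh, t); move/implyP; apply; apply/andP; split.
    rewrite inE; apply/hasP; exists k => //.
    by rewrite inE /= mulKg.
  apply: contra ne => /eqP sE'; apply/eqP; apply: injective_projections.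
    by apply: val_inj; rewrite /= /h' /h -sE' /= mulKg.
  by rewrite /= -sE'.
rewrite /factor_map -/b' /winner_value /=; case: pickP => [s2 w2|none]; last by rewrite none in win'.
rewrite (wins_unique w2 win') labels_s /shiftW /=; congr (x _ _).
by rewrite /h' invgM invgK.
Qed.

End Labels.

End Competition.

(** * Counts pulled back to an extension *)

Section ExtensionCounts.
Context (R : realType) (G : groupType) (G_countable : countable [set: G])
  (G_infinite : infinite_set [set: G]) (mu : G -> R)
  (mu_prob : prob_on_group mu) (mu_gen : supp_generates_semigroup mu)
  (P : probability (Omega G) R) (P_law : rw_law mu P).
Context d0 (B0 : measurableType d0) (a0 : G -> B0 -> B0) (beta : probability B0 R)
  (a0_meas : measurable_action a0) (p : Omega G -> B0)
  (p_inv : forall C, measurable C -> shift_invariant (p @^-1` C))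
  (p_full : forall A, shift_invariant A -> exists C : set B0, measurable C /\
        P ((A `\` p @^-1` C) `|` (p @^-1` C `\` A)) = 0%E)
  (p_law : forall C, measurable C -> beta C = P (p @^-1` C))
  (p_act : forall g, P.-negligible [set w | p (path_act g w) <> a0 g (p w)]).
Context d (B : measurableType d) (a : G -> B -> B) (nu : probability B R)
  (B_ext : is_extension a nu a0 beta).

Lemma extension_counts (F : seq G) e : 0 < e -> exists K (M : nat) (N : G -> B -> nat),
  [/\ uniq K /\ (0 < M)%N,
    (forall g n, measurable [set b | N g b = n]) /\ (forall g b, (N g b <= M)%N) /\
    (forall g b, g \notin K -> N g b = 0%N),
    forall k hs, k \in F -> uniq hs ->
      \int[nu]_b (\sum_(h <- hs) `|(N (k^-1 * h)%g (a k^-1%g b))%:R - (N h b)%:R|) <= e * M%:R,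
    \int[nu]_b `|M%:R - \sum_(h <- K) (N h b)%:R| <= e * M%:R &
    forall v : G -> R, harmonic P v -> (forall g, `|v g| <= 1) ->
      `|\sum_(h <- K) (\int[nu]_b (N h b)%:R) / M%:R * v h - v 1%g| <= e].
Proof.
move=> e0; have [pi [mpi [piE pi_law]]] := B_ext.
have [K [M [N [[uK M0] [mN [NM NK]] N1 N2 N3]]]] := boundary_counts G_countable G_infinite mu_prob
  mu_gen P_law a0_meas p_inv p_full p_law p_act F e0.
have tr (f : B0 -> R) : bdd_meas f -> (forall b, 0 <= f b) ->
    \int[nu]_b f (pi b) = \int[beta]_b f b.
  by move=> bf f0; rewrite /Rintegral (Rintegral_pushforward_eq mpi pi_law bf.1 f0).
have bN h : bdd_meas (fun b => (N h b)%:R : R) by exact: (bdd_meas_nat R (mN h) (NM h)).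
exists K, M, (fun g b => N g (pi b)); split => //.
- split; last by split => g b *; [exact: NM|exact: NK].
  by move=> g n; rewrite -[mkset _]setTI; exact: (mpi measurableT _ (mN g n)).
- move=> k hs kF uhs; under eq_Rintegral do under eq_bigr do rewrite piE.
  rewrite (tr (fun b => \sum_(h <- hs) `|(N (k^-1 * h)%g (a0 k^-1%g b))%:R - (N h b)%:R|)).
  + exact: N1.
  + apply: bdd_meas_sum => h; apply: bdd_meas_norm; apply: bdd_measB => //.
    by apply: (bdd_meas_comp (bN _)); exact: a0_meas.2.
  + by move=> b; apply: sumr_ge0.
- rewrite (tr (fun b => `|M%:R - \sum_(h <- K) (N h b)%:R|)) => //.
  by apply: bdd_meas_norm; apply: bdd_measB; [exact: bdd_meas_cst|exact: bdd_meas_sum].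
- move=> v hv v1; rewrite (eq_bigr (fun h => (\int[beta]_b (N h b)%:R) / M%:R * v h)); first exact: N3.
  by move=> h _; rewrite (tr (fun b => (N h b)%:R)).
Qed.

End ExtensionCounts.

(** * Assembling the approximation *)

Section Approximation.
Context (R : realType) (G : groupType) (G_countable : countable [set: G])
  (G_infinite : infinite_set [set: G]) (mu : G -> R)
  (mu_prob : prob_on_group mu) (mu_gen : supp_generates_semigroup mu)
  (P : probability (Omega G) R) (P_law : rw_law mu P)
  (W : pseudoPMetricType R) (W_compact : compact [set: W]).
Context d (B : measurableType d) (a : G -> B -> B) (nu : probability B R)
  (B_std : standard_borel R B) (a_meas : measurable_action a)
  (nu_stat : stationary mu a nu) (a_free : essentially_free a nu)
  (counts : forall (F : seq G) (e : R), 0 < e -> exists K (M : nat) (N : G -> B -> nat),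
  [/\ uniq K /\ (0 < M)%N,
    (forall g n, measurable [set b | N g b = n]) /\ (forall g b, (N g b <= M)%N) /\
    (forall g b, g \notin K -> N g b = 0%N),
    forall k hs, k \in F -> uniq hs ->
      \int[nu]_b (\sum_(h <- hs) `|(N (k^-1 * h)%g (a k^-1%g b))%:R - (N h b)%:R|) <= e * M%:R,
    \int[nu]_b `|M%:R - \sum_(h <- K) (N h b)%:R| <= e * M%:R &
    forall v : G -> R, harmonic P v -> (forall g, `|v g| <= 1) ->
      `|\sum_(h <- K) (\int[nu]_b (N h b)%:R) / M%:R * v h - v 1%g| <= e]).
Context (eta : probability (WGB G W) R) (eta_stat : P_mu mu W eta).
Context (n : nat) (f : 'I_n -> WGB G W -> R)
  (f_cont : forall i, continuous (f i : WG G W -> R^o)) (f_le1 : forall i x, `|f i x| <= 1).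

Let f_shift_meas i h : measurable_fun setT (fun y => f i (shiftW h y)).
Proof.
by apply: measurableT_comp; [exact: measurable_continuous_WGB|exact: measurable_shiftW].
Qed.

Let bf_shift i h : bdd_meas (fun y => f i (shiftW h y)).
Proof. by split => //; exists 1. Qed.

Let v i h : R := \int[eta]_y f i (shiftW h y).

Let v_harmonic i : harmonic P (v i).
Proof.
move=> g; rewrite /markov_op {2}/v.
rewrite (stationary_exp G_countable G_infinite mu_prob P_law (measurable_shiftW_action G W) eta_stat (bf_shift i g)).
apply: eq_Rintegral => w _; apply: eq_Rintegral => y _.
by rewrite (measurable_shiftW_action G W).1.2.
Qed.

Let v_le1 i h : `|v i h| <= 1.
Proof. by apply: normr_Exp_le. Qed.

Lemma act_negligible g h : g != h -> nu.-negligible [set b | a g b = a h b].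
Proof.
move=> gh; have [a1 aM] := a_meas.1.
have ne : (h^-1 * g)%g <> 1%g.
  by move=> E; move/eqP: gh; apply; rewrite -[LHS](mulVKg h) E mulg1.
apply: negligibleS (a_free ne) => b /= E.
by rewrite aM E -aM mulVg a1.
Qed.

Lemma act_nonatomic g x : nu.-negligible [set b | a g b = x].
Proof.
have [U [mU sepU]] := standard_borel_separating B_std.
have m1 := separated_singleton mU sepU.
have [a1 aM] := a_meas.1.
rewrite (_ : mkset _ = [set a g^-1%g x]).
  exists [set a g^-1%g x]; split => //.
  exact: (nonatomic G_countable G_infinite mu_prob P_law a_meas nu_stat mu_gen a_free).
apply/seteqP; split => b /=; first by move=> <-; rewrite -aM mulVg a1.
by move=> ->; rewrite -aM mulgV a1.
Qed.

Lemma factor_approximation e : 0 < e -> exists phi : B -> WGB G W,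
  [/\ measurable_fun setT phi, forall g b, phi (a g b) = shiftW g (phi b) &
      forall i, `|\int[nu]_b f i (phi b) - \int[eta]_y f i y| < e].
Proof.
(* The errors below add up to at most ten times [e1]: four from [s1] and [s2], one from [s3], two
   each from [s4] and [s5], one from [s6]. The bound by 1 keeps the total weight in [s5] at most
   2. *)
move=> e0; pose e1 := Num.min 1 (e / 11).
have e10 : 0 < e1 by rewrite lt_min ltr01 divr_gt0.
have e11 : e1 <= 1 by rewrite ge_min lexx.
have e1e : 10 * e1 < e.
  have : e1 <= e / 11 by rewrite ge_min lexx orbT.
  by rewrite ler_pdivlMr//; lra.
have [en [rk [enK rkK]]] := countable_infinite_bij G_countable G_infinite.
have /choice[m Hm] : forall i, exists m, forall x y : WG G W, agree_upto en m x y -> `|f i x - f i y| < e1.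
  move=> i; have [m mf] := continuous_agree W_compact rkK (@f_cont i) e10; exists m => x y; exact: mf.
(* Up to [e1], every [f i] depends only on the letters at positions in [F]. *)
pose F := 1%g :: [seq en j | j <- iota 0 (\max_i m i)].
have F1 : 1%g \in F by rewrite inE eqxx.
have F_det i x y : (forall k, k \in F -> y k = x k) -> `|f i x - f i y| < e1.
  move=> xy; apply: Hm => j jm; apply: xy; rewrite inE; apply/orP; right.
  apply: map_f; rewrite mem_iota /= add0n; apply: leq_trans jm _.
  exact: (leq_bigmax i).
(* One share for each [k] in [F], where counts are compared, and two for the total count, which
   enters [win_error] with factor 2. *)
pose e2 := e1 / (size F).+2%:R.
have e20 : 0 < e2 by rewrite divr_gt0.
have e2F : (size F)%:R * e2 + 2 * e2 <= e1.
  by rewrite -mulrDl -natrD addn2 /e2 mulrC divfK// pnatr_eq0.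
have e21 : e2 <= 1.
  apply: le_trans e11; apply: le_trans e2F; have := mulr_ge0 (ler0n R (size F)) (ltW e20); lra.
have [K [M [N [[uK M0] [mN [NM NK]] N1 N2 N3]]]] := counts F e20.
(* The product of [F] and [K] holds every slot that enters from some [k] in [F]. *)
pose hs := undup [seq (k * h)%g | k <- F, h <- K].
have uhs : uniq hs by exact: undup_uniq.
have hs_mul k h : k \in F -> h \in K -> (k * h)%g \in hs.
  by move=> kF hK; rewrite mem_undup; apply/allpairsP; exists (k, h).
have Khs h : h \in K -> h \in hs by move=> hK; rewrite -[h]mul1g hs_mul.
have [X [omX [x [om0 om1 Hx]]]] := sample_points (J := ('I_n * seq_sub hs)%type) eta
  (F := fun j y => f j.1 (shiftW (ssval j.2) y)) e10 (fun j => f_shift_meas j.1 (ssval j.2))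
  (fun j y => f_le1 j.1 _).
pose slots := (seq_sub hs * 'I_M)%type.
have [L [L0 HL]] : exists L, (0 < L)%N /\ #|{: slots}|%:R / L%:R <= e1.
  exists (Num.truncn (#|{: slots}|%:R / e1)).+1; split => //.
  by rewrite ler_pdivrMr// -ler_pdivrMl// mulrC ltW// truncnS_gt.
pose I := all_entrants a M N F hs.
pose U := some_entrants a M N F hs.
pose D b := (I b, U b).
have mD : fin_meas D.
  by apply: fin_meas_pair; [exact: fin_meas_all_entrants|exact: fin_meas_some_entrants].
pose gS i (s : slots) (w : X) := f i (shiftW (ssval s.1) (x w)).
(* [Some i] is the value of [f i] at the winning sample, [None] the indicator of failure; with the
   option index a single colouring controls all of them. *)
pose psi (o : option 'I_n) (A : {set slots} * {set slots}) (z : {ffun slots -> 'I_L * X}) : R :=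
  if o is Some i then score (gS i) A.1 A.2 z else 1 - score (fun _ _ => 1) A.1 A.2 z.
have psi0 A z : 0 <= psi None A z.
  rewrite subr_ge0 (le_trans (ler_norm _))//; apply: score_le1 => s w; by rewrite normr1.
have psi1 o A z : `|psi o A z| <= 1.
  case: o => [i|]; first by apply: score_le1 => s w; exact: f_le1.
  by rewrite ger0_norm ?psi0// /psi gerBl score_cst_ge0.
have bpsi o z : bdd_meas (fun b => psi o (D b) z) by exact: (fin_bdd (fun A => psi o A z) mD).
have om0L (w : 'I_L * X) : 0 <= label_weight omX w :> R by rewrite mulr_ge0// invr_ge0.
have [V [mV sepV]] := standard_borel_separating B_std.
(* Labels are read at the points [h^-1 b]: for distinct [h] these are almost surely distinct by
   freeness, and their laws have no atoms. *)
have [c [mc Hc]] := derandomize (nu := nu) mV sepV om0L (label_weight_sum1 L0 om1)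
  (J := seq_sub hs) (T := 'I_M) (t := fun j => a (ssval j)^-1%g) (fun j => a_meas.2 _)
  (fun j j' jj' => act_negligible (contra_neq (fun E => val_inj (invg_inj E)) jj'))
  (fun j y => act_nonatomic _ y)
  (Psi := fun o b z => psi o (D b) z) (fun o z => (bpsi o z).1) (fun o b z => psi1 o (D b) z) e10.
pose z b := labels a hs c b.
pose phi := factor_map a N hs c x.
have mphi : measurable_fun setT phi by exact: (measurable_factor_map a_meas mN hs x rkK mc).
exists phi; split => [//|g b|i]; first exact: factor_map_equivariant.
have mz : fin_meas z.
  by apply: fin_meas_ffun => s; apply: fin_meas_precomp => //; exact: a_meas.2.
have bpsiz o : bdd_meas (fun b => psi o (D b) (z b)).
  exact: (fin_bdd_meas (F := fun zz b => psi o (D b) zz) mz).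
have bphi : bdd_meas (fun b => f i (phi b)).
  split; last by exists 1.
  by apply: measurableT_comp => //; exact: measurable_continuous_WGB.
(* If a slot of [I b] wins, [phi b] agrees on [F] with the translated winning sample. Otherwise the
   score is 0 and [|f i| <= 1] is covered by the failure indicator. *)
have step1 b : `|f i (phi b) - psi (Some i) (D b) (z b)| <= e1 + psi None (D b) (z b).
  rewrite /psi /score (wins_sum_pick _ _ _ (fun s => gS i s (z b s).2)) (wins_sum_pick _ _ _ (fun=> 1)).
  case: pickP => [s /andP[sI sw]|none].
    rewrite subrr addr0 ltW//; apply: F_det => k kF; apply/esym.
    exact: (factor_map_winner a_meas NK F1 hs_mul x kF sI sw).
  rewrite !subr0; apply: le_trans (f_le1 _ _) _; by rewrite lerDr ltW.
(* The exact expectation of [psi] at [b] when the labels are independent. *)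
pose avg o b := \sum_z pweight (label_weight omX) z * psi o (D b) z.
have bavg o : bdd_meas (avg o) by apply: bdd_meas_sum => w; exact: bdd_measZ.
pose gam h := \sum_w omX w * f i (shiftW h (x w)).
have gam1 h : `|gam h| <= 1.
  rewrite (le_trans (ler_norm_sum _ _ _))// -[leRHS]om1; apply: ler_sum => w _.
  by rewrite normrM (ger0_norm (om0 _)) ler_piMr.
have IE b : I b \subset entrants a M N hs 1%g b by exact: all_entrants_sub.
have EU b : entrants a M N hs 1%g b \subset U b by exact: entrants_sub.
have IU b : I b \subset U b by exact: fintype.subset_trans (IE b) (EU b).
have avgS b : avg (Some i) b = win_weight R L #|U b| * \sum_(s in I b) gam (ssval s.1).
  exact: (wins_average L0 om1 (gS i) (IU b)).
have avgN b : avg None b = 1 - win_weight R L #|U b| * #|I b|%:R.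
  rewrite /avg; under eq_bigr do rewrite mulrBr mulr1.
  rewrite sumrB pweight_sum1; last exact: label_weight_sum1.
  rewrite (wins_average L0 om1 (fun _ _ => 1) (IU b)); congr (_ - _ * _).
  rewrite -sum1_card natr_sum; apply: eq_bigr => s _; rewrite -[RHS]om1.
  by apply: eq_bigr => w _; rewrite mulr1.
have M0R : 0 < M%:R :> R by rewrite ltr0n.
pose err b := win_error R L M (I b) (entrants a M N hs 1%g b) (U b).
have errS b : `|avg (Some i) b - M%:R^-1 * \sum_(h <- K) (N h b)%:R * gam h| <= err b.
  rewrite avgS -(sum_entrants1 a_meas uK NM NK F1 uhs hs_mul gam b).
  by apply: (win_error_sum L0 M0 (IE b) (EU b)) => s.
have errN b : avg None b <= err b by rewrite avgN; exact: win_error_fail.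
have bN h : bdd_meas (fun b => (N h b)%:R : R) by exact: (bdd_meas_nat R (mN h) (NM h)).
have bNa k h : bdd_meas (fun b => `|(N (k^-1 * h)%g (a k^-1%g b))%:R - (N h b)%:R| : R).
  apply: bdd_meas_norm; apply: bdd_measB => //.
  by apply: (bdd_meas_comp (bN _)); exact: a_meas.2.
have bM : bdd_meas (fun b => `|M%:R - \sum_(h <- K) (N h b)%:R| : R).
  by apply: bdd_meas_norm; apply: bdd_measB; [exact: bdd_meas_cst|exact: bdd_meas_sum].
(* Bounds [err] by the count errors, whose integrals are known: [e1] for ties, [2 * e2] for the
   total count and [e2] for each [k] in [F]. *)
pose err' b : R := e1 + 2 * (M%:R^-1 * `|M%:R - \sum_(h <- K) (N h b)%:R|) +
  M%:R^-1 * \sum_(k <- F) \sum_(h <- hs) `|(N (k^-1 * h)%g (a k^-1%g b))%:R - (N h b)%:R|.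
have bsum k : bdd_meas (fun b => \sum_(h <- hs) `|(N (k^-1 * h)%g (a k^-1%g b))%:R - (N h b)%:R| : R).
  exact: bdd_meas_sum.
have bsum2 : bdd_meas (fun b => \sum_(k <- F) \sum_(h <- hs) `|(N (k^-1 * h)%g (a k^-1%g b))%:R - (N h b)%:R| : R).
  exact: bdd_meas_sum.
have b12 : bdd_meas (fun b => e1 + 2 * (M%:R^-1 * `|M%:R - \sum_(h <- K) (N h b)%:R|) : R).
  by apply: bdd_measD; [exact: bdd_meas_cst|do 2 apply: bdd_measZ].
have berr : bdd_meas err' by apply: bdd_measD => //; exact: bdd_measZ.
have err_le b : err b <= err' b.
  rewrite /err /win_error /err' (card_entrants1 R a_meas uK NM NK F1 uhs hs_mul).
  apply: lerD; first by rewrite lerD// [_ / M%:R]mulrC.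
  rewrite mulrC ler_wpM2l ?invr_ge0//; exact: card_entrants_diff.
have Eerr : \int[nu]_b err' b <= 2 * e1.
  rewrite ExpD//; last exact: bdd_measZ.
  rewrite ExpD//; [|exact: bdd_meas_cst|by do 2 apply: bdd_measZ].
  rewrite Exp_cst !ExpZ//; last exact: bdd_measZ.
  rewrite Exp_sum//.
  have h1 : M%:R^-1 * \int[nu]_b `|M%:R - \sum_(h <- K) (N h b)%:R| <= e2.
    by rewrite ler_pdivrMl// mulrC.
  have h2 : M%:R^-1 * \sum_(k <- F) \int[nu]_b (\sum_(h <- hs) `|(N (k^-1 * h)%g (a k^-1%g b))%:R - (N h b)%:R|)
      <= (size F)%:R * e2.
    rewrite ler_pdivrMl//; apply: (@le_trans _ _ (\sum_(k <- F) e2 * M%:R)).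
      by rewrite big_seq [leRHS]big_seq; apply: ler_sum => k kF; exact: N1.
    rewrite big_const_seq count_predT iter_addr addr0 -[leLHS]mulr_natl.
    by rewrite [leRHS](_ : _ = (size F)%:R * (e2 * M%:R))//; ring.
  by move: e2F; lra.
have s1 : `|\int[nu]_b f i (phi b) - \int[nu]_b psi (Some i) (D b) (z b)| <=
    e1 + \int[nu]_b psi None (D b) (z b).
  rewrite -ExpB// (le_trans (normr_Exp _ _))//; first exact: bdd_measB.
  have bc : bdd_meas (fun _ : B => e1) by exact: bdd_meas_cst.
  rewrite -[X in X + _](Exp_cst nu e1) -(ExpD nu bc (bpsiz None)).
  by apply: le_Exp => //; [apply: bdd_meas_norm; exact: bdd_measB|exact: bdd_measD].
have s2 : \int[nu]_b psi None (D b) (z b) <= 3 * e1.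
  have := ltW (Hc None); rewrite ler_norml => /andP[_].
  have : \int[nu]_b avg None b <= \int[nu]_b err' b.
    by apply: le_Exp => // b; exact: le_trans (errN b) (err_le b).
  rewrite -/(\int[nu]_b psi None (D b) (z b)) -/(\int[nu]_b avg None b); lra.
have s3 : `|\int[nu]_b psi (Some i) (D b) (z b) - \int[nu]_b avg (Some i) b| < e1 := Hc (Some i).
have bK : bdd_meas (fun b => \sum_(h <- K) (N h b)%:R * gam h).
  by apply: bdd_meas_sum => h; apply: bdd_measM => //; exact: bdd_meas_cst.
have EK : \int[nu]_b (M%:R^-1 * \sum_(h <- K) (N h b)%:R * gam h) =
    \sum_(h <- K) (\int[nu]_b (N h b)%:R) / M%:R * gam h.
  rewrite ExpZ// Exp_sum => [|h]; last by apply: bdd_measM => //; exact: bdd_meas_cst.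
  rewrite mulr_sumr; apply: eq_bigr => h _.
  by under eq_Rintegral do rewrite mulrC; rewrite ExpZ// mulrCA mulrC [M%:R^-1 * _]mulrC.
have s4 : `|\int[nu]_b avg (Some i) b - \sum_(h <- K) (\int[nu]_b (N h b)%:R) / M%:R * gam h| <= 2 * e1.
  rewrite -EK -ExpB//; last exact: bdd_measZ.
  have bB : bdd_meas (fun b => avg (Some i) b - M%:R^-1 * \sum_(h <- K) (N h b)%:R * gam h).
    by apply: bdd_measB => //; exact: bdd_measZ.
  rewrite (le_trans (normr_Exp _ bB))// (le_trans _ Eerr)//; apply: le_Exp => //.
    exact: bdd_meas_norm.
  by move=> b; exact: le_trans (errS b) (err_le b).
(* Each sampled average is within [e1] of the integral against [eta], and the weights add up to at
   most [1 + e2], hence to at most 2. *)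
have s5 : `|\sum_(h <- K) (\int[nu]_b (N h b)%:R) / M%:R * gam h -
    \sum_(h <- K) (\int[nu]_b (N h b)%:R) / M%:R * v i h| <= 2 * e1.
  rewrite -sumrB (le_trans (ler_norm_sum _ _ _))//.
  apply: (@le_trans _ _ (\sum_(h <- K) (\int[nu]_b (N h b)%:R) / M%:R * e1)).
    rewrite big_seq [leRHS]big_seq; apply: ler_sum => h hK.
    have p0 : 0 <= (\int[nu]_b (N h b)%:R) / M%:R :> R by rewrite divr_ge0// Exp_ge0.
    rewrite -mulrBr normrM (ger0_norm p0) ler_wpM2l//.
    exact: (Hx (i, SeqSub (Khs _ hK))).
  rewrite -mulr_suml ler_wpM2r ?(ltW e10)// -mulr_suml ler_pdivrMr// -Exp_sum//.
  have bNK : bdd_meas (fun b => \sum_(h <- K) (N h b)%:R : R) by exact: bdd_meas_sum.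
  have bcM : bdd_meas (fun _ : B => M%:R : R) by exact: bdd_meas_cst.
  have := le_trans (normr_Exp nu (bdd_measB bcM bNK)) N2.
  rewrite (ExpB nu bcM bNK) Exp_cst ler_norml => /andP[+ _].
  have : e2 * M%:R <= 1 * M%:R by rewrite ler_pM2r.
  by move: (\int[nu]_b _) => t; lra.
have s6 := N3 (v i) (v_harmonic i) (v_le1 i).
have v1 : v i 1%g = \int[eta]_y f i y.
  by apply: eq_Rintegral => y _; rewrite (measurable_shiftW_action G W).1.1.
rewrite v1 in s6; have e2e1 : e2 <= e1.
  by apply: le_trans e2F; have := mulr_ge0 (ler0n R (size F)) (ltW e20); lra.
apply: le_lt_trans e1e.
move: s1 s2 s3 s4 s5 s6.
move: (\int[nu]_b f i (phi b)) (\int[nu]_b psi (Some i) (D b) (z b)) (\int[nu]_b psi None (D b) (z b))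
  (\int[nu]_b avg (Some i) b) (\sum_(h <- K) _ * gam h) (\sum_(h <- K) _ * v i h) (\int[eta]_y f i y).
move=> t1 t2 t3 t4 t5 t6 t7; rewrite !ler_norml ltr_norml.
move=> /andP[? ?] ? /andP[? ?] /andP[? ?] /andP[? ?] /andP[? ?].
by apply/andP; split; lra.
Qed.

End Approximation.

Theorem theorem4p1 (R : realType) (G : groupType)
  (G_countable : countable [set: G]) (G_infinite : infinite_set [set: G])
  (mu : G -> R) (mu_prob : prob_on_group mu)
  (mu_gen : supp_generates_semigroup mu)
  (W : pseudoPMetricType R) (W_hausdorff : hausdorff_space W)
  (W_compact : compact [set: W])
  (d0 : measure_display) (B0 : measurableType d0) (a0 : G -> B0 -> B0)
  (beta : probability B0 R) (B0_poisson : poisson_boundary mu a0 beta)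
  (d : measure_display) (B : measurableType d) (a : G -> B -> B)
  (nu : probability B R)
  (B_std : standard_borel R B) (a_meas : measurable_action a)
  (nu_stat : stationary mu a nu) (a_free : essentially_free a nu)
  (B_ext : is_extension a nu a0 beta) :
  weakstar_dense (Fact mu a nu W) (P_mu mu W).
Proof.
split; first by move=> eta [].
move=> eta eta_stat n f f_cont eps eps0.
have [_ [a0_meas [P [p [P_law [p_inv [p_full [p_law p_act]]]]]]]] := B0_poisson.
have /choice[c cP] : forall i, exists c, forall x, `|f i x| <= c.
  by move=> i; exact: (continuous_bounded W_compact (@f_cont i)).
(* A common bound that scales the [f i] to norm at most 1; the summand 1 keeps it positive. *)
pose C := 1 + \sum_i `|c i|.
have C0 : 0 < C by rewrite ltr_pwDl// sumr_ge0.
have fC i x : `|f i x| <= C.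
  apply: (le_trans (cP i x)); rewrite /C (bigD1 i)//= addrCA (le_trans (ler_norm _))// lerDl.
  by rewrite addr_ge0// sumr_ge0.
pose f1 i x := C^-1 * f i x.
have f1_cont i : continuous (f1 i : WG G W -> R^o).
  by move=> x; apply: cvgMr; exact: f_cont.
have f1_le1 i x : `|f1 i x| <= 1.
  by rewrite normrM normfV (gtr0_norm C0) ler_pdivrMl// mulr1.
have [phi [mphi phiE Hphi]] := factor_approximation G_countable G_infinite mu_prob mu_gen P_law
  W_compact B_std a_meas nu_stat a_free
  (fun F e => @extension_counts _ _ G_countable G_infinite _ mu_prob mu_gen _ P_law _ _ _ _ a0_meas
     _ p_inv p_full p_law p_act _ _ _ _ B_ext F e)
  eta_stat f1_cont f1_le1 (divr_gt0 eps0 C0).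
have mpA A : measurable A -> measurable (phi @^-1` A).
  by move=> mA; rewrite -[_ @^-1` _]setTI; exact: mphi.
pose Phi : {mfun B >-> WGB G W} := HB.pack phi (isMeasurableFun.Build _ _ _ _ _ mphi).
exists (distribution nu Phi); split.
  split; last by exists phi; split; [exact mphi|split].
  move=> A /mpA mA; transitivity (nu (phi @^-1` A)); first by [].
  rewrite nu_stat//; apply: eq_esum => g _; congr (_ * nu _)%E.
  by apply/seteqP; split => b /=; rewrite phiE.
move=> i; have bf : bdd_meas (f i).
  by split; [exact: measurable_continuous_WGB|exists C].
have bfphi : bdd_meas (fun b => f i (phi b)) by exact: bdd_meas_comp.
rewrite integral_distribution; last exact: bdd_meas_int.
  rewrite -(Exp_EFin eta bf) -[X in (X - _)%E](Exp_EFin nu bfphi) -EFinB lte_fin.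
  have := Hphi i; rewrite !ExpZ// -mulrBr normrM normfV (gtr0_norm C0) mulrC.
  by rewrite ltr_pM2r ?invr_gt0.
by apply/measurable_EFinP; exact: bf.1.
Qed.
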